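(* Let $\Omega\subset\mathbb C$ be a bounded domain with $C^3$-boundary such that $\pi_1(\Omega)\neq0$, and let $G:\mathcal F_2\Omega\to\mathbb R$ satisfy Hypothesis (G) (stated in the context). Then for any $N\in\mathbb N$ and any $\Gamma\in\mathbb R^N$ which is $\partial$-admissible and $\Delta$-admissible, the Kirchhoff--Routh path function $H_\Omega$ has a critical point in $\mathcal F_N\Omega$.
   Context: Identify $\mathbb C$ with $\mathbb R^2$; differentiability and gradients are meant in the real sense. For $M\in\mathbb N$, $\mathcal F_M\Omega:=\{z\in\Omega^M: z_i\neq z_j\text{ for }i\neq j\}$. For $\varepsilon>0$ put $\Omega_\varepsilon:=\{z\in\Omega:\operatorname{dist}(z,\partial\Omega)<\varepsilon\}$. Fix $\varepsilon_0>0$ so small that the orthogonal projection $p:\Omega_{\varepsilon_0}\to\partial\Omega$, $|p(z)-z|=\operatorname{dist}(z,\partial\Omega)$, is a well-defined $C^2$-map and the reflection $\bar z:=2p(z)-z$ of points $z\in\Omega_{\varepsilon_0}$ lies outside $\Omega$. Hypothesis (G): (i) $G$ is bounded below by a constant $C_0$; (ii) $(x,y)\mapsto G(x,y)+\frac1{2\pi}\ln|x-y|$ has a continuation $g\in C^1(\Omega^2)$ which is bounded above by some constant $C_1>0$; (iii) for every $\varepsilon>0$ there is $C_2>0$ depending only on $\Omega,\varepsilon$ with $|G(x,y)|+|\nabla_xG(x,y)|+|\nabla_yG(x,y)|\le C_2$ for all $x,y\in\Omega$ with $|x-y|\ge\varepsilon$; (iv) there is $C_3>0$ with $|\psi(x,y)|+|\nabla_x\psi(x,y)|+|\nabla_y\psi(x,y)|\le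 C_3$ for all $x,y\in\Omega_{\varepsilon_0}$, where $\psi(x,y)=g(x,y)-\frac1{2\pi}\ln|\bar x-y|$; (v) there is $C_4>0$ such that for any line $L=w+\mathbb Rv$ ($w\in\mathbb C$, $v\in S^1$) with $L\cap\Omega\ne\emptyset$, $G(w+rv,w+sv)-G(w+rv,w+tv)\ge -C_4$ for all $r<s<t$ for which the left-hand side is defined. With $h(x):=g(x,x)$, the Kirchhoff--Routh path function is $H_\Omega:\mathcal F_N\Omega\to\mathbb R$, $H_\Omega(z)=\sum_{j=1}^N\Gamma_j^2h(z_j)+\sum_{i,j=1,\,i\ne j}^N\Gamma_i\Gamma_jG(z_i,z_j)$. Admissibility of $\Gamma\in\mathbb R^N$ (sums over ordered pairs): - $\Delta$-admissible: $\sum_{i,j\in C,\,i\ne j}\Gamma_i\Gamma_j\ne0$ for every $C\subset\{1,\dots,N\}$, $|C|\ge2$. - $\partial$-admissible: $\sum_{i\in C}\Gamma_i^2>\sum_{i,j\in C,\,i\neq j}|\Gamma_i\Gamma_j|$ for every $C\subset\{1,\dots,N\}$, $|C|\ge2$. (For strictly convex $\Omega$ the definition is relaxed, but a domain with $\pi_1(\Omega)\ne0$ is never convex.) *)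

(* Defs.v *)
From mathcomp Require Import all_boot all_order all_algebra.
From mathcomp Require Import all_classical all_reals all_analysis.

Set Implicit Arguments.
Unset Strict Implicit.
Unset Printing Implicit Defensive.

Import Order.TTheory GRing.Theory Num.Theory.
Import numFieldNormedType.Exports.

Local Open Scope classical_set_scope.
Local Open Scope ring_scope.

(* C is identified with R^2.  The library norm on row vectors is the max-norm:
   it gives the right topology and the right notions of boundedness and
   differentiability, but distances and lengths are Euclidean and use [enorm]. *)
Notation plane R := 'rV[R]_2.

Section Plane.
Context {R : realType}.
Implicit Types (u v z : plane R) (A Omega : set (plane R)).

Definition dot u v : R := \sum_i u 0 i * v 0 i.

Definition enorm u : R := Num.sqrt (dot u u).

(* Multiplication by the imaginary unit. *)
Definition perp u : plane R := \row_i (if i == 0 then - u 0 1 else u 0 0).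

(* Only meaningful for nonempty [A], as [inf set0 = 0]. *)
Definition dist z A : R := inf [set enorm (z - w) | w in A].

Definition boundary A : set (plane R) := closure A `\` interior A.

Definition grad (f : plane R -> R) z : plane R :=
  \row_i 'D_(delta_mx 0 i) f z.

End Plane.

(* [f] is of class C^k on the open set [A], for a finite-dimensional domain:
   all iterated directional derivatives of order < k are differentiable on [A],
   and those of order k are continuous on [A]. *)
Fixpoint Ck {R : realType} {V W : normedModType R} (k : nat) (A : set V)
    (f : V -> W) : Prop :=
  if k is k'.+1 then
    (forall x, A x -> differentiable f x) /\ (forall v, Ck k' A ('D_v f))
  else forall x, A x -> {for x, continuous f}.

Section Domains.
Context {R : realType}.
Implicit Types (Omega : set (plane R)).

Definition domain Omega : Prop :=
  [/\ open Omega, connected Omega & Omega !=set0].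

(* Near each boundary point, in coordinates with respect to a positively
   oriented orthonormal frame (e, perp e), Omega is the epigraph of a
   C^3-function. *)
Definition C3_boundary Omega : Prop :=
  forall q, boundary Omega q ->
    exists (e : plane R) (gamma : R -> R),
      [/\ enorm e = 1, Ck 3 setT gamma &
          \forall z \near q, Omega z <-> gamma (dot z e) < dot z (perp e)].

Definition unit_interval : set R := [set` `[0, 1]].

Definition loop Omega (x : plane R) : set (R -> plane R) :=
  [set c | [/\ {within unit_interval, continuous c},
               forall t, unit_interval t -> Omega (c t),
               c 0 = x & c 1 = x]].

Definition loop_homotopic Omega (x : plane R) (c0 c1 : R -> plane R) : Prop :=
  exists H : R * R -> plane R,
    [/\ {within unit_interval `*` unit_interval, continuous H},
        forall s t, unit_interval s -> unit_interval t -> Omega (H (s, t)),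
        forall t, unit_interval t -> H (0, t) = c0 t,
        forall t, unit_interval t -> H (1, t) = c1 t &
        forall s, unit_interval s -> H (s, 0) = x /\ H (s, 1) = x].

Definition loop_class Omega (x : plane R) (c : R -> plane R) :
    set (R -> plane R) :=
  [set c' | loop Omega x c' /\ loop_homotopic Omega x c c'].

(* The underlying set of the fundamental group; its unit is the class of the
   constant loop. *)
Definition pi1 Omega (x : plane R) : set (set (R -> plane R)) :=
  [set loop_class Omega x c | c in loop Omega x].

(* For a domain the choice of the base point is irrelevant. *)
Definition pi1_nontrivial Omega : Prop :=
  exists2 x, Omega x & pi1 Omega x <> [set loop_class Omega x (cst x)].

Definition collar Omega (eps : R) : set (plane R) :=
  [set z | Omega z /\ dist z (boundary Omega) < eps].

Definition reflection (p : plane R -> plane R) (z : plane R) : plane R :=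
  2 *: p z - z.

(* eps0 is small enough, and p is the orthogonal projection onto the boundary;
   the values of p outside the collar are irrelevant. *)
Record collar_projection Omega (eps0 : R) (p : plane R -> plane R) : Prop := {
  collar_gt0 : 0 < eps0;
  proj_boundary : forall z, collar Omega eps0 z -> boundary Omega (p z);
  proj_dist : forall z, collar Omega eps0 z ->
    enorm (p z - z) = dist z (boundary Omega);
  proj_unique : forall z w, collar Omega eps0 z -> boundary Omega w ->
    enorm (w - z) = dist z (boundary Omega) -> w = p z;
  proj_C2 : Ck 2 (collar Omega eps0) p;
  reflection_outside : forall z, collar Omega eps0 z ->
    ~ Omega (reflection p z) }.

(* Row i of z is the i-th point of the configuration. *)
Definition config (N : nat) Omega : set 'M[R]_(N, 2) :=
  [set z | (forall i, Omega (row i z)) /\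
           (forall i j, i <> j -> row i z <> row j z)].

End Domains.

Section KirchhoffRouth.
Context {R : realType}.
Implicit Types (Omega : set (plane R)) (x y : plane R).

(* Only the values of G at pairs of distinct points of Omega, and the values of
   g on Omega x Omega, matter; there g is determined by G. *)
Implicit Types (G : plane R -> plane R -> R) (g : plane R * plane R -> R).

Definition psi (p : plane R -> plane R) g x y : R :=
  g (x, y) - (2 * pi)^-1 * ln (enorm (reflection p x - y)).

Definition C1_bound (F : plane R -> plane R -> R) x y : R :=
  `|F x y| + enorm (grad (fun x' => F x' y) x) + enorm (grad (F x) y).

Record hypothesis_G Omega (eps0 : R) (p : plane R -> plane R) G g : Prop := {
  G_bounded_below : exists C0 : R,
    forall x y, Omega x -> Omega y -> x <> y -> C0 <= G x y;
  g_continuation : forall x y, Omega x -> Omega y -> x <> y ->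
    g (x, y) = G x y + (2 * pi)^-1 * ln (enorm (x - y));
  g_C1 : Ck 1 (Omega `*` Omega) g;
  g_bounded_above : exists2 C1 : R, 0 < C1 &
    forall x y, Omega x -> Omega y -> g (x, y) <= C1;
  G_off_diagonal : forall eps : R, 0 < eps -> exists2 C2 : R, 0 < C2 &
    forall x y, Omega x -> Omega y -> eps <= enorm (x - y) ->
      C1_bound G x y <= C2;
  psi_bounded : exists2 C3 : R, 0 < C3 &
    forall x y, collar Omega eps0 x -> collar Omega eps0 y ->
      C1_bound (psi p g) x y <= C3;
  G_lines : exists2 C4 : R, 0 < C4 &
    forall w v : plane R, enorm v = 1 -> (exists a : R, Omega (w + a *: v)) ->
    forall r s t : R, r < s -> s < t ->
      Omega (w + r *: v) -> Omega (w + s *: v) -> Omega (w + t *: v) ->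
      - C4 <= G (w + r *: v) (w + s *: v) - G (w + r *: v) (w + t *: v) }.

Definition Delta_admissible (N : nat) (Gamma : 'rV[R]_N) : Prop :=
  forall C : {set 'I_N}, (2 <= #|C|)%N ->
    \sum_(i in C) \sum_(j in C | j != i) Gamma 0 i * Gamma 0 j != 0.

Definition boundary_admissible (N : nat) (Gamma : 'rV[R]_N) : Prop :=
  forall C : {set 'I_N}, (2 <= #|C|)%N ->
    \sum_(i in C) \sum_(j in C | j != i) `|Gamma 0 i * Gamma 0 j|
      < \sum_(i in C) Gamma 0 i ^+ 2.

Definition KirchhoffRouth (N : nat) (Gamma : 'rV[R]_N) G g
    (z : 'M[R]_(N, 2)) : R :=
  \sum_j Gamma 0 j ^+ 2 * g (row j z, row j z)
  + \sum_i \sum_(j | j != i) Gamma 0 i * Gamma 0 j * G (row i z) (row j z).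

Definition critical_point {V : normedModType R} (f : V -> R) (z : V) : Prop :=
  differentiable f z /\ forall v, 'd f z v = 0.

End KirchhoffRouth.

(* Main.v *)
Require Import Defs.
From HB Require Import structures.
From mathcomp Require finmap.
From mathcomp Require Import all_boot all_order all_algebra all_fingroup.
From mathcomp Require Import all_classical all_reals all_analysis.
From mathcomp Require Import zify ring lra.

(* Suppose that H has no critical point. Then H is steep in the following sense:
   there is A > 0 such that at every configuration z some direction v satisfies
   dH(z) v >= 1, |v_i| <= A dist(z_i, boundary) and |v_i - v_j| <= A |z_i - z_j|.
   Near the boundary of the configuration space one takes v_i = z_i - p(z_i) for
   the points i of a cluster C at the smallest scale, and v_i = 0 otherwise; by
   the reflection estimate, dH(z) v is about (2 pi)^-1 times a quantity
   >= sum_C Gamma_i^2 - sum_C |Gamma_i Gamma_j|, which is positive by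
   boundary-admissibility. Near a collision away from the boundary one takes the
   dilation of a cluster C, for which dH(z) v is about
   -+ (2 pi)^-1 sum_C Gamma_i Gamma_j, nonzero by Delta-admissibility. Because of
   the two bounds on v, the flow along such directions lasts forever, and it
   raises H by any prescribed amount.

   As pi_1 is nontrivial, the complement of Omega has a compact piece E that is
   separated from the rest. Let a be a point of E outside the closure of Omega.
   There are N disjoint closed curves in Omega around a, which gives a
   "torus" of configurations, one point on each curve, unrolled to R^N. On the
   configurations for which z_i lies on the ray with angle 2 pi i / N from a, the
   points are far from each other, so that H is bounded above there. The flow
   moves angles by a bounded amount only, hence by the Poincare-Miranda theorem
   the deformed unrolled torus still meets this set, although H has become as
   large as we like on it: a contradiction.

   The theorem of Poincare-Miranda comes from a combinatorial lemma on labelled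
   triangulated cubes, proved with mod 2 cup products. The existence of E and the
   curves are obtained on a fine square grid: a closed grid walk can be contracted
   by pushing it across squares if its winding number vanishes around each square
   that is not contained in Omega. *)

Set Implicit Arguments.
Unset Strict Implicit.
Unset Printing Implicit Defensive.

Import Order.TTheory GRing.Theory Num.Theory.
Import numFieldNormedType.Exports.

(** * Cup products and the mod 2 Kuhn lemma *)

(** In general the path function is bounded neither above nor below: collisions and the approach to
    the boundary drive it to infinity with signs that depend on the strengths. Hence minimizing or
    maximizing does not help, and two linked sets are needed. On the torus of configurations H is
    bounded below by compactness. On the rays it is bounded above even for points close to the
    boundary, since [g] is bounded above and G is bounded off the diagonal. The order of the
    constants is what makes the linking work. The lower bound of H on the torus depends only on a
    bound [d] for the distances of the curves from each other and from the boundary, not on the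
    number of their windings. So the required gain of H is known once [d] is, and with it the bound
    [C] on the change of the angles. Only then are the curves chosen, wound so often that their
    angles exceed [C] at both ends. *)

Section CupProduct.
Variable T : Type.
Implicit Types (l m : T -> bool) (ls : seq (T -> bool)) (c : seq T).

(** Booleans stand for Z/2: this is the cup product of the coboundaries of the 0-cochains [ls],
    evaluated on the ordered simplex [c], and 0 if the dimensions do not match. *)
Fixpoint cup ls c : bool :=
  match ls, c with
  | l :: ls', x :: ((y :: _) as c') => (l x (+) l y) && cup ls' c'
  | [::], [:: _] => true
  | _, _ => false
  end.

Fixpoint faces c : seq (seq T) :=
  if c is x :: c' then c' :: [seq x :: f | f <- faces c'] else [::].

(* The cochain [l_1 cup ... cup m cup ... cup l_k] in which [m] is a 0-cochain
   and the other factors are the coboundaries of the [l_i]. *)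
Fixpoint cup0 ls m ls' c : bool :=
  match ls, c with
  | [::], x :: _ => m x && cup ls' c
  | l :: ls, x :: ((y :: _) as c') => (l x (+) l y) && cup0 ls m ls' c'
  | _, _ => false
  end.

Lemma big_addb_andl (I : Type) (r : seq I) (b : bool) (F : I -> bool) :
  \big[addb/false]_(i <- r) (b && F i) = b && \big[addb/false]_(i <- r) F i.
Proof.
by elim: r => [|i r IH]; rewrite ?big_nil ?andbF // !big_cons IH andb_addr.
Qed.

(** A product of coboundaries is a cocycle. The faces without one of the first two vertices
    contribute [l y + l z] and [l x + l z] times the same product, the other faces [l x + l y] times
    a sum that is known by induction. *)
Lemma cup_closed ls c : size c = (size ls).+2 ->
  \big[addb/false]_(f <- faces c) cup ls f = false.
Proof.
elim: ls c => [|l ls IH] [|x [|y c]] //= [sz].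
  by case: c sz => // _; rewrite !big_cons big_nil.
have := IH (y :: c); rewrite /= sz => /(_ erefl).
rewrite /= !big_cons !big_map /= big_addb_andl.
move: (\big[addb/false]_(_ <- _) _) => b.
case: c sz => // z c _ /=.
by case: (cup ls (z :: c)); case: b => //; case: (l x); case: (l y); case: (l z).
Qed.

(** Leibniz rule: as the other factors are cocycles, only [m] is differentiated. *)
Lemma cup_leibniz ls m ls' c : size c = (size ls + size ls').+2 ->
  \big[addb/false]_(f <- faces c) cup0 ls m ls' f = cup (ls ++ m :: ls') c.
Proof.
elim: ls c => [|l ls IH] [|x [|y c]] //= [sz].
  have := @cup_closed ls' [:: x, y & c]; rewrite /= sz => /(_ erefl).
  rewrite /= !big_cons !big_map /= big_addb_andl.
  move: (\big[addb/false]_(_ <- _) _) => b.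
  by case: (cup ls' (y :: c)); case: (cup ls' (x :: c)); case: b => //;
     case: (m x); case: (m y).
have := IH (y :: c); rewrite /= sz => /(_ erefl).
rewrite /= !big_cons !big_map /= big_addb_andl.
move: (\big[addb/false]_(_ <- _) _) => b <-.
case: c sz => [|z c] // _ /=.
by case: (cup0 _ _ _ (z :: c)); case: b => //; case: (l x); case: (l y); case: (l z).
Qed.

Lemma cup_addb ls m m' ls' c :
  cup (ls ++ (fun x => m x (+) m' x) :: ls') c =
  cup (ls ++ m :: ls') c (+) cup (ls ++ m' :: ls') c.
Proof.
elim: ls c => [|l ls IH] [|x [|y c]] //=; last by rewrite IH andb_addr.
by case: (m x); case: (m y); case: (m' x); case: (m' y); case: (cup _ _).
Qed.

Lemma cup0_vanish ls m ls' c : (forall x, List.In x c -> m x = false) ->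
  cup0 ls m ls' c = false.
Proof.
elim: ls c => [|l ls IH] [|x [|y c]] //= h; rewrite ?h ?IH ?andbF //; first by left.
  by left.
by move=> z zc; apply: h; right.
Qed.

Lemma cup_const (l0 : T -> bool) ls c k b : k < size ls ->
  (forall x, List.In x c -> nth l0 ls k x = b) -> cup ls c = false.
Proof.
elim: ls c k => [//|l ls IH] [|x [|y c]] [|k] //= kl h.
  by rewrite !h ?addbb //; [right; left|left].
by rewrite (IH (y :: c) k) ?andbF // => z zc; apply: h; right.
Qed.

Lemma cup0_const (l0 : T -> bool) ls m ls' c k b :
  k < size ls + size ls' ->
  (forall x, List.In x c -> nth l0 (ls ++ ls') k x = b) ->
  cup0 ls m ls' c = false.
Proof.
elim: ls c k => [|l ls IH] [|x c] k //= kl h.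
  by rewrite (@cup_const l0 ls' (x :: c) k b) ?andbF.
case: c h => // y c; case: k kl => [|k] kl h.
  have {}h : forall z, List.In z [:: x, y & c] -> l z = b := h.
  by rewrite !h ?addbb //; [right; left|left].
by rewrite (IH (y :: c) k) ?andbF // => z zc; apply: h; right.
Qed.

Lemma cup_nth (l0 : T -> bool) (x0 : T) ls c : size c = (size ls).+1 ->
  cup ls c = all (fun k => nth l0 ls k (nth x0 c k) (+) nth l0 ls k (nth x0 c k.+1))
                 (iota 0 (size ls)).
Proof.
elim: ls c => [|l ls IH] [|x [|y c]] //= [sz].
rewrite (IH (y :: c)) /= ?sz //; congr (_ && _).
by rewrite -[1]/(1 + 0) iotaDl all_map.
Qed.

Lemma faces_rem (x0 : T) c :
  faces c = [seq take k c ++ drop k.+1 c | k <- iota 0 (size c)].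
Proof.
elim: c => [//|x c IH] /=; rewrite drop0; congr (_ :: _).
by rewrite IH -map_comp -[1]/(1 + 0) iotaDl -map_comp.
Qed.

End CupProduct.

(** * The mod 2 Kuhn lemma on the Freudenthal triangulation *)

Section Kuhn.
Variables n p : nat.
Hypothesis p_gt0 : 0 < p.

Local Notation vertex := {ffun 'I_n -> nat}.
Implicit Types (q : {ffun 'I_n -> 'I_p.+1}) (s : {perm 'I_n}).

(* Vertex [k] of the simplex of the Freudenthal triangulation with base point
   [q]: direction [i] is the [s i]-th one to be increased. *)
Definition vert q s (k : nat) : vertex := [ffun i => q i + (s i < k)].

Definition base q := [forall i, q i < p].

(** Evaluation on the mod 2 fundamental chain of the cube [0, p]^n, the sum of all its simplices. *)
Definition cup_total (ls : seq (vertex -> bool)) : bool :=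
  \big[addb/false]_(s : {perm 'I_n}) \big[addb/false]_(q | base q)
     cup ls [seq vert q s k | k <- iota 0 n.+1].

(** This cancels interior faces: an even [s] is paired with the odd [s * tperm i j]. *)
Lemma sum_swap (F : {perm 'I_n} -> bool) (i j : 'I_n) : i != j ->
  (forall s, F (s * tperm i j)%g = F s) ->
  \big[addb/false]_(s : {perm 'I_n}) F s = false.
Proof.
move=> ij FE; rewrite (bigID (fun s => odd_perm s)) /=.
rewrite [X in _ (+) X](reindex_inj (mulIg (tperm i j))) /=.
rewrite [X in _ (+) X](eq_big (fun s => odd_perm s) F) ?addbb // => s.
by rewrite odd_permM odd_tperm ij addbT negbK.
Qed.

(** A face in a hyperplane orthogonal to direction [j] is seen from both sides, by a cube and by its
    neighbour. The two counts differ only in the outer hyperplanes, where [B] vanishes. *)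
Lemma sum_shift (B : vertex -> bool) (j : 'I_n) :
  (forall q, (q j == 0 :> nat) || (q j == p :> nat) ->
     B [ffun i => q i : nat] = false) ->
  \big[addb/false]_(q | base q) B [ffun i => q i + (i == j)] =
  \big[addb/false]_(q | base q) B [ffun i => q i : nat].
Proof.
move=> B0.
(* The shift is cyclic in order to be injective; [Q] excludes the points where it wraps around. *)
pose sh q : {ffun 'I_n -> 'I_p.+1} := [ffun i => if i == j then ordS (q i) else q i].
have sh_inj : injective sh.
  move=> q q' /ffunP E; apply/ffunP => i; have := E i; rewrite !ffunE.
  by case: eqP => // _ /ordS_inj.
pose Q q := [forall i, if i == j then 0 < q i < p else q i < p].
transitivity (\big[addb/false]_(q | Q q) B [ffun i => q i : nat]); last first.
  rewrite [RHS](bigID (fun q => 0 < q j)) /=.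
  rewrite [X in _ = _ (+) X]big1 ?addbF => [|q /andP[_]]; last first.
    by rewrite -leqNgt leqn0 => q0; rewrite B0 // q0.
  apply: eq_bigl => q; apply/forallP/andP => [h|[/forallP h h'] i].
    split; last by have := h j; rewrite eqxx => /andP[].
    by apply/forallP => i; have := h i; case: eqP => // _ /andP[].
  by case: eqP => [->|_]; rewrite h ?h'.
rewrite [RHS](reindex_inj sh_inj) /=.
rewrite [LHS](bigID (fun q => (q j).+1 < p)) /=.
rewrite [X in _ (+) X]big1 ?addbF => [|q /andP[/forallP bq]]; last first.
  rewrite -leqNgt => qj; have {}qj : (q j).+1 = p by apply/eqP; rewrite eqn_leq qj bq.
  rewrite -(B0 (sh q)) ?ffunE ?eqxx /= ?qj ?modn_small ?ltnSn ?eqxx ?orbT //.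
  congr B; apply/ffunP => i; rewrite !ffunE.
  by case: eqP => [->|_]; rewrite ?addn0 // addn1 /= qj modn_small.
apply: eq_big => [q|q /andP[/forallP bq qj]].
  apply/andP/forallP => [[/forallP bq qj] i|h].
    by rewrite ffunE; case: eqP => [->|_] //=; rewrite modn_small ?qj // ltnW ?ltnS // ltnW.
  split; [apply/forallP => i|]; last first.
    have := h j; rewrite ffunE eqxx /=.
    have := ltn_ord (q j); rewrite ltnS leq_eqVlt => /orP[/eqP ->|qj].
      by rewrite modnn.
    by rewrite modn_small.
  have := h i; rewrite ffunE; case: eqP => [->|_] //= .
  have := ltn_ord (q j); rewrite ltnS leq_eqVlt => /orP[/eqP ->|qj _] //.
  by rewrite modnn.
congr B; apply/ffunP => i; rewrite !ffunE; case: eqP => [->|_]; rewrite ?addn0 //.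
by rewrite addn1 /= modn_small // ltnS ltnW.
Qed.

Definition proper_label (i : 'I_n) (l : vertex -> bool) :=
  forall v : vertex, (v i = 0 -> l v = false) /\ (v i = p -> l v = true).

(** Stokes: by the Leibniz rule this is a sum over the faces of all simplices. Faces that omit an
    inner vertex cancel by [sum_swap], the other ones by [sum_shift]. On the boundary of the cube
    the cochain vanishes: in direction [j] because [m] does, in a direction [i] different from [j]
    because the i-th label is constant there. *)
Lemma cup_total_boundary ls m ls' (j : 'I_n) : (size ls + size ls').+1 = n ->
  size ls = j ->
  (forall v : vertex, v j = 0 \/ v j = p -> m v = false) ->
  (forall i : 'I_n, i != j -> proper_label i (nth m (ls ++ m :: ls') i)) ->
  cup_total (ls ++ m :: ls') = false.
Proof.
move=> sz szl m0 good.
have n_gt0 : 0 < n by rewrite -sz.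
pose F k s q := cup0 ls m ls'
  [seq vert q s i | i <- take k (iota 0 n.+1) ++ drop k.+1 (iota 0 n.+1)].
have -> : cup_total (ls ++ m :: ls') =
   \big[addb/false]_(k <- iota 0 n.+1) \big[addb/false]_(s : {perm 'I_n})
     \big[addb/false]_(q | base q) F k s q.
  rewrite /cup_total {}/F.
  have [I0 I0E] : {I0 | I0 = iota 0 n.+1} by exists (iota 0 n.+1).
  rewrite -I0E [RHS]exchange_big; apply: eq_bigr => s _.
  rewrite [RHS]exchange_big; apply: eq_bigr => q _.
  rewrite -cup_leibniz ?size_map ?I0E ?size_iota ?sz // -I0E.
  rewrite (faces_rem [ffun=> 0]) big_map size_map I0E size_iota -I0E.
  by apply: eq_bigr => k _; rewrite map_cat map_take map_drop.
have -> : iota 0 n.+1 = 0 :: rcons (iota 1 n.-1) n.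
  have iE a b : iota a b.+1 = rcons (iota a b) (a + b).
    by rewrite -addn1 iotaD cats1.
  change (0 :: iota 1 n = 0 :: rcons (iota 1 n.-1) n).
  by rewrite -{1}(@prednK n n_gt0) iE add1n prednK.
rewrite big_cons -cats1 big_cat /= big_cons big_nil addbF.
rewrite [X in _ (+) (X (+) _)]big1_seq => [|k]; last first.
  rewrite /= mem_iota => /andP[k0 kn].
  have k1n : k.-1 < n by lia.
  have kn' : k < n by lia.
  apply: (@sum_swap _ (Ordinal k1n) (Ordinal kn')).
    by apply/eqP => /(congr1 val) /=; lia.
  move=> s; apply: eq_bigr => q _; rewrite /F; congr cup0.
  apply/eq_in_map => a ain; apply/ffunP => i; rewrite !ffunE; congr (_ + nat_of_bool _).
  have ak : a != k.
    apply/eqP => ak; move: ain; rewrite ak mem_cat.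
    have -> : iota 0 n.+1 = iota 0 k ++ k :: iota k.+1 (n - k).
      by rewrite -[_ :: _]/(iota k (n - k).+1) -{2}[k]add0n -iotaD; congr iota; lia.
    rewrite take_size_cat ?size_iota // mem_iota ltnn andbF /=.
    rewrite -cat_rcons drop_size_cat ?size_rcons ?size_iota //.
    by rewrite mem_iota ltnn.
  rewrite permM; case: tpermP => [->|->|] //=; move: ak; lia.
rewrite addFb.
(* The face of the simplex [(q, s)] without its first vertex is a face without last vertex: the base
   moves one step in the first direction of [s], and in [s * r] this direction becomes the last
   one. *)
have r_inj := @ord_pred_inj n; pose r := perm r_inj.
pose C s (v : vertex) := cup0 ls m ls' [seq [ffun i => v i + (s i < a)] | a <- iota 0 n].
have FC s q : F n s q = C s [ffun i => q i : nat].
  rewrite /F /C; congr cup0.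
  rewrite drop_oversize ?size_iota // cats0.
  rewrite -[X in take _ (iota 0 X)]addn1 iotaD take_size_cat ?size_iota //.
  by apply: eq_map => a; apply/ffunP => i; rewrite !ffunE.
have last_lt : n.-1 < n by lia.
pose ilast s : 'I_n := s^-1%g (Ordinal last_lt).
have F0 s q : F 0 s q = C (s * r)%g [ffun i => q i + (i == ilast (s * r)%g)].
  rewrite /F /C; congr cup0; rewrite take0 cat0s /= drop0.
  rewrite -[in LHS](addn0 1) iotaDl -map_comp; apply/eq_in_map => a.
  rewrite mem_iota /= add0n => an; apply/ffunP => i; rewrite !ffunE permM permE /=.
  have -> : (i == ilast (s * r)%g) = (s i == 0 :> nat).
    rewrite /ilast -(inj_eq (@perm_inj _ (s * r)%g)) permKV permM permE.
    rewrite -val_eqE /=; have := ltn_ord (s i).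
    case: (s i : nat) => [|b] /= bn; first by rewrite add0n modn_small ?eqxx //; lia.
    by rewrite modnDr modn_small; lia.
  have := ltn_ord (s i); case: (s i : nat) => [|b] /= bn.
    by rewrite add0n modn_small //; lia.
  by rewrite modnDr modn_small; lia.
have step s : \big[addb/false]_(q | base q) C s [ffun i => q i + (i == ilast s)] =
     \big[addb/false]_(q | base q) C s [ffun i => q i : nat].
  apply: sum_shift => q q0.
  have cst a : a \in iota 0 n -> (s (ilast s) < a) = false.
    by rewrite mem_iota /ilast permKV /=; lia.
  have inC x : List.In x [seq [ffun i => [ffun i0 => q i0 : nat] i + (s i < a)] | a <- iota 0 n] ->
      x (ilast s) = q (ilast s).
    elim: (iota 0 n) cst => //= a r' IH cst [<-|]; last first.
      by apply: IH => b bin; apply: cst; rewrite inE bin orbT.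
    by rewrite !ffunE; have := cst a; rewrite inE eqxx /= => ->; rewrite ?addn0.
  case: (eqVneq (ilast s) j) => [ej|nj].
    apply: cup0_vanish => x /inC; rewrite ej => xE; apply: m0; rewrite xE -ej.
    by case/orP: q0 => /eqP; [left|right].
  have [k [kn knth]] : exists k, k < size ls + size ls' /\
      nth m (ls ++ ls') k = nth m (ls ++ m :: ls') (ilast s).
    have := ltn_ord (ilast s); rewrite -{2}sz; rewrite -val_eqE /= in nj.
    move=> il; exists (if ilast s < size ls then ilast s : nat else (ilast s).-1).
    move: nj il; rewrite szl; move: (ilast s : nat) => a nj il.
    rewrite !nth_cat szl; case: ifP => aj; first by split; [lia|rewrite aj].
    split; first by lia.
    have -> : (a.-1 < j) = false by lia.
    by case ab: (a - j) => [|b]; [lia|congr nth; lia].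
  apply: (@cup0_const _ m _ _ _ _ k (q (ilast s) != 0 :> nat)) => // x /inC xE.
  rewrite knth; have [g0 g1] := good _ nj x; rewrite xE in g0 g1.
  by case/orP: q0 => /eqP qE; [rewrite g0|rewrite g1] => //; rewrite qE // -lt0n.
rewrite [X in X (+) _](eq_bigr (fun s => \big[addb/false]_(q | base q) F n (s * r)%g q)).
  by rewrite [X in _ (+) X](reindex_inj (mulIg r)) addbb.
move=> s _; rewrite -(eq_bigr _ (fun q _ => esym (F0 s q))) step.
by apply: eq_bigr => q _; rewrite FC.
Qed.

Definition top_label (i : 'I_n) (v : vertex) := v i == p.

Lemma top_label_proper i : proper_label i (top_label i).
Proof.
by move=> v; rewrite /top_label; split => ->; rewrite ?eqxx //; case: p p_gt0.
Qed.

(** Only one simplex counts: that the i-th label changes at the i-th step forces [s i = i] and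
    [q i = p.-1]. *)
Lemma cup_total_top : 0 < n -> cup_total [seq top_label i | i <- enum 'I_n] = true.
Proof.
move=> n_gt0.
pose q0 : {ffun 'I_n -> 'I_p.+1} := [ffun=> inord p.-1].
have q0E i : q0 i = p.-1 :> nat by rewrite ffunE inordK //; lia.
have cupE s q : base q ->
    cup [seq top_label i | i <- enum 'I_n] [seq vert q s k | k <- iota 0 n.+1] =
    ((s == 1%g) && (q == q0)).
  move=> /forallP bq.
  have i0 : 'I_n by exact: (Ordinal n_gt0).
  rewrite (@cup_nth _ xpred0 [ffun=> 0]); last first.
    by rewrite size_map size_iota size_map size_enum_ord.
  rewrite size_map size_enum_ord.
  have E (k : 'I_n) : nth xpred0 [seq top_label i | i <- enum 'I_n] k = top_label k.
    by rewrite (nth_map i0) ?size_enum_ord // nth_ord_enum.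
  have V k : k < n.+1 -> nth [ffun=> 0] [seq vert q s k0 | k0 <- iota 0 n.+1] k = vert q s k.
    by move=> kn; rewrite (nth_map 0) ?size_iota // nth_iota.
  apply/allP/andP => [h|[/eqP sE /eqP qE] k].
    have {}h (k : 'I_n) : s k = k /\ q k = p.-1 :> nat.
      have := h k; rewrite mem_iota ltn_ord => /(_ isT).
      rewrite E !V ?ltnS ?ltn_ord //; last by rewrite ltnW.
      rewrite /top_label !ffunE; have := bq k.
      move=> qk h'; have sk : s k = k :> nat.
        by apply/eqP; rewrite eqn_leq; move: h' qk; lia.
      by split; [apply/val_inj|move: h' qk; lia].
    split; apply/eqP; first by apply/permP => k; rewrite perm1; case: (h k).
    by apply/ffunP => k; apply/val_inj; rewrite /= q0E; case: (h k).
  rewrite mem_iota add0n => kn.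
  rewrite -[k]/(val (Ordinal kn)) E !V /= ?ltnS // 1?ltnW //.
  by rewrite sE qE /top_label !ffunE perm1 /= inordK; lia.
rewrite /cup_total (bigD1 1%g) //= [X in _ (+) X]big1 ?addbF => [|s s1]; last first.
  by apply: big1 => q bq; have := cupE s q bq; rewrite (negPf s1).
rewrite (bigD1 q0) /= => [|]; last by apply/forallP => i; rewrite q0E; lia.
rewrite big1 ?addbF => [|q /andP[bq q1]]; last first.
  by have := cupE 1%g q bq; rewrite (negPf q1) andbF.
have := cupE 1%g q0; rewrite !eqxx; apply.
by apply/forallP => i; rewrite q0E; lia.
Qed.

(** The labels are exchanged one by one for [top_label]. The difference of two proper labels for
    direction [j] vanishes on both faces in that direction, so that [cup_total] does not change. Its
    value is thus 1, and some simplex has a nonzero product. *)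
Lemma kuhn (l : 'I_n -> vertex -> bool) : (forall i, proper_label i (l i)) ->
  exists q s, base q /\
    forall i : 'I_n, l i (vert q s i) != l i (vert q s i.+1).
Proof.
move=> good; case: (posnP n) => [n0|n_gt0].
  have nI (i : 'I_n) : False by have := ltn_ord i; rewrite {2}n0.
  by exists [ffun=> ord0], 1%g; split => [|i]; [apply/forallP => i|]; case: (nI i).
pose mix m := [seq (if i < m then top_label i else l i) | i : 'I_n <- enum 'I_n].
have mixE m : m <= n -> cup_total (mix m) = true -> cup_total (mix 0) = true.
  elim: m => // m IH mn H; apply: IH; first by rewrite ltnW.
  pose j := Ordinal mn.
  pose ls := take m (mix m); pose ls' := drop m.+1 (mix m).
  have szm a : size (mix a) = n by rewrite size_map size_enum_ord.
  have nthm a (i : 'I_n) : nth xpred0 (mix a) i = if i < a then top_label i else l i.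
    by rewrite (nth_map j) ?size_enum_ord // nth_ord_enum.
  have E : mix m = ls ++ l j :: ls'.
    have := nthm m j; rewrite /= ltnn => <-.
    by rewrite -drop_nth ?szm // cat_take_drop.
  have E' : mix m.+1 = ls ++ top_label j :: ls'.
    apply: (@eq_from_nth _ xpred0).
      by rewrite (etrans (szm m.+1) (esym (szm m))) E !size_cat.
    rewrite szm => i iN; rewrite -[i]/(val (Ordinal iN)) nthm /=.
    have := nthm m (Ordinal iN); rewrite /= E !nth_cat.
    have -> : size ls = m by rewrite size_take szm mn.
    case: ltnP => im /=; first by rewrite ltnW ?ltnS // => ->.
    case im' : (i - m) => [|a] /=.
      have em : i = m by lia.
      have -> : i < m.+1 by lia.
      by move=> _; congr top_label; apply: val_inj.
    by have -> : (i < m.+1) = false by lia.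
  pose mu v := top_label j v (+) l j v.
  have : cup_total (ls ++ mu :: ls') = false.
    have szls : size ls = m by rewrite size_take szm mn.
    apply: (cup_total_boundary (j := j)) => //.
    - by have := szm m; rewrite E size_cat /= addnS.
    - move=> v; have [a b] := good j v; have [a' b'] := top_label_proper j v.
      by rewrite /mu; case=> h; [rewrite a ?a'|rewrite b ?b'].
    - move=> i ij.
      suff -> : nth mu (ls ++ mu :: ls') i = nth xpred0 (mix m) i.
        rewrite nthm; case: ifP => _; [exact: top_label_proper|exact: good].
      rewrite E !nth_cat szls; case: ltnP => im; first by apply: set_nth_default; rewrite szls.
      case im' : (i - m) => [|a] /=.
        by move: ij; rewrite -val_eqE /=; lia.
      by apply: set_nth_default; rewrite size_drop szm; have := ltn_ord i; lia.
  rewrite /cup_total.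
  under eq_bigr => s _ do under eq_bigr => q _ do rewrite cup_addb.
  under eq_bigr => s _ do rewrite big_split.
  rewrite big_split -/(cup_total (ls ++ top_label j :: ls')) -/(cup_total (ls ++ l j :: ls')).
  by rewrite -E -E' H -/(cup_total (mix m)) => /negbFE.
have topE : mix n = [seq top_label i | i <- enum 'I_n].
  by apply: eq_map => i; rewrite ltn_ord.
have {mixE} := mixE n (leqnn n); rewrite topE => /(_ (cup_total_top n_gt0)).
have -> : mix 0 = [seq l i | i <- enum 'I_n] by apply: eq_map.
move=> tot.
have : [exists s : {perm 'I_n}, exists q : {ffun 'I_n -> 'I_p.+1}, base q &&
    cup [seq l i | i <- enum 'I_n] [seq vert q s k | k <- iota 0 n.+1]].
  apply: contraT; rewrite negb_exists => /forallP h; move: tot.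
  rewrite /cup_total big1 // => s _; apply: big1 => q bq.
  by have := h s; rewrite negb_exists => /forallP /(_ q); rewrite bq => /negPf.
move=> /existsP[s /existsP[q /andP[bq]]].
rewrite (@cup_nth _ xpred0 [ffun=> 0]); last first.
  by rewrite size_map size_iota size_map size_enum_ord.
rewrite size_map size_enum_ord.
move=> /allP h; exists q, s; split=> // i.
have := h i; rewrite mem_iota ltn_ord => /(_ isT).
have -> : nth xpred0 [seq l i | i <- enum 'I_n] i = l i.
  by rewrite (nth_map i) ?size_enum_ord // nth_ord_enum.
have V k : k < n.+1 -> nth [ffun=> 0] [seq vert q s k0 | k0 <- iota 0 n.+1] k = vert q s k.
  by move=> kn; rewrite (nth_map 0) ?size_iota // nth_iota.
rewrite !V ?ltnS //; last by rewrite ltnW.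
by case: (l i _); case: (l i _).
Qed.

End Kuhn.

Local Open Scope ring_scope.

(** * Closed grid walks *)

Section Walks.
Notation V := (int * int)%type.
Implicit Types (u v a b : V) (m s L : seq V).

Definition step_sum (f : V -> V -> int) L : int :=
  \sum_(uv <- zip L (behead L)) f uv.1 uv.2.

Lemma step_sum_cons f u v L : step_sum f [:: u, v & L] = f u v + step_sum f (v :: L).
Proof. by rewrite /step_sum /= big_cons. Qed.

Lemma step_sum1 f u : step_sum f [:: u] = 0.
Proof. by rewrite /step_sum /= big_nil. Qed.

Lemma step_sum_cat f s1 v s2 :
  step_sum f (s1 ++ v :: s2) = step_sum f (rcons s1 v) + step_sum f (v :: s2).
Proof.
elim: s1 => [|u [|u' s1] IH] /=; first by rewrite step_sum1 add0r.
  by rewrite !step_sum_cons step_sum1 addr0.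
by rewrite step_sum_cons [in LHS]IH /= !step_sum_cons addrA.
Qed.

Lemma step_sum_telescope (g : V -> int) u m :
  step_sum (fun x y => g y - g x) (u :: m) = g (last u m) - g u.
Proof.
elim: m u => [|v m IH] u /=; first by rewrite step_sum1 subrr.
by rewrite step_sum_cons IH addrC subrKA.
Qed.

Lemma step_sum0 f L : (forall x y, x \in L -> y \in L -> f x y = 0) -> step_sum f L = 0.
Proof.
elim: L => [|u [|v L] IH] h; rewrite ?step_sum1 //; first by rewrite /step_sum big_nil.
rewrite step_sum_cons h ?inE ?eqxx ?orbT // IH ?addr0 // => x y xL yL.
by apply: h; rewrite inE ?xL ?yL orbT.
Qed.

Lemma step_sumD f g L :
  step_sum (fun x y => f x y + g x y) L = step_sum f L + step_sum g L.
Proof. exact: big_split. Qed.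

Lemma step_sumN f L : step_sum (fun x y => - f x y) L = - step_sum f L.
Proof. by rewrite /step_sum sumrN. Qed.

Lemma eq_step_sum f g (e : rel V) u m : path e u m ->
  (forall x y, e x y -> f x y = g x y) -> step_sum f (u :: m) = step_sum g (u :: m).
Proof.
move=> + fg; elim: m u => [|v m IH] u; first by rewrite !step_sum1.
by move=> /= /andP[uv vm]; rewrite !step_sum_cons (fg _ _ uv) IH.
Qed.

(* Signed number of crossings with the upward vertical ray that starts in the
   middle of the unit square with lower left corner [q]. *)
Definition crossing (q : V) u v : int :=
  if (q.2 < u.2) && (u.2 == v.2) then
    if (u.1 == q.1) && (v.1 == q.1 + 1) then 1
    else if (v.1 == q.1) && (u.1 == q.1 + 1) then -1 else 0
  else 0.

Definition adjacent u v : bool :=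
  ((u.1 == v.1) && ((u.2 == v.2 + 1) || (v.2 == u.2 + 1))) ||
  ((u.2 == v.2) && ((u.1 == v.1 + 1) || (v.1 == u.1 + 1))).

Definition lazy (e : rel V) : rel V := fun u v => (u == v) || e u v.

(** The powers of 4 make a walk lighter when a horizontal edge at height Y > 0 is pushed down by
    one: the edge is replaced by one of weight 4^(Y-1) and two vertical ones of weight 1, and
    4^(Y-1) + 2 < 4^Y. *)
Definition weight_step u v : nat :=
  if (u.2 == v.2) && (u.1 != v.1) then (4 ^ `|u.2|)%N else 1%N.

Definition weight L : nat := \sum_(uv <- zip L (behead L)) weight_step uv.1 uv.2.

Lemma weight_cons u v L : weight [:: u, v & L] = (weight_step u v + weight (v :: L))%N.
Proof. by rewrite /weight /= big_cons. Qed.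

Lemma weight1 u : weight [:: u] = 0%N.
Proof. by rewrite /weight /= big_nil. Qed.

Lemma weight_cat s1 v s2 :
  weight (s1 ++ v :: s2) = (weight (rcons s1 v) + weight (v :: s2))%N.
Proof.
elim: s1 => [|u [|u' s1] IH] /=; first by rewrite weight1 add0n.
  by rewrite !weight_cons weight1 addn0.
by rewrite weight_cons [in LHS]IH /= !weight_cons addnA.
Qed.

Lemma weight_step_gt0 u v : (0 < weight_step u v)%N.
Proof. by rewrite /weight_step; case: ifP => // _; rewrite expn_gt0. Qed.

Lemma path_splitN (r : rel V) u m : ~~ path r u m ->
  exists s1 v a s2, u :: m = s1 ++ [:: v, a & s2] /\ ~~ r v a.
Proof.
elim: m u => [//|a m IH] u /=; rewrite negb_and => /orP[nr|/IH].
  by exists [::], u, a, m.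
by move=> [s1 [v [b [s2 [E nr]]]]]; exists (u :: s1), v, b, s2; rewrite E.
Qed.

(** Rotation of a closed walk to the starting point [v]. *)
Lemma rebase s1 v s2 : last v s2 = head v s1 ->
  [/\ last v (s2 ++ behead (rcons s1 v)) = v,
      perm_eq (s2 ++ behead (rcons s1 v)) (behead (s1 ++ v :: s2)),
      forall f, step_sum f (v :: s2 ++ behead (rcons s1 v)) =
                step_sum f (s1 ++ v :: s2) &
      forall (e : rel V) u m, u :: m = s1 ++ v :: s2 -> path e u m ->
         path e v (s2 ++ behead (rcons s1 v))].
Proof.
case: s1 => [|u s1] /= hl; first by rewrite cats0; split=> // e u m [-> ->].
split.
- by rewrite last_cat hl last_rcons.
- by rewrite -cat_rcons perm_catC.
- move=> f; rewrite -[u :: s1 ++ _]/((u :: s1) ++ v :: s2) [RHS]step_sum_cat addrC /=.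
  have -> : v :: s2 ++ rcons s1 v = belast v s2 ++ u :: rcons s1 v.
    by rewrite -cat_rcons -hl -lastI.
  by rewrite step_sum_cat -hl -lastI.
- move=> e u' m [-> ->]; rewrite cat_path => /andP[p1 /= /andP[p2 p3]].
  by rewrite cat_path p3 hl rcons_path p1 p2.
Qed.

(** * Contraction of closed walks whose winding numbers vanish *)

Section Contraction.
Variables (e : rel V) (P : pred V) (E : seq V -> seq V -> Prop).
Hypothesis e_sym : symmetric e.
Hypothesis e_adj : forall u v, e u v -> adjacent u v.
Hypothesis e_pos : forall u v, e u v -> 0 < u.2.
Hypothesis P_edges : forall q, P q ->
  [/\ e (q.1, q.2 + 1) q, e q (q.1 + 1, q.2) & e (q.1 + 1, q.2) (q.1 + 1, q.2 + 1)].
Hypothesis P_cross : forall q u m, ~~ P q -> path (lazy e) u m -> last u m = u ->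
  step_sum (crossing q) (u :: m) = 0.
Hypothesis E_refl : forall u, E [:: u] [:: u].
Hypothesis E_trans : forall w w' w'', E w w' -> E w' w'' -> E w w''.
Hypothesis E_context : forall s1 s2 w w', E w w' -> E (s1 ++ w ++ s2) (s1 ++ w' ++ s2).
Hypothesis E_pause : forall u, E [:: u; u] [:: u].
Hypothesis E_back : forall u v, e u v -> E [:: u; v; u] [:: u].
Hypothesis E_pushr : forall q, P q ->
  E [:: (q.1, q.2 + 1); (q.1 + 1, q.2 + 1)]
    [:: (q.1, q.2 + 1); q; (q.1 + 1, q.2); (q.1 + 1, q.2 + 1)].
Hypothesis E_pushl : forall q, P q ->
  E [:: (q.1 + 1, q.2 + 1); (q.1, q.2 + 1)]
    [:: (q.1 + 1, q.2 + 1); (q.1 + 1, q.2); q; (q.1, q.2 + 1)].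

(** Otherwise both neighbours of a highest vertex [v] would be the point directly below it, and a
    simple closed walk with more than two steps does not visit a point twice. The walk is rotated to
    start at [v], which makes both neighbours visible. *)
Lemma top_edge u m (Y : int) : path e u m -> last u m = u -> uniq m ->
  (2 < size m)%N -> (forall x, x \in m -> x.2 <= Y) -> (exists2 v, v \in m & v.2 = Y) ->
  exists s1 v a s2, [/\ u :: m = s1 ++ [:: v, a & s2], v.2 = Y & a.2 = Y].
Proof.
move=> pm lm um szm mY [v vm vY].
have [|/path_splitN [s1 [b [a [s2 [Es]]]]]] :=
  boolP (path (fun x y => e x y && ~~ ((x.2 == Y) && (y.2 == Y))) u m); last first.
  have : path e u m = true by [].
  case: s1 Es => [[-> ->]|c s1 [-> ->]].
    by move=> /= /andP[-> _] /=; rewrite negbK => /andP[/eqP bY /eqP aY]; exists [::], b, a, s2.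
  rewrite cat_path => /and3P[_ _ /= /andP[-> _]] /=.
  by rewrite negbK => /andP[/eqP bY /eqP aY]; exists (c :: s1), b, a, s2.
move=> pY.
case/splitPr: vm pm pY lm um szm mY => p1 p2 pm pY lm um szm mY.
have [|hl hp _ hpath] := @rebase (u :: p1) v p2.
  by move: lm; rewrite last_cat /=.
have {}hpath := hpath _ u (p1 ++ v :: p2) erefl pY.
move: hpath hl; have : uniq (p2 ++ rcons p1 v) by rewrite (perm_uniq hp).
have : size (p2 ++ rcons p1 v) = size (p1 ++ v :: p2) by rewrite (perm_size hp).
have : forall x, x \in (p2 ++ rcons p1 v) -> x.2 <= Y.
  by move=> x; rewrite (perm_mem hp); exact: mY.
rewrite /=; case: (p2 ++ rcons p1 v) => [|a r] rY sz; first by rewrite -sz in szm.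
case/lastP: r rY sz => [|r b] rY sz; first by rewrite -sz in szm.
rewrite /= last_rcons => + + bv; rewrite bv.
case/lastP: r rY sz => [|r c] rY sz; first by rewrite -sz in szm.
rewrite /= rcons_path last_rcons => /andP[+ _] /and3P[/andP[va vaY] _ /andP[cv cvY]].
rewrite mem_rcons inE negb_or mem_rcons inE negb_or => /and3P[_ ac _].
exfalso; move/negP: ac; apply; apply/eqP.
have aY : a.2 <= Y by apply: rY; rewrite inE eqxx.
have cY : c.2 <= Y by apply: rY; rewrite inE !(mem_rcons, inE) eqxx !orbT.
move: (e_adj va) (e_adj cv) vaY cvY aY cY vY; rewrite /adjacent.
by case: (a) => a1 a2; case: (c) => c1 c2; case: (v) => v1 v2 /=; move=> *; congr (_, _); lia.
Qed.

Lemma path_lazy_uniq u m : path (lazy e) u m -> uniq (u :: m) -> path e u m.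
Proof.
elim: m u => //= a m IH u /andP[/orP[/eqP <-|-> /=] p]; first by rewrite inE eqxx.
by move=> /andP[_ um]; apply: IH.
Qed.

(** Induction on the weight. A walk with a repeated vertex is cut into two lighter closed walks. In
    a simple one an edge of maximal height is pushed down across the square [q] below it. *)
Lemma contract u m : path (lazy e) u m -> last u m = u -> E (u :: m) [:: u].
Proof.
have [n] := ubnP (weight (u :: m)); elim: n u m => // n IH u m wn pm lm.
have [um|] := boolP (uniq m); last first.
  have -> : uniq m = ~~ ~~ uniq m by rewrite negbK.
  rewrite negbK => nu.
  have [v [m1 [m2 [m3 mE]]]] : exists v m1 m2 m3, m = m1 ++ v :: m2 ++ v :: m3.
    elim: m nu {wn pm lm} => //= a m IHm; rewrite negb_and negbK => /orP[am|/IHm].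
      by case/splitPr: am => p1 p2; exists a, [::], p1, p2.
    by move=> [v [m1 [m2 [m3 ->]]]]; exists v, (a :: m1), m2, m3.
  move: pm lm wn; rewrite mE.
  rewrite last_cat /= last_cat /= cat_path /= cat_path /=.
  move=> /and5P[pm1 pv pm2 pv' pm3] lm3.
  rewrite -[u :: _]/((u :: m1) ++ _) weight_cat -[v :: _ ++ _]/((v :: m2) ++ _) weight_cat.
  have w1 : (0 < weight (rcons (u :: m1) v))%N.
    case: (m1) => [|c r] /=; rewrite ?weight_cons addn_gt0 ?weight_step_gt0 //.
  have w2 : (0 < weight (rcons (v :: m2) v))%N.
    case: (m2) => [|c r] /=; rewrite ?weight_cons addn_gt0 ?weight_step_gt0 //.
  move=> wn; apply: (E_trans (w' := (u :: m1) ++ v :: m3)).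
    have := E_context (u :: m1) m3 (IH v (rcons m2 v) _ _ _).
    rewrite /= cat_rcons; apply; first by move: w1 wn => /=; lia.
      by rewrite rcons_path pm2.
    by rewrite last_rcons.
  apply: IH; first by rewrite -[u :: _]/((u :: m1) ++ _) weight_cat; move: w2 wn => /=; lia.
    by rewrite cat_path /= pm1 pv.
  by rewrite last_cat.
case: m um pm lm wn => [|a m] um pm lm wn; first exact: E_refl.
case: m um pm lm wn => [|b m] um pm lm wn; first by move: lm => /= ->; exact: E_pause.
have pe : path e u [:: a, b & m].
  move: pm => /= /andP[/orP[/eqP ua|-> /=] pm]; last exact: (@path_lazy_uniq a (b :: m)).
  by move: um; rewrite /= -ua -{1}lm /= mem_last.
case: m um pm lm wn pe => [|c m] um pm lm wn pe.
  by move: lm pe => /= -> /andP[ua _]; exact: E_back.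
have aM : a \in [:: a, b, c & m] by rewrite inE eqxx.
have szM : (2 < size [:: a, b, c & m])%N by [].
move: {b c m} [:: a, b, c & m] um pm lm wn pe aM szM => M um pm lm wn pe aM szM.
pose Y := \big[Order.max/a.2]_(x <- M) x.2.
have MY x : x \in M -> x.2 <= Y by move=> xM; rewrite /Y; apply: le_bigmax_seq.
have [v vM vY] : exists2 v, v \in M & v.2 = Y.
  have : exists2 v, v \in a :: M & v.2 = Y.
    rewrite /Y; elim: (M) => [|x r [y yr yE]]; first by rewrite big_nil; exists a; rewrite ?inE.
    rewrite big_cons -yE; case: leP => _.
      by exists y => //; move: yr; rewrite !inE => /orP[->|->]; rewrite ?orbT.
    by exists x; rewrite // !inE eqxx orbT.
  by move=> [v]; rewrite inE => /orP[/eqP ->|vM] vY; [exists a|exists v].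
have [s1 [v' [a' [s2 [ME vY' aY]]]]] := top_edge pe lm um szM MY (ex_intro2 _ _ v vM vY).
move: pe lm um => {vM vY v}; rename v' into v; rename a' into d => pe lm um.
have va : e v d.
  move: (pe); case: s1 ME => [[-> ->]|x s1 [-> ->]]; first by move=> /= /andP[].
  by rewrite cat_path => /and3P[_ _ /= /andP[]].
have Y0 : 0 < Y by rewrite -vY'; exact: e_pos va.
have hv : (v.1 == d.1 + 1) || (d.1 == v.1 + 1).
  by move: (e_adj va); rewrite /adjacent; move: vY' aY; case: (v) (d) => [? ?] [? ?] /=; lia.
pose q : V := (Order.min v.1 d.1, Y - 1).
have crE x y : x.2 <= Y -> y.2 <= Y -> crossing q x y != 0 ->
    (x = v /\ y = d) \/ (x = d /\ y = v).
  rewrite /crossing /q /=; move: hv vY' aY.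
  case: (v) (d) (x) (y) => [v1 v2] [d1 d2] [x1 x2] [y1 y2] /= hv -> -> xY yY.
  case: ifP => // h; case: ifP => [h' _|_].
    case: (leP v1 d1) h' => [vd|dv] h'; [left|right].
      by split; congr (_, _); lia.
    by split; congr (_, _); lia.
  case: ifP => // h' _.
  case: (leP v1 d1) h' => [vd|dv] h'; [right|left].
    by split; congr (_, _); lia.
  by split; congr (_, _); lia.
(* The upward ray from [q] meets the walk only in the edge between [v] and [d], so that the winding
   number around [q] is 1 or -1. *)
have Pq : P q.
  apply/contraT => nPq; have := P_cross nPq pm lm.
  have [|rl rp rs _] := @rebase s1 v (d :: s2).
    have : last u M = head v s1 -> last v (d :: s2) = head v s1.
      by move=> <-; case: (s1) ME => [[-> ->]|x s1' [-> ->]] //=; rewrite last_cat.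
    by rewrite lm; case: (s1) ME => [[-> _]|x s1' [-> _]]; apply.
  rewrite ME -rs /=.
  move: rl rp; rewrite /=; set r := s2 ++ _ => rl rp.
  have {rp} rp : perm_eq (d :: r) M.
    by rewrite (perm_trans rp) //; case: (s1) ME => [[_ ->]|x s1' [_ ->]].
  have : uniq (d :: r) by rewrite (perm_uniq rp).
  have : size (d :: r) = size M by rewrite (perm_size rp).
  have rY x : x \in d :: r -> x.2 <= Y by rewrite (perm_mem rp); exact: MY.
  case: r rl rY rp => [|f r] /= rl rY _ szr; first by move: szM; rewrite -szr.
  case: r rl rY szr => [|f' r] /= rl rY szr; first by move: szM; rewrite -szr.
  move: szr => _.
  rewrite !inE !negb_or => /and4P[/and3P[df df' dr] /andP[ff' fr] _ _].
  rewrite step_sum_cons step_sum_cons.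
  rewrite [step_sum _ _]step_sum0 ?addr0 => [|x y xL yL]; last first.
    have [//|h] := eqVneq (crossing q x y) 0.
    case: (crE x y _ _ h) => [||[_ yd]|[xd _]].
    - by apply: rY; rewrite inE xL orbT.
    - by apply: rY; rewrite inE yL orbT.
    - by move: yL; rewrite yd !inE (negPf df) (negPf df') (negPf dr).
    - by move: xL; rewrite xd !inE (negPf df) (negPf df') (negPf dr).
  have -> : crossing q d f = 0.
    have [//|h] := eqVneq (crossing q d f) 0.
    case: (crE d f _ _ h) => [||[vd _]|[_ fv]].
    - by rewrite aY.
    - by apply: rY; rewrite !inE eqxx orbT.
    - by move: hv; rewrite vd; clear; lia.
    move: ff' fr; rewrite fv => /negPf vf' /negP []; have := mem_last f' r.
    by rewrite rl inE vf'.
  rewrite addr0 /crossing /q /=; move: hv vY' aY.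
  case: (v) (d) => [v1 v2] [d1 d2] /= hv -> ->.
  have -> : (Y - 1 < Y) && (Y == Y) by clear; lia.
  case: (leP v1 d1) => vd.
    by have -> : (v1 == v1) && (d1 == v1 + 1) by clear -hv vd; lia.
  have -> : (v1 == d1) && (d1 == d1 + 1) = false by clear -hv vd; lia.
  by have -> : (d1 == d1) && (v1 == d1 + 1) by clear -hv vd; lia.
have [v'' [d'' [Epush wlt pathc]]] : exists v'' d'',
    [/\ E [:: v; d] [:: v; v''; d''; d],
       (weight [:: v; v''; d''; d] < weight [:: v; d])%N &
       path e v [:: v''; d''; d]].
  have wlt (v1 d1 : int) L1 L2 : v1 != d1 ->
      L1 = [:: (v1, Y); (v1, Y - 1); (d1, Y - 1); (d1, Y)] ->
      L2 = [:: (v1, Y); (d1, Y)] -> (weight L1 < weight L2)%N.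
    move=> vd -> ->; rewrite !weight_cons !weight1 /weight_step /= !eqxx vd /= !andbF.
    have -> : `|Y|%N = `|Y - 1|%N.+1 by clear -Y0; lia.
    by rewrite expnS; have : (0 < 4 ^ `|Y - 1|)%N by [rewrite expn_gt0]; clear; lia.
  have [e1 e2 e3] := P_edges Pq.
  have YE : Y - 1 + 1 = Y by clear; lia.
  move: e1 e2 e3 (E_pushl Pq) (E_pushr Pq) hv; rewrite /q /= YE.
  move: vY' aY; case: (v) (d) => [v1 v2] [d1 d2] /= -> ->.
  case: (leP v1 d1) => vd e1 e2 e3 El Er hv.
    have dE : d1 = v1 + 1 by clear -hv vd; lia.
    rewrite -dE in e2 e3 El Er; exists (v1, Y - 1), (d1, Y - 1).
    by split=> //; [apply: (wlt v1 d1) => //; clear -dE; lia|rewrite e1 e2 e3].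
  have vE : v1 = d1 + 1 by clear -hv vd; lia.
  rewrite -vE in e2 e3 El Er; exists (v1, Y - 1), (d1, Y - 1).
  by split=> //; [apply: (wlt v1 d1) => //; clear -vE; lia|rewrite e_sym e3 e_sym e2 e_sym e1].
have Elong := E_context s1 s2 Epush; rewrite /= -ME in Elong.
apply: (E_trans Elong).
have [m' m'E] : exists m', s1 ++ [:: v, v'', d'', d & s2] = u :: m'.
  by case: (s1) ME => [[-> _]|x s1' [-> _]]; eexists.
rewrite m'E; apply: IH.
- rewrite -m'E; move: wn; rewrite ME !weight_cat; move: wlt.
  by rewrite !weight_cons !weight1; clear; lia.
- apply: (sub_path (e := e)) => [x y exy|]; first by rewrite /lazy exy orbT.
  move: pe m'E pathc; case: (s1) ME => [[-> ->]|x s1' [-> ->]] /=.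
    by move=> /andP[_ p2] [<-] /= /and4P[-> -> -> _].
  rewrite cat_path => /and4P[p1 p2 p3 p4] [<-] /and4P[q1 q2 q3 _].
  by rewrite cat_path /= p1 p2 q1 q2 q3.
- move: lm m'E; case: (s1) ME => [[-> ->]|x s1' [-> ->]] /= lm [<-] //.
  by move: lm; rewrite !last_cat.
Qed.

End Contraction.
End Walks.

Local Open Scope classical_set_scope.

(** * The Poincare-Miranda theorem *)

Section NormedTools.
Context {R : realType}.

Lemma near_ex (V : normedModType R) (x : V) (P : V -> Prop) :
  (\forall y \near x, P y) -> exists2 r : R, 0 < r & forall y, `|x - y| < r -> P y.
Proof. by move=> /nbhs_normP[r /= r0 h]; exists r => // y xy; apply: h. Qed.

Lemma ex_near (V : normedModType R) (x : V) (P : V -> Prop) (r : R) : 0 < r ->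
  (forall y, `|x - y| < r -> P y) -> \forall y \near x, P y.
Proof. by move=> r0 h; apply/nbhs_normP; exists r => //= y /h. Qed.

Lemma cont_ex (V W : normedModType R) (f : V -> W) (x : V) (e : R) : 0 < e ->
  {for x, continuous f} ->
  exists2 r : R, 0 < r & forall y, `|x - y| < r -> `|f x - f y| < e.
Proof. by move=> e0 /cvgrPdist_lt /(_ e e0) /near_ex. Qed.

Lemma ex_cont (V W : normedModType R) (f : V -> W) (x : V) :
  (forall e : R, 0 < e ->
     exists2 r : R, 0 < r & forall y, `|x - y| < r -> `|f x - f y| < e) ->
  {for x, continuous f}.
Proof.
move=> h; apply/cvgrPdist_lt => e e0.
by have [r r0 h'] := h e e0; exact: ex_near h'.
Qed.

(** The form in which compactness is mostly used below: a property of points and scales that holds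
    locally for all small scales [e] holds on [K] for all small [e], uniformly. *)
Lemma compact_unif (V : normedModType R) (K : set V) (P : V -> R -> Prop) :
  compact K ->
  (forall x, K x -> exists2 r : R, 0 < r &
     forall y e, K y -> `|x - y| < r -> 0 < e < r -> P y e) ->
  exists2 r : R, 0 < r & forall y e, K y -> 0 < e < r -> P y e.
Proof.
move=> /compact_near_coveringP/near_covering_withinP cK h.
have := @cK R (0 : R)^'+ (fun e y => P y e) _; case=> [x Kx|r /= r0 h'].
  have [r r0 h'] := h x Kx.
  exists ([set y | `|x - y| < r], [set e | 0 < e < r]) => /=.
    split; first by apply: ex_near r0 _.
    exists r => //= e /= er e0; rewrite e0 /=; move: er.
    by rewrite sub0r normrN gtr0_norm.
  by move=> [y e] [/= yr er] Ky; exact: h'.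
exists r => // y e Ky /andP[e0 er]; apply: h' => //=.
by rewrite sub0r normrN gtr0_norm.
Qed.

Lemma entry_le m n (M : 'M[R]_(m, n)) i j : `|M i j| <= `|M|.
Proof.
rewrite [leRHS]/Num.norm /= mx_normrE.
by apply/bigmax_geP; right => /=; exists (i, j).
Qed.

Lemma mx_norm_le m n (M : 'M[R]_(m, n)) (e : R) : 0 <= e ->
  (forall i j, `|M i j| <= e) -> `|M| <= e.
Proof.
move=> e0 h; rewrite [leLHS]/Num.norm /= mx_normrE.
by apply/bigmax_leP; split=> // -[i j] _ /=.
Qed.

Lemma mx_norm_lt m n (M : 'M[R]_(m, n)) (e : R) : 0 < e ->
  (forall i j, `|M i j| < e) -> `|M| < e.
Proof.
move=> e0 h; rewrite [ltLHS]/Num.norm /= mx_normrE.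
by apply/bigmax_ltP; split=> // -[i j] _ /=.
Qed.

End NormedTools.

Section ContinuousFunctions.
Context {R : realType} {T : topologicalType} {V : normedModType R}.

Lemma cont_add (f g : T -> V) : continuous f -> continuous g ->
  continuous (fun x => f x + g x).
Proof. by move=> cf cg x; apply: cvgD; [exact: cf|exact: cg]. Qed.

Lemma cont_sub (f g : T -> V) : continuous f -> continuous g ->
  continuous (fun x => f x - g x).
Proof. by move=> cf cg x; apply: cvgB; [exact: cf|exact: cg]. Qed.

Lemma cont_scale (a : T -> R) (f : T -> V) : continuous a -> continuous f ->
  continuous (fun x => a x *: f x).
Proof. by move=> ca cf x; apply: cvgZ; [exact: ca|exact: cf]. Qed.

Lemma cont_mul (a b : T -> R) : continuous a -> continuous b ->
  continuous (fun x => a x * b x).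
Proof. by move=> ca cf x; apply: cvgM; [exact: ca|exact: cf]. Qed.

Lemma cont_comp {U : topologicalType} (f : T -> U) (g : U -> V) :
  continuous f -> continuous g -> continuous (fun x => g (f x)).
Proof. by move=> cf cg x; apply: continuous_comp; [exact: cf|exact: cg]. Qed.

Lemma cont_max (f g : T -> R) : continuous f -> continuous g ->
  continuous (fun x => Num.max (f x) (g x)).
Proof. by move=> cf cg x; apply: (@continuous_max R T f g x); [exact: cf|exact: cg]. Qed.

Lemma cont_min (f g : T -> R) : continuous f -> continuous g ->
  continuous (fun x => Num.min (f x) (g x)).
Proof. by move=> cf cg x; apply: (@continuous_min R T f g x); [exact: cf|exact: cg]. Qed.

End ContinuousFunctions.

Lemma cube_compact (R : realType) n (M : R) :
  compact [set t : 'rV[R]_n | forall i, `|t 0 i| <= M].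
Proof.
have := @rV_compact R n (fun=> `[- M, M]%classic) (fun=> @segment_compact _ _ _).
congr (compact _); apply/seteqP; split=> t /= h i.
  by have := h i; rewrite in_itv /= ler_norml.
by rewrite in_itv /= -ler_norml; exact: h.
Qed.

(** Without a common zero there is, by compactness, a scale at which near every point of the cube
    some [F i] has a strict constant sign. With a mesh below this scale and the signs of the [F i]
    as labels, Kuhn's lemma yields a simplex on which every label changes. *)
Lemma poincare_miranda (R : realType) n (M : R) (F : 'I_n -> 'rV[R]_n -> R) :
  0 < M -> (forall i, continuous (F i)) ->
  (forall i (t : 'rV[R]_n), t 0 i = - M -> F i t <= 0) ->
  (forall i (t : 'rV[R]_n), t 0 i = M -> 0 <= F i t) ->
  exists t, forall i, F i t = 0.
Proof.
move=> M0 cF Fneg Fpos; apply: contrapT => nozero.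
pose K := [set t : 'rV[R]_n | forall i, `|t 0 i| <= M].
pose P (t : 'rV[R]_n) (e : R) := exists i,
  (forall u, `|t - u| <= e -> 0 < F i u) \/ (forall u, `|t - u| <= e -> F i u < 0).
have [|r r0 h] := @compact_unif R _ K P (@cube_compact R n M).
  move=> t _; have [i Fi] : exists i, F i t != 0.
    apply: contrapT => h; apply: nozero; exists t => i.
    by apply: contrapT => /eqP Fi; apply: h; exists i.
  have Fi0 : 0 < `|F i t| by rewrite normr_gt0.
  have [r r0 h] := cont_ex Fi0 (cF i t).
  exists (r / 2); first by rewrite divr_gt0.
  move=> y e _ ty /andP[e0 er]; exists i.
  have tu u : `|y - u| <= e -> `|F i t - F i u| < `|F i t|.
    move=> yu; apply: h; rewrite -(subrKA y).
    by apply: le_lt_trans (ler_normD _ _) _; rewrite (splitr r) ltrD // (le_lt_trans yu).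
  have [F0|F0] := ltP 0 (F i t); [left|right] => u /tu.
    by rewrite (gtr0_norm F0) ltr_distl => /andP[_]; lra.
  have {}F0 : F i t < 0 by rewrite lt_neqAle Fi.
  by rewrite (ltr0_norm F0) ltr_distl; lra.
pose p := (Num.trunc (2 * M / (r / 2))).+1.
have p0 : (0 < p)%N by [].
have pR : 0 < p%:R :> R by rewrite ltr0n.
have pr : 2 * M / p%:R < r / 2.
  rewrite ltr_pdivrMr // -ltr_pdivrMl ?divr_gt0 // [ltLHS]mulrC.
  exact: truncnS_gt.
pose x (v : {ffun 'I_n -> nat}) : 'rV[R]_n := \row_i (- M + 2 * M * (v i)%:R / p%:R).
(* The labels on the faces are prescribed, because [F i] may vanish there; they agree with its weak
   sign. *)
pose l (i : 'I_n) (v : {ffun 'I_n -> nat}) :=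
  if v i == 0%N then false else if v i == p then true else 0 < F i (x v).
have [|q [s [bq qs]]] := @kuhn n p p0 l.
  by move=> i v; rewrite /l; split=> ->; rewrite ?eqxx.
pose t := x [ffun i => q i : nat].
have Kt : K t.
  move=> i; rewrite mxE ffunE ler_norml lerDl; apply/andP; split.
    by rewrite divr_ge0 ?mulr_ge0 ?ler0n // ltW.
  have : 2 * M * (q i)%:R / p%:R <= 2 * M.
    rewrite ler_pdivrMr // ler_pM2l ?mulr_gt0 // ler_nat ltnW //.
    by have /forallP := bq; apply.
  by lra.
have r20 : 0 < r / 2 < r by lra.
have tv k : `|t - x (vert q s k)| <= r / 2.
  apply: mx_norm_le => [|a b]; first by case/andP: r20 => /ltW.
  rewrite !mxE !ffunE; apply: le_trans (ltW pr).
  rewrite natrD; set b' := (_ < _)%N; set c := (q b)%:R.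
  have -> : - M + 2 * M * c / p%:R - (- M + 2 * M * (c + b'%:R) / p%:R) =
     - (2 * M / p%:R * b'%:R) by field; rewrite gt_eqF.
  have A : 0 <= 2 * M / p%:R by rewrite divr_ge0 ?mulr_ge0 // ltW.
  by rewrite normrN ger0_norm ?(mulr_ge0 A) //; case: b'; rewrite /= ?mulr1 ?mulr0.
have Ftrue i v : l i v -> 0 <= F i (x v).
  rewrite /l; case: eqP => // _; case: eqP => [vp _|_ /ltW //].
  by apply: Fpos; rewrite mxE vp mulfK ?gt_eqF //; lra.
have Ffalse i v : ~~ l i v -> F i (x v) <= 0.
  rewrite /l; case: eqP => [v0 _|_].
    by apply: Fneg; rewrite mxE v0 mulr0 mul0r addr0.
  by case: eqP => // _; rewrite -leNgt.
have [i [hi|hi]] := h t _ Kt r20; have := qs i.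
- have : l i (vert q s i) by apply/negPn/negP => /Ffalse; rewrite leNgt hi.
  have : l i (vert q s i.+1) by apply/negPn/negP => /Ffalse; rewrite leNgt hi.
  by move=> -> ->.
- have /negPf -> : ~~ l i (vert q s i) by apply/negP => /Ftrue; rewrite leNgt hi.
  have /negPf -> : ~~ l i (vert q s i.+1) by apply/negP => /Ftrue; rewrite leNgt hi.
  by [].
Qed.

(** * Homotopies of loops *)

Section Homotopy.
Context {R : realType}.
Implicit Types (Omega K : set (plane R)) (x u v : plane R) (c : R -> plane R)
  (L : seq (plane R)).

Definition clamp (t : R) : R := Num.max 0 (Num.min 1 t).

Lemma clamp_in t : 0 <= clamp t <= 1.
Proof. by rewrite /clamp le_max lexx /= ge_max ler01 ge_min lexx. Qed.

Lemma clamp_id t : 0 <= t <= 1 -> clamp t = t.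
Proof. by move=> /andP[t0 t1]; rewrite /clamp min_r // max_r. Qed.

Lemma clamp_le0 t : t <= 0 -> clamp t = 0.
Proof. by move=> t0; rewrite /clamp max_l // ge_min t0 orbT. Qed.

Lemma clamp_ge1 t : 1 <= t -> clamp t = 1.
Proof. by move=> t1; rewrite /clamp min_l // max_r. Qed.

Lemma clamp_continuous : continuous clamp.
Proof.
apply: cont_max; first exact: cst_continuous.
by apply: cont_min; [exact: cst_continuous|move=> t; exact: cvg_id].
Qed.

Definition is_convex K := forall u v (t : R), K u -> K v -> 0 <= t <= 1 ->
  K ((1 - t) *: u + t *: v).

(* Homotopies of loops based at [x] that are given by globally defined
   continuous functions. *)
Definition hom Omega x c0 c1 := exists H : R * R -> plane R,
  [/\ continuous H, forall s t, Omega (H (s, t)),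
      forall t, 0 <= t <= 1 -> H (0, t) = c0 t,
      forall t, 0 <= t <= 1 -> H (1, t) = c1 t &
      forall s, H (s, 0) = x /\ H (s, 1) = x].

Lemma cont_pair1 (a : R -> R) : continuous a -> continuous (fun p : R * R => a p.1).
Proof. by move=> ca p; apply: continuous_comp; [exact: cvg_fst|exact: ca]. Qed.

Lemma cont_pair2 (V : normedModType R) (a : R -> V) :
  continuous a -> continuous (fun p : R * R => a p.2).
Proof. by move=> ca p; apply: continuous_comp; [exact: cvg_snd|exact: ca]. Qed.

Lemma cont_prod (a b : R * R -> R) : continuous a -> continuous b ->
  continuous (fun p : R * R => (a p, b p)).
Proof.
move=> ca cb p.
exact: (cvg_pair (G := nbhs (a p)) (H := nbhs (b p)) (ca p) (cb p)).
Qed.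

Lemma cont_affine (a b : R) : continuous (fun t : R => a * t + b).
Proof.
apply: cont_add; last exact: cst_continuous.
by apply: cont_mul; [exact: cst_continuous|move=> t; exact: cvg_id].
Qed.

Lemma hom_sym Omega x c0 c1 : hom Omega x c0 c1 -> hom Omega x c1 c0.
Proof.
move=> [H [cH HO H0 H1 Hx]]; exists (fun p => H (1 - p.1, p.2)).
apply: And5; last by move=> s; exact: Hx.
- move: {H0 H1 HO Hx} cH => cH.
  apply: (@cont_comp _ _ _ _ (fun p : R * R => (1 - p.1, p.2))); last exact: cH.
  apply: cont_prod; last by move=> p; exact: cvg_snd.
  by apply: (@cont_pair1 (fun s => 1 - s)); apply: (@cont_sub R _ R); [exact: cst_continuous|move=> t; exact: cvg_id].
- by move=> s t; exact: HO.
- by move=> t t01; rewrite subr0 H1.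
- by move=> t t01; rewrite subrr H0.
Qed.

(** The homotopies are glued by adding them and subtracting their common middle loop, with clamped
    times; continuity then needs no case distinction. *)
Lemma hom_trans Omega x c0 c1 c2 :
  hom Omega x c0 c1 -> hom Omega x c1 c2 -> hom Omega x c0 c2.
Proof.
move=> [H [cH HO H0 H1 Hx]] [H' [cH' HO' H0' H1' Hx']].
pose F (p : R * R) := H (clamp (2 * p.1 + 0), clamp p.2) +
  H' (clamp (2 * p.1 + -1), clamp p.2) - H (1, clamp p.2).
have mid t : H' (0, clamp t) = H (1, clamp t) by rewrite H1 ?H0' ?clamp_in.
have cc (a b : R) : continuous (fun p : R * R => (clamp (a * p.1 + b), clamp p.2)).
  apply: cont_prod; last by apply: cont_pair2; exact: clamp_continuous.
  apply: (@cont_pair1 (fun s => clamp (a * s + b))).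
  by apply: cont_comp; [exact: cont_affine|exact: clamp_continuous].
have F1 s t : s <= 1 / 2 -> F (s, t) = H (clamp (2 * s + 0), clamp t).
  move=> s2; rewrite /F /=.
  have -> : clamp (2 * s + -1) = 0 by apply: clamp_le0; lra.
  by rewrite mid addrK.
have F2 s t : 1 / 2 <= s -> F (s, t) = H' (clamp (2 * s + -1), clamp t).
  move=> s2; rewrite /F /=.
  have -> : clamp (2 * s + 0) = 1 by apply: clamp_ge1; lra.
  by rewrite [LHS]addrAC subrr add0r.
exists F; apply: And5.
- apply: cont_sub; first apply: cont_add.
  + exact: (cont_comp (cc 2 0)).
  + exact: (cont_comp (cc 2 (-1))).
  apply: (cont_comp (f := fun p : R * R => (1 : R, clamp p.2)) (g := H)); last exact: cH.
  apply: cont_prod; first by move=> p; exact: cvg_cst.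
  by apply: cont_pair2; exact: clamp_continuous.
- move=> s t; case: (leP s (1 / 2)) => [s2|/ltW s2]; first by rewrite F1.
  by rewrite F2.
- move=> t t01; rewrite F1; last by lra.
  by rewrite mulr0 addr0 [clamp t]clamp_id // clamp_le0 // H0.
- move=> t t01; rewrite F2; last by lra.
  have -> : clamp (2 * 1 + -1) = 1 by apply: clamp_ge1; lra.
  by rewrite [clamp t]clamp_id // H1'.
- move=> s; have k0 : clamp 0 = 0 by rewrite clamp_le0.
  have k1 : clamp 1 = 1 by rewrite clamp_ge1.
  by case: (leP s (1 / 2)) => [s2|/ltW s2]; [rewrite !F1 ?k0 ?k1|rewrite !F2 ?k0 ?k1].
Qed.

Lemma hom_straight Omega x c0 c1 : continuous c0 -> continuous c1 ->
  (forall t s, 0 <= t <= 1 -> 0 <= s <= 1 -> Omega ((1 - s) *: c0 t + s *: c1 t)) ->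
  c0 0 = x -> c0 1 = x -> c1 0 = x -> c1 1 = x -> hom Omega x c0 c1.
Proof.
move=> cc0 cc1 h c00 c01 c10 c11.
exists (fun p => (1 - clamp p.1) *: c0 (clamp p.2) + clamp p.1 *: c1 (clamp p.2)).
split.
- apply: cont_add; apply: cont_scale.
  + apply: (@cont_sub R _ R); first by move=> p; exact: cvg_cst.
    by apply: cont_pair1; exact: clamp_continuous.
  + by apply: (@cont_pair2 _ (fun t => c0 (clamp t))); apply: cont_comp => //; exact: clamp_continuous.
  + by apply: cont_pair1; exact: clamp_continuous.
  + by apply: (@cont_pair2 _ (fun t => c1 (clamp t))); apply: cont_comp => //; exact: clamp_continuous.
- by move=> s t /=; apply: h; exact: clamp_in.
- by move=> t t01 /=; rewrite clamp_le0 // subr0 scale1r scale0r addr0 clamp_id.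
- by move=> t t01 /=; rewrite clamp_ge1 // subrr scale1r scale0r add0r clamp_id.
- move=> s /=; have -> : clamp 0 = 0 by rewrite clamp_le0.
  have -> : clamp 1 = 1 by rewrite clamp_ge1.
  by rewrite c00 c01 c10 c11 -scalerDl subrK scale1r.
Qed.

Lemma hom_reparam Omega x c (a b : R -> R) : continuous c -> (forall t, Omega (c t)) ->
  continuous a -> continuous b -> a 0 = b 0 -> a 1 = b 1 ->
  c (a 0) = x -> c (a 1) = x -> hom Omega x (fun t => c (a t)) (fun t => c (b t)).
Proof.
move=> cc cO ca cb ab0 ab1 ca0 ca1.
exists (fun p => c ((1 - p.1) * a p.2 + p.1 * b p.2)); split=> //=.
- apply: cont_comp => //; apply: (@cont_add R _ R); apply: cont_mul.
  + by apply: (@cont_pair1 (fun s => 1 - s)); apply: (@cont_sub R _ R); [exact: cst_continuous|move=> t; exact: cvg_id].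
  + exact: cont_pair2.
  + by move=> p; exact: cvg_fst.
  + exact: cont_pair2.
- by move=> t _; rewrite subr0 mul1r mul0r addr0.
- by move=> t _; rewrite subrr mul1r mul0r add0r.
- by move=> s; rewrite -ab0 -ab1 -!mulrDl subrK !mul1r.
Qed.

(* The piecewise linear curve that visits the points of [L] at times
   0, 1, 2, ... *)
Fixpoint curve L (t : R) : plane R :=
  match L with
  | [::] => 0
  | u :: L' => match L' with
    | [::] => u
    | v :: _ => curve L' (Num.max 0 (t - 1)) + (1 - clamp t) *: (u - v)
    end
  end.

Lemma curve_cons u v L t : curve [:: u, v & L] t =
  curve (v :: L) (Num.max 0 (t - 1)) + (1 - clamp t) *: (u - v).
Proof. by []. Qed.

Lemma curve_le0 u L t : t <= 0 -> curve (u :: L) t = u.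
Proof.
elim: L u t => [//|v L IH] u t t0.
rewrite curve_cons IH ?clamp_le0 ?subr0 ?scale1r ?subrKC //.
by rewrite ge_max lexx /=; lra.
Qed.

Lemma curve_ge1 u v L t : 1 <= t -> curve [:: u, v & L] t = curve (v :: L) (t - 1).
Proof. by move=> t1; rewrite curve_cons clamp_ge1 // subrr scale0r addr0 max_r //; lra. Qed.

Lemma curve_le1 u v L t : 0 <= t <= 1 -> curve [:: u, v & L] t = (1 - t) *: u + t *: v.
Proof.
move=> /andP[t0 t1]; rewrite curve_cons max_l ?curve_le0 ?clamp_id ?t0 //; last by lra.
by apply/rowP => i; rewrite !mxE; ring.
Qed.

Lemma curve_continuous L : continuous (curve L).
Proof.
case: L => [|u L]; first exact: cst_continuous.
elim: L u => [|v L IH] u; first exact: cst_continuous.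
change (continuous (fun t : R => curve (v :: L) (Num.max 0 (t - 1)) + (1 - clamp t) *: (u - v))).
apply: cont_add.
  have cm : continuous (fun t : R => Num.max 0 (t - 1)).
    apply: cont_max; first exact: cst_continuous.
    by apply: (@cont_sub R _ R); [move=> t; exact: cvg_id|exact: cst_continuous].
  exact: (cont_comp cm (IH v)).
apply: cont_scale; last exact: cst_continuous.
by apply: (@cont_sub R _ R); [exact: cst_continuous|exact: clamp_continuous].
Qed.

Lemma curve_last u L t : (size L)%:R <= t -> curve (u :: L) t = last u L.
Proof.
elim: L u t => [//|v L IH] u t tL.
have L0 : 0 <= (size L)%:R :> R by rewrite ler0n.
have tL' : (size L)%:R + 1 <= t by rewrite natr1.
rewrite curve_ge1; last by lra.
by rewrite IH //; lra.
Qed.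

Lemma curve_cat_le u L L' t : t <= (size L)%:R -> curve (u :: L ++ L') t = curve (u :: L) t.
Proof.
elim: L u t => [|v L IH] u t tL; first by rewrite cat0s [RHS]/= curve_le0.
rewrite cat_cons !curve_cons IH // ge_max ler0n /=.
by move: tL; rewrite /= -natr1; lra.
Qed.

Lemma curve_cat_ge u L L' t : (size L)%:R <= t ->
  curve (u :: L ++ L') t = curve (last u L :: L') (t - (size L)%:R).
Proof.
elim: L u t => [|v L IH] u t tL; first by rewrite subr0.
have L0 : 0 <= (size L)%:R :> R by rewrite ler0n.
have tL' : (size L)%:R + 1 <= t by rewrite natr1.
rewrite cat_cons curve_ge1; last by lra.
rewrite IH; last by lra.
have -> : (size (v :: L))%:R = (size L)%:R + 1 :> R by rewrite natr1.
by congr (curve _ _); ring.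
Qed.

Lemma curve_convex K u L t : is_convex K -> (forall v, List.In v (u :: L) -> K v) ->
  K (curve (u :: L) t).
Proof.
move=> cK; elim: L u t => [|v L IH] u t h; first by apply: h; left.
case: (leP t 0) => [t0|/ltW t0]; first by rewrite curve_le0 //; apply: h; left.
case: (leP t 1) => [t1|/ltW t1].
  rewrite curve_le1 ?t0 //; apply: cK; rewrite ?t0 //; apply: h; first by left.
  by right; left.
by rewrite curve_ge1 //; apply: IH => w hw; apply: h; right.
Qed.

Fixpoint chain Omega L : Prop :=
  match L with
  | [::] => True
  | u :: L' => match L' with
    | [::] => Omega u
    | v :: _ => (forall t : R, 0 <= t <= 1 -> Omega ((1 - t) *: u + t *: v)) /\ chain Omega L'
    end
  end.

Lemma chain_curve Omega u L t : chain Omega (u :: L) -> Omega (curve (u :: L) t).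
Proof.
elim: L u t => [//|v L IH] u t [h c].
case: (leP t 0) => [t0|/ltW t0].
  by rewrite curve_le0 //; have := h 0; rewrite lexx ler01 subr0 scale1r scale0r addr0; apply.
case: (leP t 1) => [t1|/ltW t1]; first by rewrite curve_le1 ?t0 //; apply: h; rewrite t0.
by rewrite curve_ge1 //; apply: IH.
Qed.

Definition loop_of L (t : R) : plane R := curve L ((size L).-1%:R * t).

(* Times at which the curve of [s1 ++ m ++ s2] waits at the start of [m] while
   the curve of [s1 ++ m' ++ s2] uses up the [d] extra points of [m']. *)
Definition wait (i d : R) (t : R) : R := Num.min t i + Num.max 0 (t - i - d).

(** Under the time change [wait] the curves agree before and after the exchanged pieces; in between
    both are polygons with vertices in the convex set [K]. *)
Lemma curve_local K s1 u m m' s2 (d : nat) t : is_convex K ->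
  (forall v, List.In v (u :: m) -> K v) -> (forall v, List.In v (u :: m') -> K v) ->
  last u m = last u m' -> size m' = (size m + d)%N -> 0 <= t ->
  curve (s1 ++ u :: m ++ s2) (wait (size s1)%:R d%:R t) = curve (s1 ++ u :: m' ++ s2) t \/
  (K (curve (s1 ++ u :: m ++ s2) (wait (size s1)%:R d%:R t)) /\
   K (curve (s1 ++ u :: m' ++ s2) t)).
Proof.
move=> cK Km Km' lm sm; elim: s1 t => [|w s1 IH] t t0; rewrite ?cat0s ?cat_cons.
  have wE : wait 0 d%:R t = Num.max 0 (t - d%:R).
    by rewrite /wait (min_r t0) add0r subr0.
  rewrite wE; have d0 : 0 <= d%:R :> R by rewrite ler0n.
  have smR : (size m')%:R = (size m)%:R + d%:R :> R by rewrite sm natrD.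
  have m0 : 0 <= (size m)%:R :> R by rewrite ler0n.
  case: (leP t (size m')%:R) => [tm|/ltW tm].
    right; rewrite !curve_cat_le ?ge_max ?m0 /= //; last by lra.
    by split; apply: curve_convex.
  left; rewrite max_r; last by lra.
  rewrite curve_cat_ge; last by lra.
  by rewrite curve_cat_ge // lm smR; congr (curve _ _); ring.
have [v [r [r' [rE rE']]]] : exists v r r', s1 ++ u :: m ++ s2 = v :: r /\
    s1 ++ u :: m' ++ s2 = v :: r'.
  by case: (s1) => [|v s1'] /=; [exists u, (m ++ s2), (m' ++ s2)|
    exists v, (s1' ++ u :: m ++ s2), (s1' ++ u :: m' ++ s2)].
have s0 : 0 <= (size s1)%:R :> R by rewrite ler0n.
have d0 : 0 <= d%:R :> R by rewrite ler0n.
case: (leP t 1) => [t1|/ltW t1].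
  left; rewrite rE rE'.
  have -> : wait (size s1).+1%:R d%:R t = t.
    by rewrite /wait -natr1 min_l ?max_l ?addr0; lra.
  by rewrite !curve_le1 ?t0.
have w1 : 1 <= wait (size s1).+1%:R d%:R t.
  by rewrite /wait -natr1 !(minElt, maxElt); do ?case: ifP => ?; lra.
have wE : wait (size s1).+1%:R d%:R t - 1 = wait (size s1)%:R d%:R (t - 1).
  by rewrite /wait -natr1 !(minElt, maxElt); do ?case: ifP => ?; lra.
have t10 : 0 <= t - 1 by lra.
have := IH _ t10; rewrite rE rE'.
by rewrite !curve_ge1 // wE.
Qed.

Lemma wait_continuous i d : continuous (wait i d).
Proof.
apply: (@cont_add R _ R); first apply: cont_min.
- by move=> t; exact: cvg_id.
- exact: cst_continuous.
apply: cont_max; first exact: cst_continuous.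
apply: (@cont_sub R _ R); last exact: cst_continuous.
by apply: (@cont_sub R _ R); [move=> t; exact: cvg_id|exact: cst_continuous].
Qed.

Lemma chain_cat Omega u L L' :
  chain Omega (u :: L ++ L') <-> chain Omega (u :: L) /\ chain Omega (last u L :: L').
Proof.
elim: L u => [|v L IH] u /=.
  split=> [h|[]//]; split=> //; case: L' h => // w L' [h _].
  by have := h 0; rewrite lexx ler01 subr0 scale1r scale0r addr0; apply.
split=> [[h /IH[h1 h2]]|[[h h1] h2]]; first by [].
by split=> //; apply/IH.
Qed.

Lemma chain_convex Omega K u L : is_convex K -> K `<=` Omega ->
  (forall v, List.In v (u :: L) -> K v) -> chain Omega (u :: L).
Proof.
move=> cK KO; elim: L u => [|v L IH] u h; first by apply/KO/h; left.
split; last by apply: IH => w hw; apply: h; right.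
by move=> t t01; apply/KO/cK => //; apply: h; [left|right; left].
Qed.

(** Exchange of a piece inside any closed polygon in Omega based at [x]. That the new polygon is
    again admissible belongs to the conclusion, which makes the relation transitive. *)
Definition walk_equiv Omega x L L' := forall s1 s2,
  chain Omega (s1 ++ L ++ s2) -> head x (s1 ++ L ++ s2) = x ->
  last x (s1 ++ L ++ s2) = x ->
  [/\ chain Omega (s1 ++ L' ++ s2), head x (s1 ++ L' ++ s2) = x,
      last x (s1 ++ L' ++ s2) = x &
      hom Omega x (loop_of (s1 ++ L ++ s2)) (loop_of (s1 ++ L' ++ s2))].

Lemma loop_continuous L : continuous (loop_of L).
Proof.
have cm : continuous (fun t : R => (size L).-1%:R * t).
  by apply: cont_mul; [exact: cst_continuous|move=> t; exact: cvg_id].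
exact: (cont_comp cm (@curve_continuous L)).
Qed.

Lemma loop0 u L : loop_of (u :: L) 0 = u.
Proof. by rewrite /loop_of mulr0 curve_le0. Qed.

Lemma loop1 u L : loop_of (u :: L) 1 = last u L.
Proof. by rewrite /loop_of mulr1 curve_last. Qed.

(** A reparametrization to the time change [wait] is followed by a straight-line homotopy. The
    latter is constant where the curves agree and stays in [K] elsewhere. *)
Lemma hom_local Omega x K s1 u m m' s2 (d : nat) : is_convex K -> K `<=` Omega ->
  (forall v, List.In v (u :: m) -> K v) -> (forall v, List.In v (u :: m') -> K v) ->
  last u m = last u m' -> size m' = (size m + d)%N ->
  chain Omega (s1 ++ u :: m ++ s2) ->
  head x (s1 ++ u :: m ++ s2) = x -> last x (s1 ++ u :: m ++ s2) = x ->
  hom Omega x (loop_of (s1 ++ u :: m ++ s2)) (loop_of (s1 ++ u :: m' ++ s2)).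
Proof.
move=> cK KO Km Km' lm sm; set A := s1 ++ u :: m ++ s2; set B := s1 ++ u :: m' ++ s2.
move=> cA hA lA.
have [a [A' AE]] : exists a A', A = a :: A'.
  by rewrite /A; case: (s1) => [|a s1'] /=; eexists; eexists.
have [b [B' BE]] : exists b B', B = b :: B'.
  by rewrite /B; case: (s1) => [|a' s1'] /=; eexists; eexists.
have ba : b = a.
  by move: AE BE; rewrite /A /B; case: (s1) => [|? ?] /= [-> _] [-> _].
have lB : last x B = x.
  by move: lA; rewrite /A /B !last_cat /= !last_cat lm.
have sB : (size B).-1 = ((size A).-1 + d)%N.
  by rewrite /A /B !size_cat /= !size_cat sm; lia.
have sA : (size s1 <= (size A).-1)%N by rewrite /A !size_cat /= !size_cat; lia.
have sAR : (size s1)%:R <= (size A).-1%:R :> R by rewrite ler_nat.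
have sBR : (size B).-1%:R = (size A).-1%:R + d%:R :> R by rewrite sB natrD.
have s0 : 0 <= (size s1)%:R :> R by [].
have d0 : 0 <= d%:R :> R by [].
have A_O t : Omega (curve A t) by rewrite AE; apply: chain_curve; rewrite -AE.
pose w t := wait (size s1)%:R d%:R ((size B).-1%:R * t).
have w0 : w 0 = 0.
  by rewrite /w /wait mulr0 !(minElt, maxElt); do ?case: ifP => ?; lra.
have w1 : w 1 = (size A).-1%:R.
  by rewrite /w /wait mulr1 sBR !(minElt, maxElt); do ?case: ifP => ?; lra.
have wc : continuous w.
  apply: (@cont_comp R _ R); last exact: wait_continuous.
  by apply: cont_mul; [exact: cst_continuous|move=> t; exact: cvg_id].
have cA0 : curve A 0 = x by rewrite AE curve_le0 //; move: hA; rewrite AE.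
have cA1 : curve A (size A).-1%:R = x by rewrite AE curve_last //; move: lA; rewrite AE.
apply: (hom_trans (c1 := fun t => curve A (w t))).
  apply: hom_reparam; rewrite ?mulr0 ?mulr1 ?w0 ?w1 //; first exact: curve_continuous.
  by apply: cont_mul; [exact: cst_continuous|move=> t; exact: cvg_id].
apply: hom_straight; rewrite ?w0 ?w1 ?BE ?loop0 ?loop1 //.
- by apply: (cont_comp wc); exact: curve_continuous.
- exact: loop_continuous.
- move=> t s /andP[t0 t1] s01; rewrite -BE /loop_of.
  have nt0 : 0 <= (size B).-1%:R * t by rewrite mulr_ge0.
  have H := @curve_local K s1 u m m' s2 d _ cK Km Km' lm sm nt0.
  rewrite -/A -/B -/(w t) in H.
  case: H => [<-|[KA KB]]; first by rewrite -scalerDl subrK scale1r.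
  exact/KO/cK.
- by move: hA; rewrite AE ba.
- by move: lB; rewrite BE.
Qed.

Lemma chain_local Omega x K s1 u m m' s2 : is_convex K -> K `<=` Omega ->
  (forall v, List.In v (u :: m') -> K v) -> last u m = last u m' ->
  chain Omega (s1 ++ u :: m ++ s2) -> head x (s1 ++ u :: m ++ s2) = x ->
  last x (s1 ++ u :: m ++ s2) = x ->
  [/\ chain Omega (s1 ++ u :: m' ++ s2), head x (s1 ++ u :: m' ++ s2) = x &
      last x (s1 ++ u :: m' ++ s2) = x].
Proof.
move=> cK KO Km' lm cA hA lA; split.
- have c' : chain Omega (u :: m' ++ s2).
    apply/chain_cat; split; first exact: chain_convex cK KO Km'.
    rewrite -lm; case: s1 cA {hA lA} => [|w s1]; first by move=> /chain_cat[].
    by rewrite cat_cons => /(@chain_cat _ w (s1) (u :: m ++ s2)) [_ []] _ /chain_cat[].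
  case: s1 cA {hA lA} => // w s1 /=; elim: s1 w => [|v s1 IH] w /=.
    by move=> [h _]; split.
  by move=> [h /IH c]; split.
- by move: hA; case: (s1).
- by move: lA; rewrite !last_cat /= !last_cat lm.
Qed.

Lemma walk_equiv_local Omega x K u m m' : is_convex K -> K `<=` Omega ->
  (forall v, List.In v (u :: m) -> K v) -> (forall v, List.In v (u :: m') -> K v) ->
  last u m = last u m' -> walk_equiv Omega x (u :: m) (u :: m').
Proof.
move=> cK KO Km Km' lm s1 s2 /= cA hA lA.
have [cB hB lB] := chain_local cK KO Km' lm cA hA lA; split=> //.
case: (leqP (size m) (size m')) => [le|/ltnW le].
  by apply: (hom_local cK KO Km Km' lm _ cA hA lA); symmetry; exact: subnKC.
apply: hom_sym; apply: (hom_local cK KO Km' Km (esym lm) _ cB hB lB).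
by symmetry; exact: subnKC.
Qed.

Lemma walk_equiv_trans Omega x L L' L'' :
  walk_equiv Omega x L L' -> walk_equiv Omega x L' L'' -> walk_equiv Omega x L L''.
Proof.
move=> h h' s1 s2 c hd la; have [c1 hd1 la1 H1] := h _ _ c hd la.
have [c2 hd2 la2 H2] := h' _ _ c1 hd1 la1; split=> //.
exact: hom_trans H1 H2.
Qed.

Lemma walk_equiv_context Omega x s1 s2 L L' :
  walk_equiv Omega x L L' -> walk_equiv Omega x (s1 ++ L ++ s2) (s1 ++ L' ++ s2).
Proof. by move=> h t1 t2; have := h (t1 ++ s1) (s2 ++ t2); rewrite -!catA. Qed.

End Homotopy.

(** * The square grid *)

Section Grid.
Context {R : realType}.
Variables (o : plane R) (h : R).
Hypothesis h_gt0 : 0 < h.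
Notation V := (int * int)%type.
Implicit Types (u v w q : V) (m : seq V) (z : plane R).

Definition coord u (k : 'I_2) : int := if k == 0 then u.1 else u.2.

Definition pt u : plane R := \row_k (o 0 k + h * (coord u k)%:~R).

Definition cell z : V :=
  (Num.floor ((z 0 0 - o 0 0) / h), Num.floor ((z 0 1 - o 0 1) / h)).

Definition square q : set (plane R) :=
  [set z | forall k, pt q 0 k <= z 0 k <= pt q 0 k + h].

Lemma ord2P (k : 'I_2) : k = 0 \/ k = 1.
Proof. by case: k => [[|[|//]]] kP; [left|right]; apply: val_inj. Qed.

Lemma cell_coord z k : coord (cell z) k = Num.floor ((z 0 k - o 0 k) / h).
Proof. by case: (ord2P k) => ->. Qed.

Lemma cell_bounds z k :
  pt (cell z) 0 k <= z 0 k < pt (cell z) 0 k + h.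
Proof.
rewrite mxE cell_coord; set f := Num.floor _.
have := floor_itv ((z 0 k - o 0 k) / h); rewrite -/f => /andP[f1 f2].
rewrite ler_pdivlMr // in f1; rewrite ltr_pdivrMr // in f2.
rewrite intrD in f2; apply/andP; split; lra.
Qed.

Lemma square_cell z : square (cell z) z.
Proof. by move=> k; have /andP[-> /ltW ->] := cell_bounds z k. Qed.

Lemma pt_cell u : cell (pt u) = u.
Proof.
have E k : Num.floor ((pt u 0 k - o 0 k) / h) = coord u k.
  by rewrite mxE addrC addKr mulrC mulKf ?gt_eqF // intrKfloor.
by rewrite /cell !E [RHS]surjective_pairing.
Qed.

Lemma conv_bounds (a b x y t : R) : a <= x <= b -> a <= y <= b -> 0 <= t <= 1 ->
  a <= (1 - t) * x + t * y <= b.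
Proof.
move=> /andP[ax xb] /andP[ay yb] /andP[t0 t1].
have t1' : 0 <= 1 - t by rewrite subr_ge0.
have -> : a = (1 - t) * a + t * a by ring.
have -> : b = (1 - t) * b + t * b by ring.
by rewrite !lerD // ler_wpM2l.
Qed.

Lemma square_convex q : is_convex (square q).
Proof.
move=> z z' t zq z'q t01 k.
by have := conv_bounds (zq k) (z'q k) t01; rewrite !mxE.
Qed.

Lemma square_near z : exists2 r : R, 0 < r &
  forall z', `|z - z'| < r -> square (cell z') z.
Proof.
pose f (k : 'I_2) := z 0 k - pt (cell z) 0 k.
have f0 k : 0 <= f k < h.
  by have := cell_bounds z k; rewrite /f => /andP[a b]; apply/andP; split; lra.
(* The distance to the nearest grid lines. If [z] lies on a grid line, that is [f k = 0], the closed
   squares on both sides contain it, and the next line below is at distance [h]. *)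
pose r (k : 'I_2) := Num.min (h - f k) (if 0 < f k then f k else h).
have r0 k : 0 < r k.
  have /andP[_ fh] := f0 k.
  by rewrite /r lt_min subr_gt0 fh /=; case: ifP.
exists (Num.min (r 0) (r 1)); first by rewrite lt_min !r0.
move=> z' zz' k.
have {}zz' : `|z 0 k - z' 0 k| < r k.
  have := entry_le (z - z') 0 k; rewrite !mxE => /le_lt_trans; apply.
  by apply: (lt_le_trans zz'); rewrite ge_min; case: (ord2P k) => ->; rewrite lexx ?orbT.
have /andP[z'1 z'2] := cell_bounds z' k.
have /andP[z1 z2] := cell_bounds z k.
move: zz' (f0 k); rewrite /r /f lt_min ltr_distl => /andP[/andP[a1 a2]].
rewrite ltr_distl => b f0k.
move: z'1 z'2 z1 z2 a1 a2 b f0k; rewrite !mxE !cell_coord.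
set F' := Num.floor _; set F := Num.floor _ => z'1 z'2 z1 z2 a1 a2 b f0k.
have hF (a c : int) : a <= c -> h * a%:~R <= h * c%:~R.
  by move=> ac; rewrite ler_pM2l // ler_int.
have FF1 : F' <= F.
  rewrite leNgt; apply/negP => FF.
  have : h * (F + 1)%:~R <= h * F'%:~R by apply: hF; move: FF; clear; lia.
  rewrite intrD mulrDr mulr1 => hh; lra.
have FF2 : F - 1 <= F'.
  rewrite leNgt; apply/negP => FF.
  have : h * (F' + 1)%:~R <= h * (F - 1)%:~R by apply: hF; move: FF; clear; lia.
  rewrite intrD intrB !mulrDr mulrN mulr1; move: b; case: ifP => _ b hh; lra.
have : F' = F \/ F' = F - 1 by move: FF1 FF2; clear; lia.
case=> FE; rewrite FE ?intrB.
  by apply/andP; split; lra.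
have fz : z 0 k = o 0 k + h * F%:~R.
  move: b; case: ifP => [fp b|/negbT]; last by rewrite -leNgt; lra.
  by move: z'2; rewrite FE intrB mulrBr mulr1; lra.
by rewrite fz mulrBr mulr1; apply/andP; split; lra.
Qed.

Lemma ptE u k : pt u 0 k = o 0 k + h * (coord u k)%:~R.
Proof. by rewrite mxE. Qed.

Lemma square_corner q (a b : int) : 0 <= a <= 1 -> 0 <= b <= 1 ->
  square q (pt (q.1 + a, q.2 + b)).
Proof.
move=> a01 b01 k; rewrite !ptE.
have [c c01 ->] : exists2 c : int, 0 <= c <= 1 &
    coord (q.1 + a, q.2 + b) k = coord q k + c.
  by rewrite /coord /=; case: ifP => _; [exists a|exists b].
have c0 : 0 <= h * c%:~R by case/andP: c01 => c0 _; rewrite mulr_ge0 ?ler0z // ltW.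
have c1 : h * c%:~R <= h * 1.
  by case/andP: c01 => _ c1; rewrite ler_pM2l // -(mulr1z 1) ler_int.
by rewrite intrD mulrDr; apply/andP; split; lra.
Qed.

Definition edge_in (Omega : set (plane R)) u v : bool :=
  adjacent u v && `[< chain Omega [:: pt u; pt v] >].

Lemma chain_rev2 (Omega : set (plane R)) z z' :
  chain Omega [:: z; z'] -> chain Omega [:: z'; z].
Proof.
move=> [hz oz]; split=> [t /andP[t0 t1]|].
  have t01 : 0 <= 1 - t <= 1 by apply/andP; split; lra.
  by have := hz _ t01; rewrite subKr addrC.
by have := hz 0; rewrite lexx ler01 subr0 scale1r scale0r addr0; apply.
Qed.

Lemma edge_in_sym Omega : symmetric (edge_in Omega).
Proof.
move=> u v; rewrite /edge_in.
have -> : adjacent u v = adjacent v u by rewrite /adjacent; clear; lia.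
by congr (_ && _); apply/asboolP/asboolP => /chain_rev2.
Qed.

Lemma chain_mem Omega s1 z s2 : chain Omega (s1 ++ z :: s2) -> Omega z.
Proof.
elim: s1 => [|w s1 IH] /=.
  by case: s2 => // v s2 [hz _]; have := hz 0;
     rewrite lexx ler01 subr0 scale1r scale0r addr0; apply.
case: s1 IH => [|v s1] /= IH [_ H]; [exact: IH|exact: IH].
Qed.

Lemma path_chain Omega u m : Omega (pt u) -> path (lazy (edge_in Omega)) u m ->
  chain Omega (map pt (u :: m)).
Proof.
elim: m u => [//|v m IH] u Ou /= /andP[/orP[/eqP <-|/andP[_ /asboolP[cu Ov]]] p].
  split; last exact: IH.
  by move=> t _; rewrite -scalerDl subrK scale1r.
by split=> //; exact: IH.
Qed.

Definition segment_set (z z' : plane R) : set (plane R) :=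
  [set y | exists2 t : R, 0 <= t <= 1 & y = (1 - t) *: z + t *: z'].

Lemma segment_is_convex z z' : is_convex (segment_set z z').
Proof.
move=> _ _ t [a a01 ->] [b b01 ->] t01.
exists ((1 - t) * a + t * b); first exact: conv_bounds.
by apply/rowP => i; rewrite !mxE; ring.
Qed.

Lemma segment_left z z' : segment_set z z' z.
Proof. by exists 0; rewrite ?lexx ?ler01 // subr0 scale1r scale0r addr0. Qed.

Lemma segment_right z z' : segment_set z z' z'.
Proof. by exists 1; rewrite ?lexx ?ler01 // subrr scale1r scale0r add0r. Qed.

Lemma walk_null (Omega : set (plane R)) u m :
  (forall z, Omega z -> o 0 1 < z 0 1) ->
  (forall q v m', ~ square q `<=` Omega -> path (lazy (edge_in Omega)) v m' ->
     last v m' = v -> step_sum (crossing q) (v :: m') = 0) ->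
  Omega (pt u) -> path (lazy (edge_in Omega)) u m -> last u m = u ->
  hom Omega (pt u) (loop_of (map pt (u :: m))) (cst (pt u)).
Proof.
move=> Opos cross0 Ou pm lm; set x := pt u.
pose E L L' := walk_equiv Omega x (map pt L) (map pt L').
(* A polygon that leaves Omega fails the premise of [walk_equiv], so that its points may be assumed
   to lie in Omega. *)
have Evac z L L' : (Omega z -> walk_equiv Omega x (z :: L) L') ->
    walk_equiv Omega x (z :: L) L'.
  move=> H s1 s2 c; have Oz : Omega z by move: c => /= /chain_mem.
  exact: H.
have Esq q (L v : seq V) (a b a' b' : int) : square q `<=` Omega -> 0 <= a <= 1 -> 0 <= b <= 1 ->
    0 <= a' <= 1 -> 0 <= b' <= 1 ->
    L = [:: (q.1 + a, q.2 + b); (q.1 + a', q.2 + b')] ->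
    v = [:: (q.1 + a, q.2 + b); (q.1 + a, q.2); (q.1 + a', q.2); (q.1 + a', q.2 + b')] ->
    E L v.
  move=> qO a01 b01 a01' b01' -> ->.
  have z01 : 0 <= (0 : int) <= 1 by [].
  apply: (walk_equiv_local (K := square q)) => //=; first exact: square_convex.
    by move=> z [<-|[<-|//]]; apply: square_corner.
  move=> z [<-|[<-|[<-|[<-|//]]]].
  - exact: square_corner.
  - by rewrite -[q.2]addr0; apply: square_corner.
  - by rewrite -[q.2]addr0; apply: square_corner.
  - exact: square_corner.
have := @contract (edge_in Omega) (fun q => `[< square q `<=` Omega >]) E.
move=> /(_ (@edge_in_sym Omega)).
have i01 : 0 <= (1 : int) <= 1 by [].
have i00 : 0 <= (0 : int) <= 1 by [].
move=> H; have {H} : E (u :: m) [:: u].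
  apply: H => //.
  - by move=> v w /andP[].
  - move=> v w /andP[_ /asboolP /(@chain_mem _ [::])] /Opos.
    by rewrite ptE /coord /= ltrDl pmulr_rgt0 // ltr0z.
  - move=> q /asboolP qO.
    have e2 (a b a' b' : int) : 0 <= a <= 1 -> 0 <= b <= 1 -> 0 <= a' <= 1 -> 0 <= b' <= 1 ->
        adjacent (q.1 + a, q.2 + b) (q.1 + a', q.2 + b') ->
        edge_in Omega (q.1 + a, q.2 + b) (q.1 + a', q.2 + b').
      move=> ? ? ? ? adj; rewrite /edge_in adj; apply/asboolP; apply: (chain_convex (@square_convex q) qO).
      by move=> z [<-|[<-|//]]; exact: square_corner.
    have := e2 0 1 0 0; have := e2 0 0 1 0; have := e2 1 0 1 1; rewrite !addr0 -surjective_pairing.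
    rewrite /adjacent /= !eqxx !andbT !orbT /= => E1 E2 E3.
    by split; [exact: E3|exact: E2|exact: E1].
  - by move=> q v m' /asboolP qO; exact: cross0.
  - move=> w s1 s2.
    have [z [r ->]] : exists z r, s1 ++ map pt [:: w] ++ s2 = z :: r.
      by case: (s1) => [|a s1'] /=; eexists; eexists.
    move=> c hd la; split=> //.
    rewrite /= in hd la; apply: hom_straight; rewrite ?loop0 ?loop1 //; do ?exact: loop_continuous.
    by move=> t s _ _; rewrite -scalerDl subrK scale1r; exact: chain_curve.
  - by move=> w w' w''; exact: walk_equiv_trans.
  - by move=> s1 s2 w w'; rewrite /E !map_cat; exact: walk_equiv_context.
  - move=> v; apply: Evac => Ov.
    apply: (walk_equiv_local (m := [:: pt v]) (m' := [::]) (K := [set pt v])) => //=.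
    + by move=> z z' t -> -> _; rewrite /= -scalerDl subrK scale1r.
    + by move=> z ->.
    + by move=> z [<-|[<-|//]].
    + by move=> z [<-|//].
  - move=> v w /andP[_ /asboolP[cvw Ow]].
    apply: (walk_equiv_local (m := [:: pt w; pt v]) (m' := [::])
      (K := segment_set (pt v) (pt w))) => //=.
    + exact: segment_is_convex.
    + by move=> _ [t t01 ->]; exact: cvw.
    + by move=> z [<-|[<-|[<-|//]]]; [exact: segment_left|exact: segment_right|exact: segment_left].
    + by move=> z [<-|//]; exact: segment_left.
  - by move=> q /asboolP qO; apply: (Esq q _ _ 0 1 1 1 qO); rewrite ?addr0 -?surjective_pairing.
  - by move=> q /asboolP qO; apply: (Esq q _ _ 1 1 0 1 qO); rewrite ?addr0 -?surjective_pairing.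
move=> /(_ [::] [::]); rewrite !cats0 !cat0s => /(_ (path_chain Ou pm) erefl).
have -> : last x (map pt (u :: m)) = x by rewrite /= last_map lm.
move=> /(_ erefl)[_ _ _ H]; move: H; congr (hom _ _ _ _).
Qed.

End Grid.

(** * Approximation of loops by grid walks *)

Section Discretize.
Context {R : realType}.
Implicit Types (Omega : set (plane R)) (x y z : plane R) (c : R -> plane R).

Lemma ball_is_convex y (r : R) : is_convex [set z | `|y - z| < r].
Proof.
move=> z z' t /= zr z'r /andP[t0 t1].
have t1' : 0 <= 1 - t by rewrite subr_ge0.
have -> : y - ((1 - t) *: z + t *: z') = (1 - t) *: (y - z) + t *: (y - z').
  by apply/rowP => i; rewrite !mxE; ring.
apply: (le_lt_trans (ler_normD _ _)); rewrite !normrZ !ger0_norm //.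
have [->|t0'] := eqVneq t 0; first by rewrite subr0 mul1r mul0r addr0.
have -> : r = (1 - t) * r + t * r by ring.
rewrite ler_ltD //; first by rewrite ler_wpM2l // ltW.
by rewrite ltr_pM2l // lt_neqAle eq_sym t0'.
Qed.

Lemma curve_seq (f : nat -> plane R) a M i (t : R) : (i < M)%N -> i%:R <= t <= i.+1%:R ->
  curve [seq f j | j <- iota a M.+1] t =
  (1 - (t - i%:R)) *: f (a + i)%N + (t - i%:R) *: f (a + i).+1.
Proof.
elim: M a i t => // M IH a [|i] t iM ti.
  rewrite -[iota a M.+2]/[:: a, a.+1 & iota a.+2 M] !map_cons curve_le1 //.
  by rewrite subr0 addn0.
have i1 : i.+1%:R = i%:R + 1 :> R by rewrite natr1.
have i2 : i.+2%:R = i%:R + 1 + 1 :> R by rewrite !natr1.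
have i0 : 0 <= i%:R :> R by rewrite ler0n.
rewrite i1 i2 in ti; case/andP: ti => ti1 ti2.
rewrite -[iota a M.+2]/[:: a, a.+1 & iota a.+2 M] !map_cons curve_ge1; last by lra.
have := IH a.+1 i (t - 1) iM; rewrite -[iota a.+1 M.+1]/[:: a.+1 & iota a.+2 M] map_cons => ->.
  by rewrite i1 addSnnS addnS; congr (_ *: _ + _ *: _); ring.
by rewrite i1; apply/andP; split; lra.
Qed.

Lemma path_iota (T : Type) (r : rel T) (w : nat -> T) a M :
  (forall i, (i < M)%N -> r (w (a + i)%N) (w (a + i).+1)) ->
  path r (w a) [seq w i | i <- iota a.+1 M].
Proof.
elim: M a => // M IH a h /=; apply/andP; split; first by have := h 0; rewrite addn0; apply.
by apply: IH => i iM; have := h i.+1 iM; rewrite addnS addSn.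
Qed.

Lemma last_iota (T : Type) (w : nat -> T) a M :
  last (w a) [seq w i | i <- iota a.+1 M] = w (a + M)%N.
Proof. by elim: M a => [|M IH] a /=; rewrite ?addn0 // IH addSnnS. Qed.

Lemma unit_compact : compact [set t : R | 0 <= t <= 1].
Proof.
by have := @segment_compact R 0 1; congr (compact _).
Qed.

Lemma loop_margin Omega c : open Omega -> continuous c -> (forall t, Omega (c t)) ->
  exists2 d : R, 0 < d & forall t z, 0 <= t <= 1 -> `|c t - z| < d -> Omega z.
Proof.
move=> oO cc cO.
have [|r r0 h] := @compact_unif R R [set t : R | 0 <= t <= 1]
  (fun t d => forall z, `|c t - z| <= d -> Omega z) unit_compact.
  move=> t _; have [r r0 h] := near_ex (open_nbhs_nbhs (conj oO (cO t))).
  have r2 : 0 < r / 2 by rewrite divr_gt0.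
  have [s s0 hs] := cont_ex r2 (cc t).
  exists (Num.min s (r / 2)); first by rewrite lt_min s0.
  move=> t' d _ tt' /andP[d0 dr] z ctz; apply: h.
  rewrite -(subrKA (c t')); apply: (le_lt_trans (ler_normD _ _)).
  rewrite (splitr r) ltrD //; first by apply: hs; apply: lt_le_trans tt' _; rewrite ge_min lexx.
  by apply: (le_lt_trans ctz); apply: (lt_le_trans dr); rewrite ge_min lexx orbT.
exists (r / 2); first by rewrite divr_gt0.
move=> t z t01 /ltW ctz; apply: (h t (r / 2)) => //.
by apply/andP; split; lra.
Qed.

Lemma loop_unif c (e : R) : continuous c -> 0 < e ->
  exists n : nat, (0 < n)%N /\ forall t s, 0 <= t <= 1 -> `|t - s| <= n%:R^-1 ->
    `|c t - c s| < e.
Proof.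
move=> cc e0; have e2 : 0 < e / 2 by rewrite divr_gt0.
have [|r r0 h] := @compact_unif R R [set t : R | 0 <= t <= 1]
  (fun t d => forall s, `|t - s| <= d -> `|c t - c s| < e) unit_compact.
  move=> t _; have [s s0 hs] := cont_ex e2 (cc t).
  exists (s / 2); first by rewrite divr_gt0.
  move=> t' d _ tt' /andP[d0 ds] t'' t't''.
  have h1 : `|c t - c t'| < e / 2 by apply: hs; apply: (lt_trans tt'); lra.
  have h2 : `|c t - c t''| < e / 2.
    apply: hs; rewrite -(subrKA t'); apply: (le_lt_trans (ler_normD _ _)); lra.
  rewrite -(subrKA (c t)) [e]splitr; apply: (le_lt_trans (ler_normD _ _)).
  by rewrite ltrD // distrC.
pose n := (Num.trunc (r^-1)).+1.
exists n; split=> // t s t01 ts; apply: (h t n%:R^-1) => //.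
rewrite invr_gt0 ltr0n /=.
by rewrite invf_plt ?posrE ?ltr0n // /n; exact: truncnS_gt.
Qed.

(** The loop is sampled at the times [k / n], and each sample is replaced by the corner of its cell.
    The resulting polygon stays so close to the loop that the straight-line homotopy remains in
    Omega. *)
Lemma discretize Omega c x : open Omega -> continuous c -> (forall t, Omega (c t)) ->
  c 0 = x -> c 1 = x ->
  exists2 h0 : R, 0 < h0 & forall (o : plane R) (h : R) u0, 0 < h < h0 -> pt o h u0 = x ->
    exists m, [/\ path (lazy (edge_in o h Omega)) u0 m, last u0 m = u0 &
      hom Omega x c (loop_of (map (pt o h) (u0 :: m)))].
Proof.
move=> oO cc cO c0 c1; have [d d0 hd] := loop_margin oO cc cO.
(* Between samples the loop moves by less than [h], and a sample is within [h] of its corner: less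
   than [2 * h < d] in total. *)
exists (d / 2); first by rewrite divr_gt0.
move=> o h u0 /andP[h0 hd2] u0x; have [n [n0 hn]] := loop_unif cc h0.
have nR : 0 < n%:R :> R by rewrite ltr0n.
pose u k := cell o h (c (k%:R / n%:R)).
(* Cells of consecutive samples may be diagonal neighbours; the odd steps insert the missing
   corner. *)
pose w i := if odd i then ((u i./2.+1).1, (u i./2).2) else u i./2.
have u00 : u 0%N = u0 by rewrite /u mul0r c0 -u0x pt_cell.
have un : u n = u0 by rewrite /u divff ?gt_eqF // c1 -u0x pt_cell.
have kn (k : nat) : (k <= n)%N -> 0 <= (k%:R / n%:R : R) <= 1.
  by move=> kn; rewrite divr_ge0 //= ler_pdivrMr // mul1r ler_nat.
have kk (k : nat) : (k.+1%:R / n%:R : R) = k%:R / n%:R + n%:R^-1.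
  by rewrite -natr1 mulrDl mul1r.
have near_k k t i : (k < n)%N -> k%:R / n%:R <= t <= k.+1%:R / n%:R ->
    (k.*2 <= i <= k.*2.+2)%N -> `|c t - pt o h (w i)| < d.
  move=> kn' /andP[t1 t2] ik.
  have tk : `|c t - c (k%:R / n%:R)| < h.
    rewrite distrC; apply: hn; first by apply: kn; rewrite ltnW.
    by rewrite ler_distl; rewrite kk in t2; apply/andP; split; lra.
  have tk1 : `|c t - c (k.+1%:R / n%:R)| < h.
    rewrite distrC; apply: hn; first by apply: kn.
    by rewrite ler_distl; rewrite kk in t2 *; apply/andP; split; lra.
  apply: mx_norm_lt => // i0 j; rewrite ord1 {i0} !mxE.
  have B k' : `|c t - c (k'%:R / n%:R)| < h ->
      `|c t 0 j - (o 0 j + h * (coord (u k') j)%:~R)| < d.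
    move=> tk'; have /andP[b1 b2] := cell_bounds o h0 (c (k'%:R / n%:R)) j.
    rewrite ptE -/(u k') in b1 b2.
    have := entry_le (c t - c (k'%:R / n%:R)) 0 j; rewrite !mxE => e.
    have := le_lt_trans e tk'; rewrite !ltr_distl => /andP[e1 e2].
    by apply/andP; split; lra.
  have : i = k.*2 \/ i = k.*2.+1 \/ i = k.*2.+2 by clear -ik; lia.
  rewrite /w; case=> [->|[->|->]] /=; rewrite ?odd_double /= ?doubleK ?uphalf_double.
  - exact: B.
  - by case: (ord2P j) B => -> B; [exact: (B k.+1 tk1)|exact: (B k tk)].
  - exact: B.
pose W := [seq w i | i <- iota 1 n.*2].
have w0 : w 0%N = u0 by rewrite /w.
exists W; rewrite -w0; split.
- apply: path_iota => i; rewrite add0n => i2n.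
  have kn' : (i./2 < n)%N by clear -i2n; lia.
  have tk : i./2%:R / n%:R <= (i./2%:R / n%:R : R) <= i./2.+1%:R / n%:R.
    by rewrite lexx kk lerDl invr_ge0 ltW.
  rewrite /lazy; have [//|nww] := eqVneq (w i) (w i.+1); rewrite orFb.
  apply/andP; split; last first.
    apply/asboolP; apply: (chain_convex (@ball_is_convex (c (i./2%:R / n%:R)) d)).
      by move=> z /= /hd; apply; apply: kn; rewrite ltnW.
    by move=> z [<-|[<-|//]]; apply: (near_k _ _ _ kn' tk); clear; lia.
  have cd k' j : (k' < n)%N -> coord (u k') j - 1 <= coord (u k'.+1) j <= coord (u k') j + 1.
    move=> k'n.
    have /andP[b1 b2] := cell_bounds o h0 (c (k'%:R / n%:R)) j.
    have /andP[b3 b4] := cell_bounds o h0 (c (k'.+1%:R / n%:R)) j.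
    rewrite !ptE -/(u k') -/(u k'.+1) in b1 b2 b3 b4.
    have : `|c (k'%:R / n%:R) - c (k'.+1%:R / n%:R)| < h.
      apply: hn; first by apply: kn; rewrite ltnW.
      by rewrite kk opprD addNKr normrN ger0_norm // invr_ge0 ltW.
    have := entry_le (c (k'%:R / n%:R) - c (k'.+1%:R / n%:R)) 0 j.
    rewrite !mxE => /le_lt_trans H /H; rewrite ltr_distl => /andP[e1 e2].
    move: (coord (u k') j) (coord (u k'.+1) j) b1 b2 b3 b4 => a b b1 b2 b3 b4.
    have hab (p q : int) : h * p%:~R < h * q%:~R -> p < q by rewrite ltr_pM2l // ltr_int.
    have H1 : b < a + 2 by apply: hab; rewrite intrD mulrDr; lra.
    have H2 : a < b + 2 by apply: hab; rewrite intrD mulrDr; lra.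
    by clear -H1 H2; lia.
  have c0' := cd _ 0 kn'; have c1' := cd _ 1 kn'.
  move: nww c0' c1'; rewrite /w -[odd i.+1]/(~~ odd i) -[i.+1./2]/(uphalf i).
  case: (odd i) (odd_double_half i) => iE; last first.
    rewrite (_ : uphalf i = i./2); last by clear -iE; lia.
    by move: (u i./2) (u i./2.+1) => [a b] [a' b']; rewrite /coord /adjacent /= xpair_eqE;
       clear; lia.
  rewrite (_ : uphalf i = i./2.+1); last by clear -iE; lia.
  by move: (u i./2) (u i./2.+1) => [a b] [a' b']; rewrite /coord /adjacent /= xpair_eqE;
     clear; lia.
- by rewrite last_iota add0n /w odd_double doubleK un u00.
rewrite /W -map_cons -[0%N :: _]/(iota 0 n.*2.+1) -map_comp.
have szL : (size [seq (pt o h \o w) i | i <- iota 0 n.*2.+1]).-1 = n.*2.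
  by rewrite size_map size_iota.
have [L' LE] : exists L', [seq (pt o h \o w) i | i <- iota 0 n.*2.+1] = x :: L'.
  by exists [seq (pt o h \o w) i | i <- iota 1 n.*2]; rewrite /= w0 u0x.
apply: hom_straight => //.
- exact: loop_continuous.
- move=> t s /andP[t0 t1] s01.
  have [k [kn' tk]] : exists k, (k < n)%N /\ k%:R / n%:R <= t <= k.+1%:R / n%:R.
    have [t1'|t1'] := ltP t 1; last first.
      exists n.-1; rewrite prednK // divff ?gt_eqF // t1 andbT; split=> //.
      have : n.-1%:R / n%:R <= 1 :> R by have /andP[] := kn _ (leq_pred n).
      by lra.
    exists (Num.trunc (n%:R * t)).
    have nt0 : 0 <= n%:R * t by rewrite mulr_ge0.
    have /andP[a b] := truncn_itv nt0; split.
      by rewrite -(ltr_nat R); apply: (le_lt_trans a); rewrite gtr_pMr.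
    by rewrite ler_pdivrMr // ler_pdivlMr // [t * _]mulrC a ltW.
  apply: (hd t) => //; first by rewrite t0.
  apply: (@ball_is_convex (c t) d) => //=; first by rewrite subrr normr0.
  rewrite /loop_of szL.
  have nt : (n.*2%:R * t) = 2 * (n%:R * t) :> R by rewrite -muln2 natrM; ring.
  have : exists i, (k.*2 <= i <= k.*2.+1)%N /\ i%:R <= n.*2%:R * t <= i.+1%:R.
    move: tk; rewrite ler_pdivrMr // ler_pdivlMr // => /andP[a b].
    have k2 : k.*2%:R = 2 * k%:R :> R by rewrite -muln2 natrM mulrC.
    rewrite -natr1 in b.
    have [ti|ti] := leP (n.*2%:R * t) k.*2.+1%:R.
      exists k.*2; rewrite ti andbT; split; first by clear; lia.
      by rewrite nt // k2; lra.
    exists k.*2.+1; rewrite (ltW ti); split; first by clear; lia.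
    by rewrite nt // -[k.*2.+2%:R]natr1 -[k.*2.+1%:R]natr1 k2; lra.
  move=> [i [ik it]]; rewrite (@curve_seq (pt o h \o w) 0 n.*2 i) //; last by clear -ik kn'; lia.
  apply: (@ball_is_convex (c t) d); rewrite ?add0n /=.
  - by apply: (near_k _ _ _ kn' tk); clear -ik; lia.
  - by apply: (near_k _ _ _ kn' tk); clear -ik; lia.
  by rewrite -natr1 in it; apply/andP; case/andP: it; split; lra.
- by rewrite LE loop0.
rewrite LE loop1.
have -> : last x L' = last x [seq (pt o h \o w) i | i <- iota 0 n.*2.+1] by rewrite LE.
rewrite [iota _ _]/= [map _ _]/= [last _ _]/= (last_iota (pt o h \o w)) add0n.
by rewrite /= /w odd_double doubleK un u0x.
Qed.

End Discretize.

(** * A compact component of the complement *)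

Section Separation.
Context {R : realType}.
Notation V := (int * int)%type.
Implicit Types (Omega E : set (plane R)) (x y z : plane R) (c : R -> plane R).

Section Winding.
Variables (o : plane R) (h : R) (Omega : set (plane R)).
Hypothesis h_gt0 : 0 < h.
Variables (u : V) (m : seq V).
Hypothesis walk : path (lazy (edge_in o h Omega)) u m.
Hypothesis closed_walk : last u m = u.

Definition winding (q : V) : int := step_sum (crossing q) (u :: m).

Lemma edge_avoid (v w : V) z (t : R) : edge_in o h Omega v w -> ~ Omega z ->
  0 <= t <= 1 -> z <> (1 - t) *: pt o h v + t *: pt o h w.
Proof. by move=> /andP[_ /asboolP[H _]] nz t01 zE; apply: nz; rewrite zE; exact: H. Qed.

Lemma on_hedge z (i j : int) : square o h (i, j) z -> square o h (i, j - 1) z ->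
  exists2 t : R, 0 <= t <= 1 & z = (1 - t) *: pt o h (i, j) + t *: pt o h (i + 1, j).
Proof.
move=> z1 z2; exists ((z 0 0 - pt o h (i, j) 0 0) / h).
  have /andP[a b] := z1 0.
  by rewrite ler_pdivlMr // ler_pdivrMr // mul0r mul1r; apply/andP; split; lra.
have z01 : z 0 1 = pt o h (i, j) 0 1.
  have /andP[a b] := z1 1; have /andP[c d] := z2 1.
  by move: a b c d; rewrite !ptE /coord /= intrB mulrBr mulr1; lra.
apply/rowP => k; rewrite !mxE; case: (ord2P k) => ->; last first.
  by rewrite z01 mxE /coord /=; ring.
by rewrite /coord /= intrD; field; rewrite gt_eqF.
Qed.

Lemma on_vedge z (i j : int) : square o h (i, j) z -> square o h (i - 1, j) z ->
  exists2 t : R, 0 <= t <= 1 & z = (1 - t) *: pt o h (i, j) + t *: pt o h (i, j + 1).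
Proof.
move=> z1 z2; exists ((z 0 1 - pt o h (i, j) 0 1) / h).
  have /andP[a b] := z1 1.
  by rewrite ler_pdivlMr // ler_pdivrMr // mul0r mul1r; apply/andP; split; lra.
have z01 : z 0 0 = pt o h (i, j) 0 0.
  have /andP[a b] := z1 0; have /andP[c d] := z2 0.
  by move: a b c d; rewrite !ptE /coord /= intrB mulrBr mulr1; lra.
apply/rowP => k; rewrite !mxE; case: (ord2P k) => ->.
  by rewrite z01 mxE /coord /=; ring.
by rewrite /coord /= intrD; field; rewrite gt_eqF.
Qed.

Lemma no_hedge z (i j : int) v w : ~ Omega z -> square o h (i, j) z ->
  square o h (i, j - 1) z -> edge_in o h Omega v w ->
  (v, w) <> ((i, j), (i + 1, j)) /\ (w, v) <> ((i, j), (i + 1, j)).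
Proof.
move=> nz z1 z2 e; have [t t01 zE] := on_hedge z1 z2; split=> [[vE wE]|[wE vE]].
  by apply: (edge_avoid e nz t01); rewrite vE wE.
by rewrite edge_in_sym in e; apply: (edge_avoid e nz t01); rewrite vE wE.
Qed.

Lemma no_vedge z (i j : int) v w : ~ Omega z -> square o h (i, j) z ->
  square o h (i - 1, j) z -> edge_in o h Omega v w ->
  (v, w) <> ((i, j), (i, j + 1)) /\ (w, v) <> ((i, j), (i, j + 1)).
Proof.
move=> nz z1 z2 e; have [t t01 zE] := on_vedge z1 z2; split=> [[vE wE]|[wE vE]].
  by apply: (edge_avoid e nz t01); rewrite vE wE.
by rewrite edge_in_sym in e; apply: (edge_avoid e nz t01); rewrite vE wE.
Qed.

Lemma pair_neq (v w : V) (a b c d : int) : (v, w) <> ((a, b), (c, d)) ->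
  ~~ [&& v.1 == a, v.2 == b, w.1 == c & w.2 == d].
Proof.
move=> H; apply/negP => /and4P[/eqP e1 /eqP e2 /eqP e3 /eqP e4]; apply: H.
by rewrite [v]surjective_pairing [w]surjective_pairing e1 e2 e3 e4.
Qed.

(** The two rays differ by the common edge of the squares. It contains the point [z] outside Omega,
    hence the walk does not use it. *)
Lemma winding_down z (i j : int) : ~ Omega z -> square o h (i, j) z ->
  square o h (i, j - 1) z -> winding (i, j) = winding (i, j - 1).
Proof.
move=> nz z1 z2; apply: (eq_step_sum walk) => v w /orP[/eqP <-|e].
  by rewrite /crossing /=; clear; do ![case: ifP]; lia.
have [/pair_neq n1 /pair_neq n2] := no_hedge nz z1 z2 e.
have /andP[adj _] := e; move: n1 n2 adj; rewrite /crossing /adjacent /=.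
by move: v w {e} => [v1 v2] [w1 w2] /=; clear; do ![case: ifP]; lia.
Qed.

Lemma winding_left z (i j : int) : ~ Omega z -> square o h (i, j) z ->
  square o h (i - 1, j) z -> winding (i, j) = winding (i - 1, j).
Proof.
move=> nz z1 z2.
(* The indicator of the grid points of column [i] above the square. A closed walk enters and leaves
   this half-line equally often: to the left through the ray of [(i - 1, j)], to the right through
   that of [(i, j)], and below only through the excluded edge. *)
pose g (v : V) : int := ((v.1 == i) && (j < v.2))%:Z.
have := step_sum_telescope g u m; rewrite closed_walk subrr => tel.
apply/eqP; rewrite -subr_eq0 /winding -step_sumN -step_sumD -oppr_eq0 -step_sumN -tel.
apply/eqP; apply: (eq_step_sum walk) => v w /orP[/eqP <-|e].
  by rewrite /crossing /g /=; clear; do ![case: ifP]; lia.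
have [/pair_neq n1 /pair_neq n2] := no_vedge nz z1 z2 e.
have /andP[adj _] := e; move: n1 n2 adj; rewrite /crossing /adjacent /g /=.
move: v w {e} => [v1 v2] [w1 w2] /= n1 n2 /orP[/andP[/eqP e1 hv]|/andP[/eqP e2 hh]].
  have -> : v2 == w2 = false by clear -hv; lia.
  by rewrite !andbF e1 in n1 n2 *; clear -n1 n2 hv; lia.
clear n1 n2; rewrite e2 eqxx andbT; case: (j < w2) => /=; last by rewrite !andbF.
rewrite !andbT; case/orP: hh => /eqP ->; clear.
  have -> : (w1 + 1 == i - 1) && (w1 == i - 1 + 1) = false by lia.
  have -> : (w1 + 1 == i) && (w1 == i + 1) = false by lia.
  by do ![case: ifP]; lia.
have -> : (v1 + 1 == i - 1) && (v1 == i - 1 + 1) = false by lia.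
have -> : (v1 + 1 == i) && (v1 == i + 1) = false by lia.
by do ![case: ifP]; lia.
Qed.

Lemma square_pair z q q' : square o h q z -> square o h q' z ->
  [/\ square o h (q.1, q'.2) z, (q.1 - q'.1 \in [:: 0; 1; -1]) & (q.2 - q'.2 \in [:: 0; 1; -1])].
Proof.
move=> z1 z2; split.
- move=> k; case: (ord2P k) => ->.
    by have := z1 0; rewrite !ptE.
  by have := z2 1; rewrite !ptE.
- have /andP[a b] := z1 0; have /andP[c d] := z2 0.
  rewrite !ptE /coord /= in a b c d.
  have hab (p r : int) : h * p%:~R <= h * r%:~R + h -> p <= r + 1.
    by move=> H; rewrite -(ler_int R) -(ler_pM2l h_gt0) intrD mulrDr mulr1.
  have := hab q.1 q'.1; have := hab q'.1 q.1; rewrite !inE => H1 H2.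
  have {}H1 := H1 ltac:(lra); have {}H2 := H2 ltac:(lra).
  by clear -H1 H2; lia.
- have /andP[a b] := z1 1; have /andP[c d] := z2 1.
  rewrite !ptE /coord /= in a b c d.
  have hab (p r : int) : h * p%:~R <= h * r%:~R + h -> p <= r + 1.
    by move=> H; rewrite -(ler_int R) -(ler_pM2l h_gt0) intrD mulrDr mulr1.
  have := hab q.2 q'.2; have := hab q'.2 q.2; rewrite !inE => H1 H2.
  have {}H1 := H1 ltac:(lra); have {}H2 := H2 ltac:(lra).
  by clear -H1 H2; lia.
Qed.

(** The winding number around a point outside Omega does not depend on the closed square in which
    the point is placed. Diagonal neighbours are joined through [(q.1, q'.2)], which also contains
    the point. *)
Lemma winding_const z q q' : ~ Omega z -> square o h q z -> square o h q' z ->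
  winding q = winding q'.
Proof.
move=> nz z1 z2; have [z3 d1 d2] := square_pair z1 z2.
have -> : winding q = winding (q.1, q'.2).
  move: d2; rewrite !inE => /or3P[] /eqP d.
  - by rewrite [q in LHS]surjective_pairing; congr (winding (_, _)); clear -d; lia.
  - have E : q'.2 = q.2 - 1 by clear -d; lia.
    by rewrite E in z3 *; rewrite [q in LHS]surjective_pairing; apply: (winding_down nz); rewrite -?surjective_pairing.
  - have E : q.2 = q'.2 - 1 by clear -d; lia.
    rewrite [q in LHS]surjective_pairing E; apply/esym/(winding_down nz) => //.
    by rewrite -E -surjective_pairing.
move: d1; rewrite !inE => /or3P[] /eqP d.
- by rewrite [q' in RHS]surjective_pairing; congr (winding (_, _)); clear -d; lia.
- have E : q'.1 = q.1 - 1 by clear -d; lia.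
  rewrite [q' in RHS]surjective_pairing E; apply: (winding_left nz) => //.
  by rewrite -E -surjective_pairing.
- have E : q.1 = q'.1 - 1 by clear -d; lia.
  rewrite E in z3 *; rewrite [q' in RHS]surjective_pairing; apply/esym/(winding_left nz) => //.
Qed.

Lemma winding_bounded : exists B : nat, forall q, winding q != 0 ->
  (`|q.1| <= B)%N /\ (`|q.2| <= B)%N.
Proof.
have [B hB] : exists B : nat, forall v, v \in u :: m -> (`|v.1| < B)%N /\ (`|v.2| < B)%N.
  elim: (u :: m) => [|a r [B hB]]; first by exists 0%N.
  exists (maxn B (maxn `|a.1| `|a.2|).+1) => v; rewrite inE => /orP[/eqP ->|/hB[b1 b2]].
    by split; rewrite leq_max ltnS leq_max leqnn ?orbT.
  by split; rewrite leq_max ?b1 ?b2.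
exists B => q wq.
have nz : ~ forall v w, v \in u :: m -> w \in u :: m -> crossing q v w = 0.
  by move=> H; move/negP: wq; apply; apply/eqP; exact: step_sum0.
have q1 : (`|q.1| <= B)%N.
  rewrite leqNgt; apply/negP => q1; apply: nz => v w /hB[v1 v2] /hB[w1 w2].
  move: q1 v1 v2 w1 w2; rewrite /crossing; clear.
  by move: q v w => [? ?] [? ?] [? ?] /=; do ![case: ifP]; lia.
split=> //; rewrite leqNgt; apply/negP => q2; case: (ltP 0 q.2) => q20.
  apply: nz => v w /hB[v1 v2] /hB[w1 w2].
  move: q20 q2 v1 v2 w1 w2; rewrite /crossing; clear.
  by move: q v w => [? ?] [? ?] [? ?] /=; do ![case: ifP]; lia.
(* For a square below the whole walk the ray counts as much as the full vertical line, and a closed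
   walk crosses a line equally often in both senses. *)
pose g (v : V) : int := if q.1 < v.1 then 1 else 0.
have := step_sum_telescope g u m; rewrite closed_walk subrr => tel.
move/negP: wq; apply; apply/eqP; rewrite /winding -[RHS]tel.
have pw : path (fun v w => lazy (edge_in o h Omega) v w && (`|v.2| < B)%N) u m.
  elim: (m) (u) walk hB => //= a r IH b /andP[-> p] H; rewrite IH ?andbT //=.
    by case: (H b) => //; rewrite inE eqxx.
  by move=> v vr; apply: H; rewrite inE vr orbT.
apply: (eq_step_sum pw) => v w /andP[/orP[/eqP <-|/andP[adj _]] vB].
  by rewrite /crossing /g; clear; do ![case: ifP]; lia.
move: adj vB q1 q2 q20; rewrite /crossing /g /adjacent; clear.
by move: q v w => [q1 q2] [v1 v2] [w1 w2] /=; do ![case: ifP]; lia.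
Qed.

End Winding.
End Separation.

Section Separation.
Context {R : realType}.
Notation V := (int * int)%type.
Implicit Types (Omega E : set (plane R)) (x y z : plane R) (c : R -> plane R).

Lemma within_clamp (V : normedModType R) (c : R -> V) :
  {within unit_interval, continuous c} -> continuous (fun t => c (clamp t)).
Proof.
move=> /subspace_continuousP H t; apply: (@cvg_comp _ _ _ clamp c); last first.
  by apply: H; exact: clamp_in.
move=> A [/= e e0 H']; have [r r0 Hr] := cont_ex e0 (@clamp_continuous R t).
apply: (@ex_near _ _ t (fun s => A (clamp s)) r r0) => s ts /=; apply: H'; first exact: Hr.
exact: clamp_in.
Qed.

Lemma hom_loop_homotopic Omega x c0 c1 :
  hom Omega x (fun t => c0 (clamp t)) (fun t => c1 (clamp t)) ->
  loop_homotopic Omega x c0 c1.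
Proof.
move=> [H [cH HO H0 H1 Hx]]; exists H; split.
- exact: continuous_subspaceT.
- by move=> s t _ _; exact: HO.
- by move=> t t01; rewrite H0 // clamp_id.
- by move=> t t01; rewrite H1 // clamp_id.
- by move=> s _; exact: Hx.
Qed.

Lemma bounded_setP (W : normedModType R) (A : set W) : bounded_set A ->
  exists2 B : R, 0 < B & forall w, A w -> `|w| <= B.
Proof.
move=> [M [_ H]]; exists (Num.max M 0 + 1).
  by rewrite ltr_pwDr // le_max lexx orbT.
by move=> z Az; apply: H => //; rewrite ltr_pwDr // le_max lexx.
Qed.

(** [E] consists of the points outside Omega with nonzero winding number. This number is locally
    constant on the complement of Omega, so that [E] and the rest of the complement are both closed,
    and it vanishes far away. *)
Lemma hole_of_winding o h Omega u m q : 0 < h -> open Omega ->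
  path (lazy (edge_in o h Omega)) u m -> last u m = u ->
  ~ square o h q `<=` Omega -> step_sum (crossing q) (u :: m) != 0 ->
  exists E : set (plane R), [/\ E !=set0, E `<=` ~` Omega, closed E,
    closed (~` Omega `\` E) & bounded_set E].
Proof.
move=> h0 oO pm lm qO wq.
pose E := [set z | ~ Omega z /\ winding u m (cell o h z) != 0].
have loc z : ~ Omega z -> exists2 r : R, 0 < r &
    forall z', ~ Omega z' -> `|z - z'| < r ->
      winding u m (cell o h z') = winding u m (cell o h z).
  move=> nz; have [r r0 H] := square_near o h0 z.
  exists r => // z' _ zz'; apply: (winding_const h0 pm lm nz); first exact: H.
  exact: square_cell.
have clos (A B : set (plane R)) : A `|` B = ~` Omega ->
    (forall z z', A z -> B z' -> winding u m (cell o h z') <> winding u m (cell o h z)) ->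
    closed A.
  move=> ABO AB z Az; apply: contrapT => nAz.
  have [nz|Oz] := pselect (~ Omega z); last first.
    have [z' [Az' Oz']] := Az _ (open_nbhs_nbhs (conj oO (contrapT Oz))).
    by have : (A `|` B) z' by [left]; rewrite ABO.
  have Bz : B z by have : (A `|` B) z by [rewrite ABO]; case.
  have [r r0 H] := loc z nz.
  have [z' [Az' zz']] := Az _ (ex_near r0 (fun z' => id)).
  have nz' : ~ Omega z' by have : (A `|` B) z' by [left]; rewrite ABO.
  by apply: (AB z' z Az' Bz); rewrite H.
exists E; split.
- have [z zq nz] : exists2 z, square o h q z & ~ Omega z.
    by apply: contrapT => H; apply: qO => z zq; apply: contrapT => nz; apply: H; exists z.
  exists z; split=> //.
  by rewrite (winding_const h0 pm lm nz (square_cell _ h0 _) zq).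
- by move=> z [].
- apply: (clos _ (~` Omega `\` E)).
    by apply/seteqP; split=> z /=; [move=> [[]|[]]|move=> nz; have [Ez|nE] := pselect (E z); [left|right]].
  move=> z z' [_ wz] [nz' nE] ww; apply: nE; split=> //; by rewrite ww.
- apply: (clos _ E).
    by apply/seteqP; split=> z /=; [move=> [[]|[]]|move=> nz; have [Ez|nE] := pselect (E z); [right|left]].
  move=> z z' [nz nE] [_ wz'] ww; apply: nE; split=> //; by rewrite -ww.
have [B hB] := winding_bounded pm lm.
exists (`|o| + h * B%:R + h); split; first exact: num_real.
move=> M hM z [nz /hB[B1 B2]]; apply: (le_trans _ (ltW hM)).
have Bh : 0 <= h * B%:R by rewrite mulr_ge0 // ltW.
apply: mx_norm_le => [|i j]; first by rewrite !addr_ge0 // ltW.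
rewrite ord1; have /andP[a b] := cell_bounds o h0 z j.
have ok : `|o 0 j| <= `|o| by exact: entry_le.
have hc : `|h * (coord (cell o h z) j)%:~R| <= h * B%:R.
  rewrite normrM (gtr0_norm h0) ler_pM2l // -intr_norm (_ : B%:R = (B%:Z)%:~R) // ler_int.
  by case: (ord2P j) => ->; rewrite /coord /=; [move: B1|move: B2]; rewrite /=; clear; lia.
rewrite ptE in a b.
move: ok hc; rewrite !ler_norml => /andP[k1 k2] /andP[h1 h2].
by apply/andP; split; lra.
Qed.

Lemma separation Omega : open Omega -> bounded_set Omega -> pi1_nontrivial Omega ->
  exists E : set (plane R), [/\ E !=set0, E `<=` ~` Omega, closed E,
    closed (~` Omega `\` E) & bounded_set E].
Proof.
move=> oO /bounded_setP[B B0 hB] [x Ox nontriv]; apply: contrapT => nE; apply: nontriv.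
have null c : continuous c -> (forall t, Omega (c t)) -> c 0 = x -> c 1 = x ->
    hom Omega x c (cst x).
  move=> cc cO c0 c1; have [h0 h00 H] := discretize oO cc cO c0 c1.
  pose h := h0 / 2; have h_gt0 : 0 < h by rewrite divr_gt0.
  (* [x] becomes the grid point [(K, K)], and [K] is so large that Omega lies above the grid origin
     [o]. *)
  pose K := (Num.trunc ((B + `|x| + 1) / h)).+1.
  have hK : B + `|x| + 1 < h * K%:R.
    by rewrite -ltr_pdivrMl // [ltLHS]mulrC; exact: truncnS_gt.
  pose o : plane R := x - const_mx (h * K%:R).
  have u0x : pt o h (K%:Z, K%:Z) = x.
    by apply/rowP => k; rewrite !mxE; case: (ord2P k) => ->; rewrite /coord /= subrK.
  have hh : 0 < h < h0 by rewrite h_gt0 /h /=; lra.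
  have [m [pm lm hm]] := H o h _ hh u0x.
  apply: (hom_trans hm).
  have := @walk_null R o h h_gt0 Omega (K%:Z, K%:Z) m; rewrite u0x; apply => //.
  - move=> z /hB zB; rewrite !mxE.
    have := entry_le z 0 1; have := entry_le x 0 1; rewrite !ler_norml => /andP[a b] /andP[c' d].
    by lra.
  - move=> q v m' qO pm' lm'; apply/eqP/negPn/negP => wq; apply: nE.
    exact: (hole_of_winding h_gt0 oO pm' lm' qO wq).
have all_hom c0 c1 : loop Omega x c0 -> loop Omega x c1 -> loop_homotopic Omega x c0 c1.
  move=> [cc0 O0 c00 c01] [cc1 O1 c10 c11]; apply: hom_loop_homotopic.
  have k0 : clamp 0 = 0 :> R by rewrite clamp_le0.
  have k1 : clamp 1 = 1 :> R by rewrite clamp_ge1.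
  have kI t : unit_interval (clamp t) by exact: clamp_in.
  apply: (hom_trans (c1 := cst x)); last apply: hom_sym.
    by apply: null; rewrite ?k0 ?k1 //; [exact: within_clamp|move=> t; exact: O0].
  by apply: null; rewrite ?k0 ?k1 //; [exact: within_clamp|move=> t; exact: O1].
have cst_loop : loop Omega x (cst x).
  by split=> //; exact/continuous_subspaceT/cst_continuous.
have cE c : loop Omega x c -> loop_class Omega x c = loop Omega x.
  by move=> lc; apply/seteqP; split=> [c' []//|c' lc']; split=> //; exact: all_hom.
apply/seteqP; split=> [_ [c lc <-]|_ ->] /=; first by rewrite !cE.
by exists (cst x).
Qed.

End Separation.

(** * Angles *)

Section Angles.
Context {R : realType}.
Implicit Types (u v w z : plane R) (L : seq (plane R)).

Lemma dotE u v : dot u v = u 0 0 * v 0 0 + u 0 1 * v 0 1.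
Proof. by rewrite /dot big_ord_recr /= big_ord1; congr (_ * _ + _ * _); congr (_ _ _); apply: val_inj. Qed.

Lemma dotC u v : dot u v = dot v u.
Proof. by rewrite !dotE; ring. Qed.

Lemma dot_ge0 u : 0 <= dot u u.
Proof. by rewrite dotE -!expr2 addr_ge0 ?sqr_ge0. Qed.

Lemma enorm_ge0 u : 0 <= enorm u.
Proof. exact: sqrtr_ge0. Qed.

Lemma enorm_sqr u : enorm u ^+ 2 = dot u u.
Proof. by rewrite sqr_sqrtr ?dot_ge0. Qed.

Lemma enorm_gt0 u : (0 < enorm u) = (0 < dot u u).
Proof. by rewrite /enorm sqrtr_gt0. Qed.

Definition cross u v : R := u 0 0 * v 0 1 - u 0 1 * v 0 0.

(** [t] is an argument of [z]; every [t] is one if [z = 0]. *)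
Definition polar z (t : R) := z 0 0 = enorm z * cos t /\ z 0 1 = enorm z * sin t.

(* The oriented angle from [u] to [v] when it is acute. *)
Definition ang u v : R := atan (cross u v / dot u v).

Lemma sin_atan (x : R) : sin (atan x) = x * cos (atan x).
Proof.
have c0 : cos (atan x) != 0 by rewrite cos_atan invr_eq0 gt_eqF // sqrtr_gt0 ltr_pwDl ?sqr_ge0.
by rewrite -{2}(atanK x) /tan divfK.
Qed.

(** For an acute angle, [dot u v] and [cross u v] divided by the lengths are its cosine and sine.
    This lets arguments be followed continuously in small steps. *)
Lemma polar_step u v (t : R) : polar u t -> 0 < dot u v -> polar v (t + ang u v).
Proof.
move=> [u0 u1] d0.
have nu : 0 < enorm u.
  rewrite lt_neqAle enorm_ge0 andbT eq_sym; apply/eqP => e0.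
  by move: d0; rewrite dotE u0 u1 e0 !mul0r addr0 ltxx.
have nv : 0 < enorm v.
  rewrite enorm_gt0 lt_neqAle dot_ge0 andbT eq_sym; apply/eqP => e0.
  have /eqP : dot v v = 0 by [].
  rewrite dotE -!expr2 paddr_eq0 ?sqr_ge0 // !sqrf_eq0 => /andP[/eqP v0 /eqP v1].
  by move: d0; rewrite dotE v0 v1 !mulr0 addr0 ltxx.
have cosE : cos (ang u v) = dot u v / (enorm u * enorm v).
  rewrite cos_atan -[RHS]invf_div; congr (_^-1).
  have -> : 1 + (cross u v / dot u v) ^+ 2 = (enorm u * enorm v / dot u v) ^+ 2.
    rewrite !exprMn !enorm_sqr exprVn !dotE /cross; field.
    by rewrite -dotE gt_eqF.
  by rewrite sqrtr_sqr ger0_norm // divr_ge0 ?mulr_ge0 ?enorm_ge0 // ltW.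
have sinE : sin (ang u v) = cross u v / (enorm u * enorm v).
  rewrite /ang sin_atan -/(ang u v) cosE; field.
  by rewrite !gt_eqF.
have nu2 : enorm u ^+ 2 = u 0 0 * u 0 0 + u 0 1 * u 0 1 by rewrite enorm_sqr dotE.
have ct : cos t = u 0 0 / enorm u by rewrite u0 mulrAC divff ?mul1r // gt_eqF.
have st : sin t = u 0 1 / enorm u by rewrite u1 mulrAC divff ?mul1r // gt_eqF.
have nu2' : u 0 0 * u 0 0 + u 0 1 * u 0 1 != 0 by rewrite -nu2 gt_eqF // exprn_gt0.
split; rewrite ?cosD ?sinD ct st cosE sinE.
  have -> : enorm v * (u 0 0 / enorm u * (dot u v / (enorm u * enorm v)) -
     u 0 1 / enorm u * (cross u v / (enorm u * enorm v))) =
     (u 0 0 * dot u v - u 0 1 * cross u v) / enorm u ^+ 2.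
    by field; rewrite !gt_eqF.
  by rewrite nu2 dotE /cross; field.
have -> : enorm v * (u 0 1 / enorm u * (dot u v / (enorm u * enorm v)) +
     u 0 0 / enorm u * (cross u v / (enorm u * enorm v))) =
     (u 0 1 * dot u v + u 0 0 * cross u v) / enorm u ^+ 2.
  by field; rewrite !gt_eqF.
by rewrite nu2 dotE /cross; field.
Qed.

Lemma ang_lt u v : `|ang u v| < pi / 2.
Proof. by rewrite ltr_norml atan_gtNpi2 atan_ltpi2. Qed.

Lemma cos1_eq0 (x : R) : cos x = 1 -> `|x| < 2 * pi -> x = 0.
Proof.
move=> c1 xp; have c2 : cos (`|x| / 2 + `|x| / 2) = 1.
  by rewrite -splitr; case: (ger0P x) => // _; rewrite cosN.
move: c2; rewrite cosD -!expr2 cos2sin2 => c2.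
have s0 : sin (`|x| / 2) = 0 by apply/eqP; rewrite -sqrf_eq0; apply/eqP; lra.
apply/eqP; rewrite -normr_eq0; apply/eqP; apply: contrapT => /eqP x0.
have xpos : 0 < `|x| by rewrite lt_neqAle eq_sym x0 normr_ge0.
have /sin_gt0_pi : 0 < `|x| / 2 < pi by apply/andP; split; lra.
by rewrite s0 ltxx.
Qed.

Lemma polar_unique z (s t : R) : 0 < enorm z -> polar z s -> polar z t ->
  `|s - t| < 2 * pi -> s = t.
Proof.
move=> n0 [a b] [c d] st.
have nz : enorm z != 0 by rewrite gt_eqF.
have ce : cos s = cos t by apply: (mulfI nz); rewrite -a -c.
have se : sin s = sin t by apply: (mulfI nz); rewrite -b -d.
apply/eqP; rewrite -subr_eq0; apply/eqP; apply: cos1_eq0 => //.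
by rewrite cosB ce se -!expr2 cos2Dsin2.
Qed.

Lemma dot_continuous (T : topologicalType) (f g : T -> plane R) :
  continuous f -> continuous g -> continuous (fun x => dot (f x) (g x)).
Proof.
move=> cf cg; have c (k : 'I_2) (f' : T -> plane R) : continuous f' -> continuous (fun x => f' x 0 k).
  by move=> cf'; exact: (cont_comp cf' (@coord_continuous R 1 2 0 k)).
rewrite (_ : (fun x => _) = fun x => f x 0 0 * g x 0 0 + f x 0 1 * g x 0 1); last first.
  by apply/funext => x; rewrite dotE.
by apply: (@cont_add R _ R); apply: cont_mul; exact: c.
Qed.

Lemma ang_continuous (T : topologicalType) (f g : T -> plane R) :
  continuous f -> continuous g -> (forall x, 0 < dot (f x) (g x)) ->
  continuous (fun x => ang (f x) (g x)).
Proof.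
move=> cf cg d0; have c (k : 'I_2) (f' : T -> plane R) : continuous f' -> continuous (fun x => f' x 0 k).
  by move=> cf'; exact: (cont_comp cf' (@coord_continuous R 1 2 0 k)).
have cr : continuous (fun x => cross (f x) (g x)).
  by apply: (@cont_sub R _ R); apply: cont_mul; exact: c.
have cq : continuous (fun x => cross (f x) (g x) / dot (f x) (g x)).
  apply: cont_mul => // x; apply: cvgV; first by rewrite gt_eqF.
  exact: dot_continuous.
exact: (cont_comp cq (@continuous_atan R)).
Qed.

(** By polarization, since the Euclidean lengths satisfy |u - v|^2 <= 2 d^2 and |u|^2 >= 4 d^2. *)
Lemma dot_pos u v (d : R) : `|u - v| <= d -> 0 < d -> 2 * d <= `|u| -> 0 < dot u v.
Proof.
move=> uv d0 ud.
have E : 2 * dot u v = dot u u + dot v v - dot (u - v) (u - v).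
  by rewrite !dotE !mxE; ring.
have sq (x : R) : `|x| <= d -> x * x <= d ^+ 2.
  by move=> xd; rewrite -expr2 -(real_normK (num_real x)) ler_sqr ?nnegrE ?normr_ge0 // ltW.
have D : dot (u - v) (u - v) <= 2 * d ^+ 2.
  rewrite dotE; have := sq _ (le_trans (entry_le (u - v) 0 0) uv).
  by have := sq _ (le_trans (entry_le (u - v) 0 1) uv); lra.
have U : (2 * d) ^+ 2 <= dot u u.
  have : exists k : 'I_2, 2 * d <= `|u 0 k|.
    apply: contrapT => H; move: ud; apply/negP; rewrite -ltNge.
    apply: mx_norm_lt => [|i k]; first by lra.
    by rewrite ord1 ltNge; apply/negP => h; apply: H; exists k.
  move=> [k uk]; have {}uk : (2 * d) ^+ 2 <= u 0 k ^+ 2.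
    by rewrite -(real_normK (num_real (u 0 k))) ler_sqr ?nnegrE ?normr_ge0 //; lra.
  have := sqr_ge0 (u 0 0); have := sqr_ge0 (u 0 1).
  by rewrite dotE -!expr2; case: (ord2P k) uk => -> uk; lra.
have := dot_ge0 v; have := exprn_gt0 2 d0; rewrite exprMn in U; lra.
Qed.

End Angles.

(** * Loops around the hole *)

Section Contour.
Notation V := (int * int)%type.
Implicit Types (u v w q : V) (m : seq V).

(** A cochain whose sums over closed walks vanish is exact: in each connected component the
    potential is the sum along any walk from a chosen representative. *)
Lemma potential (r : rel V) (c : V -> V -> int) : symmetric r ->
  (forall u v, c v u = - c u v) ->
  (forall u m, path r u m -> last u m = u -> step_sum c (u :: m) = 0) ->
  exists phi : V -> int, forall u v, r u v -> phi v - phi u = c u v.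
Proof.
move=> r_sym c_anti closed0.
pose T u n v := exists m, [/\ path r u m, last u m = v & step_sum c (u :: m) = n].
have T_trans u v w n n' : T u n v -> T v n' w -> T u (n + n') w.
  move=> [m [pm lm sm]] [m' [pm' lm' sm']]; exists (m ++ m'); split.
  - by rewrite cat_path pm lm.
  - by rewrite last_cat lm.
  - have -> : u :: m ++ m' = belast u m ++ v :: m' by rewrite -lm -cat_rcons -lastI.
    by rewrite step_sum_cat -{1}lm -lastI sm sm'.
have T_step u v : r u v -> T u (c u v) v.
  by move=> uv; exists [:: v]; rewrite /= uv; split=> //; rewrite step_sum_cons step_sum1 addr0.
have T_sym u v n : T u n v -> T v (- n) u.
  move=> [m]; elim: m u n => [|a m IH] u n /= [pm lm sm].
    by move: lm sm => <-; rewrite step_sum1 => <-; exists [::]; rewrite step_sum1 oppr0.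
  case/andP: pm => ua pm; rewrite step_sum_cons in sm.
  rewrite -sm opprD addrC -(c_anti u a); apply: T_trans; last by apply: T_step; rewrite r_sym.
  by apply: IH.
have T_uniq u v n n' : T u n v -> T u n' v -> n = n'.
  move=> t /T_sym t'; have [m [pm lm sm]] := T_trans _ _ _ _ _ t t'.
  by apply/eqP; rewrite -subr_eq0 -sm closed0.
pose conn u := [set v | exists n, T u n v].
have conn_eq u v : r u v -> conn u = conn v.
  move=> uv; apply/seteqP; split=> w [n t] /=.
    by exists (- c u v + n); apply: T_trans t; apply: T_sym; exact: T_step.
  by exists (c u v + n); apply: T_trans t; exact: T_step.
pose rep u := xget (0, 0) (conn u).
have repP u : exists n, T (rep u) n u.
  have : conn u (rep u) by apply: (@xgetPex _ (0, 0) (conn u)); exists u, 0, [::]; rewrite step_sum1.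
  by move=> [n t]; exists (- n); exact: T_sym.
have [phi phiP] := choice repP.
exists phi => u v uv; have t := phiP u; have := phiP v; rewrite /rep -(conn_eq u v uv) => t'.
by rewrite (T_uniq _ _ _ _ t' (T_trans _ _ _ _ _ t (T_step _ _ uv))) addrC addKr.
Qed.

(** Summation by parts: only the positions where [b] changes would contribute, and there [X]
    vanishes. *)
Lemma abel_sum (b : nat -> bool) (X : nat -> int) M : b 0%N = false -> b M = false ->
  (forall j, b j.+1 != b j -> X j.+1 = 0) ->
  \sum_(j < M) (b j)%:Z * (X j - X j.+1) = 0.
Proof.
move=> b0 bM h.
suff -> : \sum_(j < M) (b j)%:Z * (X j - X j.+1) = - ((b M)%:Z * X M).
  by rewrite bM mul0r oppr0.
elim: M {bM} => [|M IH]; first by rewrite big_ord0 b0 mul0r oppr0.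
rewrite big_ord_recr /= IH mulrBr addKr; congr (- _).
have [->//|/h ->] := eqVneq (b M.+1) (b M).
by rewrite !mulr0.
Qed.

(* The edges that separate a square of [b] from a square outside [b]. *)
Definition border (b : pred V) u v : bool := adjacent u v &&
  (if u.2 == v.2 then b (Num.min u.1 v.1, u.2) (+) b (Num.min u.1 v.1, u.2 - 1)
   else b (u.1, Num.min u.2 v.2) (+) b (u.1 - 1, Num.min u.2 v.2)).

Lemma border_sym b : symmetric (border b).
Proof.
move=> u v; rewrite /border.
have -> : adjacent u v = adjacent v u by rewrite /adjacent; clear; lia.
case adj: (adjacent v u) => //=.
rewrite [v.2 == _]eq_sym ![Num.min v.1 _]minC ![Num.min v.2 _]minC.
have [->//|n2] := eqVneq u.2 v.2.
suff -> : u.1 = v.1 by [].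
by move: adj n2; rewrite /adjacent; clear; move: u v => [? ?] [? ?] /=; lia.
Qed.

Lemma borderh b i j : b (i, j) != b (i, j - 1) -> border b (i, j) (i + 1, j).
Proof.
move=> h; rewrite /border /adjacent /= !eqxx /= orbT orbT /=.
have -> : Num.min i (i + 1) = i by rewrite min_l // lerDl.
by move: h; case: (b _); case: (b _).
Qed.

Lemma borderv b i j : b (i, j) != b (i - 1, j) -> border b (i, j) (i, j + 1).
Proof.
move=> h; rewrite /border /adjacent /= !eqxx /= orbT /=.
have -> : (j == j + 1) = false by clear; lia.
have -> : Num.min j (j + 1) = j by rewrite min_l // lerDl.
by move: h; case: (b _); case: (b _).
Qed.

(** Discrete Stokes. Otherwise the crossing cochain would have a potential [phi] along the border of
    [b], and the cochain (X, Y), which is crossing minus the coboundary of [phi], would vanish on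
    the border. The sum of its curls over the squares of [b] is then 0. But the coboundary has no
    curl, and the crossing cochain has curl -1 at the square (0, 0) and 0 elsewhere. *)
Lemma contour (b : pred V) (M : nat) : (forall q, b q -> (`|q.1| < M)%N /\ (`|q.2| < M)%N) ->
  b (0, 0) -> exists u m, [/\ path (border b) u m, last u m = u &
    step_sum (crossing (0, 0)) (u :: m) != 0].
Proof.
move=> bM b0; apply: contrapT => H.
have anti u v : crossing (0, 0) v u = - crossing (0, 0) u v.
  rewrite /crossing /=; move: u v => [? ?] [? ?] /=; clear.
  by do ![case: ifP]; lia.
have [|phi phiP] := @potential (border b) (crossing (0, 0)) (@border_sym b) anti.
  move=> u m pm lm; apply/eqP/negPn/negP => h; apply: H; by exists u, m.
pose cr (i j : int) : int := crossing (0, 0) (i, j) (i + 1, j).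
pose X (i j : int) := cr i j - (phi (i + 1, j) - phi (i, j)).
pose Y (i j : int) := - (phi (i, j + 1) - phi (i, j)).
have X0 i j : b (i, j) != b (i, j - 1) -> X i j = 0.
  by move=> /borderh /phiP; rewrite /X /cr => ->; rewrite subrr.
have Y0 i j : b (i, j) != b (i - 1, j) -> Y i j = 0.
  move=> /borderv /phiP; rewrite /Y => ->; rewrite /crossing /=; clear.
  by have -> : (j == j + 1) = false by [lia]; rewrite andbF oppr0.
(* The window from -M to M exceeds [b], so that every row and column starts and ends outside [b]. *)
pose sh (a : nat) : int := a%:Z - M%:Z.
have shS a : sh a.+1 = sh a + 1 by rewrite /sh; clear; lia.
have bout (a c : nat) : a = 0%N \/ a = M.*2 \/ c = 0%N \/ c = M.*2 -> b (sh a, sh c) = false.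
  move=> hac; apply/negP => /bM[] /=; rewrite /sh; move: hac; clear; lia.
have SX : \sum_(a < M.*2) \sum_(c < M.*2) (b (sh a, sh c))%:Z * (X (sh a) (sh c) - X (sh a) (sh c.+1)) = 0.
  apply: big1 => a _; apply: (@abel_sum (fun c => b (sh a, sh c)) (fun c => X (sh a) (sh c))).
  - by apply: bout; right; right; left.
  - by apply: bout; right; right; right.
  - by move=> c hb; apply: X0; rewrite shS addrK -shS.
have SY : \sum_(a < M.*2) \sum_(c < M.*2) (b (sh a, sh c))%:Z * (Y (sh a) (sh c) - Y (sh a.+1) (sh c)) = 0.
  rewrite exchange_big /=; apply: big1 => c _.
  apply: (@abel_sum (fun a => b (sh a, sh c)) (fun a => Y (sh a) (sh c))).
  - by apply: bout; left.
  - by apply: bout; right; left.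
  - by move=> a hb; apply: Y0; rewrite shS addrK -shS.
have M0 : (0 < M)%N by case: (bM _ b0) => /= h _; apply: leq_ltn_trans h.
have MM : (M < M.*2)%N by clear -M0; lia.
have : \sum_(a < M.*2) \sum_(c < M.*2) (b (sh a, sh c))%:Z *
    (cr (sh a) (sh c) - cr (sh a) (sh c + 1)) = -1.
  rewrite (bigD1 (Ordinal MM)) //= (bigD1 (Ordinal MM)) //=.
  have shM : sh M = 0 by rewrite /sh subrr.
  have crE i j : cr i j - cr i (j + 1) = - ((i == 0) && (j == 0))%:Z.
    by rewrite /cr /crossing /=; clear; do ![case: ifP]; lia.
  rewrite shM b0 crE /= mul1r big1 ?addr0 ?big1 ?addr0 //.
  - move=> a aM; apply: big1 => c _; rewrite crE.
    have -> : (sh a == 0) = false.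
      by move: aM; rewrite -val_eqE /= /sh; clear; lia.
    by rewrite mulr0.
  - move=> c cM; rewrite crE.
    have -> : (sh c == 0) = false.
      by move: cM; rewrite -val_eqE /= /sh; clear; lia.
    by rewrite andbF mulr0.
have : \sum_(a < M.*2) \sum_(c < M.*2) (b (sh a, sh c))%:Z *
    (cr (sh a) (sh c) - cr (sh a) (sh c + 1)) =
  \sum_(a < M.*2) \sum_(c < M.*2) (b (sh a, sh c))%:Z * (X (sh a) (sh c) - X (sh a) (sh c.+1))
  - \sum_(a < M.*2) \sum_(c < M.*2) (b (sh a, sh c))%:Z * (Y (sh a) (sh c) - Y (sh a.+1) (sh c)).
  rewrite -sumrB; apply: eq_bigr => a _; rewrite -sumrB; apply: eq_bigr => c _.
  by rewrite /X /Y !shS; ring.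
by rewrite SX SY subrr => ->.
Qed.

End Contour.

(** * Continuous angles along polygons *)

Section Lift.
Context {R : realType}.
Variables (a : plane R) (h : R).
Hypothesis h_gt0 : 0 < h.
Notation V := (int * int)%type.
Implicit Types (z : plane R) (L : seq (plane R)).

(** The angle around [a] swept by the curve of [L] from time 0 on, provided that the edges are
    [short]. *)
Fixpoint lift L (t : R) : R :=
  match L with
  | [::] => 0
  | u :: L' => match L' with
    | [::] => 0
    | v :: _ => ang (u - a) ((1 - clamp t) *: u + clamp t *: v - a) +
                lift L' (Num.max 0 (t - 1))
    end
  end.

Lemma lift_cons u v L t : lift [:: u, v & L] t =
  ang (u - a) ((1 - clamp t) *: u + clamp t *: v - a) + lift (v :: L) (Num.max 0 (t - 1)).
Proof. by []. Qed.

Definition short : rel (plane R) := fun u v => (`|u - v| <= h) && (2 * h <= `|u - a|).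

Lemma short_dot u v (t : R) : short u v -> 0 <= t <= 1 ->
  0 < dot (u - a) ((1 - t) *: u + t *: v - a).
Proof.
move=> /andP[uv ua] /andP[t0 t1]; apply: (dot_pos (d := h)) => //.
have -> : u - a - ((1 - t) *: u + t *: v - a) = t *: (u - v).
  by apply/rowP => k; rewrite !mxE; ring.
by rewrite normrZ ger0_norm //; apply: le_trans uv; rewrite ler_piMl.
Qed.

Lemma ang_id z : ang z z = 0.
Proof. by rewrite /ang /cross [z 0 1 * _]mulrC subrr mul0r atan0. Qed.

Lemma lift_le0 L t : t <= 0 -> lift L t = 0.
Proof.
elim: L t => // u [|v L] // IH t t0.
rewrite lift_cons IH ?clamp_le0 ?subr0 ?scale1r ?scale0r ?addr0 ?ang_id //.
by rewrite ge_max lexx /=; lra.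
Qed.

Lemma lift_ge1 u v L t : 1 <= t ->
  lift [:: u, v & L] t = ang (u - a) (v - a) + lift (v :: L) (t - 1).
Proof.
move=> t1; rewrite lift_cons clamp_ge1 // subrr scale0r scale1r add0r max_r //; lra.
Qed.

Lemma lift_polar u L (s t : R) : path short u L -> polar (u - a) s ->
  polar (curve (u :: L) t - a) (s + lift (u :: L) t).
Proof.
elim: L u s t => [|v L IH] u s t; first by rewrite /= addr0.
move=> /= /andP[uv pL] us; rewrite -/(curve [:: u, v & L] t) -/(lift [:: u, v & L] t).
case: (leP t 0) => [t0|/ltW t0]; first by rewrite curve_le0 // lift_le0 // addr0.
case: (leP t 1) => [t1|/ltW t1].
  have t01 : 0 <= t <= 1 by rewrite t0.
  rewrite curve_le1 // lift_cons lift_le0 ?addr0 ?clamp_id //; last by rewrite ge_max lexx /=; lra.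
  by apply: polar_step => //; exact: short_dot.
rewrite curve_ge1 // lift_ge1 // addrA; apply: IH => //; apply: polar_step => //.
have := @short_dot u v 1 uv; rewrite ler01 lexx subrr scale0r scale1r add0r; exact.
Qed.

Lemma lift_continuous u L : path short u L -> continuous (lift (u :: L)).
Proof.
elim: L u => [|v L IH] u; first by move=> _; exact: cst_continuous.
move=> /andP[uv pL].
change (continuous (fun t : R => ang (u - a) ((1 - clamp t) *: u + clamp t *: v - a) +
  lift (v :: L) (Num.max 0 (t - 1)))).
apply: (@cont_add R _ R).
  apply: ang_continuous.
  - exact: cst_continuous.
  - apply: cont_sub; last exact: cst_continuous.
    apply: cont_add; apply: cont_scale; try exact: cst_continuous.
      by apply: (@cont_sub R _ R); [exact: cst_continuous|exact: clamp_continuous].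
    exact: clamp_continuous.
  - by move=> t; apply: short_dot => //; exact: clamp_in.
have cm : continuous (fun t : R => Num.max 0 (t - 1)).
  apply: cont_max; first exact: cst_continuous.
  by apply: (@cont_sub R _ R); [move=> t; exact: cvg_id|exact: cst_continuous].
exact: (cont_comp cm (IH v pL)).
Qed.

(** Coordinates relative to the middle of the square (0, 0), in units of [h]; being half-integers
    they never vanish. *)
Definition vcoord (i : int) : R := i%:~R - 1 / 2.

(* The angle of the vertex [u] seen from the middle [a] of the square (0, 0),
   with a branch cut along the upward vertical ray. *)
Definition vangle (u : V) : R := atan (vcoord u.2 / vcoord u.1) - (if 0 < u.1 then 0 else pi).

Let o : plane R := a - const_mx (h / 2).

Lemma pt_center (u : V) k : (pt o h u - a) 0 k = h * vcoord (coord u k).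
Proof. by rewrite !mxE /vcoord; field. Qed.

Lemma vcoord_gt0 i : (0 < vcoord i) = (0 < i).
Proof.
rewrite /vcoord; case: (ltP 0 i) => i0.
  have : (1%:~R : R) <= i%:~R by rewrite ler_int; move: i0; clear; lia.
  by move=> h1; apply/idP; rewrite mulr1z in h1; lra.
have : i%:~R <= (0%:~R : R) by rewrite ler_int.
by rewrite mulr0z => h1; apply/negbTE; rewrite -leNgt; lra.
Qed.

Lemma vcoord_lt0 i : (vcoord i < 0) = (i <= 0).
Proof.
rewrite leNgt -vcoord_gt0 -leNgt le_eqVlt; case: eqP => //= v0.
have : i%:~R * 2 = (1%:~R : R) by rewrite /vcoord in v0; rewrite mulr1z; lra.
rewrite -[2]/(2%:~R) -intrM => /eqP; rewrite eqr_int; clear; lia.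
Qed.

Lemma vangle_polar u : polar (pt o h u - a) (vangle u).
Proof.
have E (s : R) : s * s = 1 -> 0 < s * vcoord u.1 ->
    ang (\row_k (if k == 0 then s else 0)) (pt o h u - a) = atan (vcoord u.2 / vcoord u.1).
  move=> s1 su; rewrite /ang /cross dotE !pt_center /coord /= !mxE /=; congr atan.
  have x0 : vcoord u.1 != 0 by move: su; apply: contraTneq => ->; rewrite mulr0 ltxx.
  have s0 : s != 0 by move: su; apply: contraTneq => ->; rewrite mul0r ltxx.
  by field; rewrite (gt_eqF h_gt0) x0 s0.
have D (s : R) : 0 < s * vcoord u.1 -> 0 < dot (\row_k (if k == 0 then s else 0)) (pt o h u - a).
  by move=> su; rewrite dotE !pt_center /coord /= !mxE /= mul0r addr0 mulrCA mulr_gt0.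
have N (s : R) : s * s = 1 -> enorm (\row_k (if k == 0 then s else 0) : plane R) = 1.
  by move=> s1; rewrite /enorm dotE !mxE /= mulr0 addr0 s1 sqrtr1.
rewrite /vangle; case: ifP => u1.
  have su : 0 < 1 * vcoord u.1 by rewrite mul1r vcoord_gt0.
  rewrite subr0 -(E 1) ?mulr1 // -[ang _ _]add0r; apply: polar_step; last exact: D.
  by split; rewrite N ?mulr1 // mxE /= ?cos0 ?sin0 mul1r.
have su : 0 < -1 * vcoord u.1 by rewrite mulN1r oppr_gt0 vcoord_lt0 leNgt u1.
rewrite [atan _ - pi]addrC -(E (-1)) ?mulrNN ?mulr1 //; apply: polar_step; last exact: D.
by split; rewrite N ?mulrNN ?mulr1 // mxE /= ?cosN ?sinN ?cospi ?sinpi mul1r ?oppr0.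
Qed.

Lemma polar2pi z (s : R) (k : int) : polar z s -> polar z (s + 2 * pi * k%:~R).
Proof.
have P n (t : R) : cos (t + 2 * pi * n%:R) = cos t /\ sin (t + 2 * pi * n%:R) = sin t.
  elim: n t => [|n IH] t; first by rewrite mulr0 addr0.
  have -> : t + 2 * pi * n.+1%:R = t + 2 * pi * n%:R + pi *+ 2.
    by rewrite -natr1 -[pi *+ 2]mulr_natl; ring.
  by rewrite cosD2pi sinD2pi.
move=> [z0 z1]; case: k => n.
  by have [c d] := P n s; rewrite /polar -pmulrn c d.
have [c d] := P n.+1 (s + 2 * pi * (Negz n)%:~R).
move: c d; have -> : s + 2 * pi * (Negz n)%:~R + 2 * pi * n.+1%:R = s.
  by rewrite NegzE mulrNz -pmulrn; ring.
by rewrite /polar => <- <-.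
Qed.

Lemma atan_gt0 (x : R) : (0 < atan x) = (0 < x).
Proof.
case: (ltgtP x 0) => [x0|x0|->]; last by rewrite atan0 ltxx.
  by apply/negbTE; rewrite -leNgt -atan0; apply: le_atan; exact: ltW.
by rewrite -atan0; exact: lt_atan.
Qed.

Lemma atan_lt0 (x : R) : (atan x < 0) = (x < 0).
Proof. by rewrite -oppr_gt0 -atanN atan_gt0 oppr_gt0. Qed.

Lemma vangle_edge u v : adjacent u v ->
  `|vangle v - vangle u - 2 * pi * (crossing (0, 0) u v)%:~R| < pi.
Proof.
case: u v => [u1 u2] [v1 v2]; rewrite /vangle /=.
set A := atan (vcoord v2 / vcoord v1); set B := atan (vcoord u2 / vcoord u1).
have A1 : A < pi / 2 by exact: atan_ltpi2.
have A2 : - (pi / 2) < A by exact: atan_gtNpi2.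
have B1 : B < pi / 2 by exact: atan_ltpi2.
have B2 : - (pi / 2) < B by exact: atan_gtNpi2.
have neg (x y : R) : 0 < x -> y < 0 -> 0 < - atan (x / y).
  by move=> x0 y0; rewrite oppr_gt0 atan_lt0 ltr_ndivrMr // mul0r.
rewrite /adjacent /crossing /=.
have [u0|u0] := ltP 0 u1; have [v0|v0] := ltP 0 v1.
- move=> _; have -> : (u1 == 0) && (v1 == 0 + 1) = false by move: u0; clear; lia.
  have -> : (v1 == 0) && (u1 == 0 + 1) = false by move: v0; clear; lia.
  by case: ifP => _; rewrite mulr0 !subr0 ltr_norml; apply/andP; split; lra.
- move=> adj.
  have [u1E v1E uv2] : [/\ u1 = 1, v1 = 0 & u2 = v2].
    by split; move: adj u0 v0; clear; lia.
  have x0 : 0 < vcoord u1 by rewrite vcoord_gt0.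
  have x0' : vcoord v1 < 0 by rewrite vcoord_lt0.
  move: A1 A2 B1 B2; rewrite /A /B uv2 u1E v1E eqxx andbT /=.
  rewrite u1E v1E in x0 x0'.
  case: (ltP 0 v2) => v20.
    have y0 : 0 < vcoord v2 by rewrite vcoord_gt0.
    have := neg _ _ y0 x0'; have : 0 < atan (vcoord v2 / vcoord 1) by rewrite atan_gt0 divr_gt0.
    move: (atan _) (atan _) => a1 a2 h1 h2 h3 h4 h5 h6.
    by rewrite mulrN1z mulrN mulr1 ltr_norml; apply/andP; split; lra.
  have y0 : 0 < - vcoord v2 by rewrite oppr_gt0 vcoord_lt0.
  have := neg _ _ y0 x0'; rewrite mulNr atanN opprK.
  have : atan (vcoord v2 / vcoord 1) < 0 by rewrite atan_lt0 pmulr_llt0 ?invr_gt0 // -oppr_gt0.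
  move: (atan _) (atan _) => a1 a2 h1 h2 h3 h4 h5 h6.
  by rewrite mulr0 ltr_norml; apply/andP; split; lra.
- move=> adj.
  have [u1E v1E uv2] : [/\ u1 = 0, v1 = 1 & u2 = v2].
    by split; move: adj u0 v0; clear; lia.
  have x0 : vcoord u1 < 0 by rewrite vcoord_lt0.
  have x0' : 0 < vcoord v1 by rewrite vcoord_gt0.
  move: A1 A2 B1 B2; rewrite /A /B uv2 u1E v1E eqxx andbT /=.
  rewrite u1E v1E in x0 x0'.
  case: (ltP 0 v2) => v20.
    have y0 : 0 < vcoord v2 by rewrite vcoord_gt0.
    have := neg _ _ y0 x0; have : 0 < atan (vcoord v2 / vcoord 1) by rewrite atan_gt0 divr_gt0.
    move: (atan _) (atan _) => a1 a2 h1 h2 h3 h4 h5 h6.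
    by rewrite mulr1z mulr1 ltr_norml; apply/andP; split; lra.
  have y0 : 0 < - vcoord v2 by rewrite oppr_gt0 vcoord_lt0.
  have := neg _ _ y0 x0; rewrite mulNr atanN opprK.
  have : atan (vcoord v2 / vcoord 1) < 0 by rewrite atan_lt0 pmulr_llt0 ?invr_gt0 // -oppr_gt0.
  move: (atan _) (atan _) => a1 a2 h1 h2 h3 h4 h5 h6.
  by rewrite mulr0 ltr_norml; apply/andP; split; lra.
- move=> _; have -> : (u1 == 0) && (v1 == 0 + 1) = false by move: v0; clear; lia.
  have -> : (v1 == 0) && (u1 == 0 + 1) = false by move: u0; clear; lia.
  by case: ifP => _; rewrite mulr0 subr0 ltr_norml; apply/andP; split; lra.
Qed.

(** Both sides lead from an argument of one end to an argument of the other. The left one is less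
    than pi / 2 and the right one less than pi in absolute value, so they cannot differ by a nonzero
    multiple of 2 pi. *)
Lemma ang_edge u v : adjacent u v -> short (pt o h u) (pt o h v) ->
  ang (pt o h u - a) (pt o h v - a) =
  vangle v - vangle u - 2 * pi * (crossing (0, 0) u v)%:~R.
Proof.
move=> adj sh; have d0 : 0 < dot (pt o h u - a) (pt o h v - a).
  by have := @short_dot _ _ 1 sh; rewrite ler01 lexx subrr scale0r scale1r add0r; exact.
have p1 := polar_step (vangle_polar u) d0.
have p2 := polar2pi (- crossing (0, 0) u v) (vangle_polar v).
have n0 : 0 < enorm (pt o h v - a).
  rewrite enorm_gt0 lt_neqAle dot_ge0 andbT eq_sym; apply/eqP => e0.
  have /eqP : dot (pt o h v - a) (pt o h v - a) = 0 by [].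
  rewrite dotE -!expr2 paddr_eq0 ?sqr_ge0 // !sqrf_eq0 => /andP[/eqP z0 /eqP z1].
  by move: d0; rewrite dotE z0 z1 !mulr0 addr0 ltxx.
have b1 := vangle_edge adj; have b2 := ang_lt (pt o h u - a) (pt o h v - a).
have := polar_unique n0 p1 p2; rewrite mulrNz => H.
move: b1 b2 H.
move: (ang _ _) (vangle u) (vangle v) (crossing _ _ _)%:~R => A b c k.
rewrite !ltr_norml => /andP[h1 h2] /andP[h3 h4] H.
have : - (2 * pi) < b + A - (c + 2 * pi * - k) < 2 * pi by apply/andP; split; lra.
by move=> /H; lra.
Qed.

(** [crossing] counts passages above [a] from left to right, which are clockwise; hence the minus
    sign. *)
Lemma lift_total u m (t : R) : path adjacent u m -> path short (pt o h u) (map (pt o h) m) ->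
  (size m)%:R <= t -> lift (map (pt o h) (u :: m)) t =
  vangle (last u m) - vangle u - 2 * pi * (step_sum (crossing (0, 0)) (u :: m))%:~R.
Proof.
elim: m u t => [|v m IH] u t; first by rewrite step_sum1 mulr0 /= !subrr.
move=> /andP[adj pm] /andP[sh pS] mt.
have mt' : (size m)%:R + 1 <= t by rewrite natr1.
have m0 : 0 <= (size m)%:R :> R by [].
rewrite !map_cons lift_ge1; last by lra.
rewrite -map_cons IH //; last by lra.
by rewrite ang_edge // step_sum_cons intrD; ring.
Qed.

End Lift.

(** * Closed curves around the hole *)

Section AnnulusLoops.
Context {R : realType}.
Notation V := (int * int)%type.
Implicit Types (Omega E : set (plane R)) (z : plane R).

Lemma curve_on_edge (o : plane R) (h : R) (r : rel V) u v m (t : R) : path r u (v :: m) ->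
  exists p q, r p q /\
    segment_set (pt o h p) (pt o h q) (curve (map (pt o h) [:: u, v & m]) t).
Proof.
elim: m u v t => [|w m IH] u v t /andP[uv pm].
  exists u, v; split=> //; exists (clamp t); first exact: clamp_in.
  by rewrite !map_cons curve_cons /=; apply/rowP => k; rewrite !mxE; ring.
rewrite !map_cons; case: (leP t 1) => [t1|/ltW t1]; last first.
  by rewrite curve_ge1 //; exact: IH.
exists u, v; split=> //; case: (leP t 0) => [t0|/ltW t0].
  by rewrite curve_le0 //; exact: segment_left.
by exists t; rewrite ?t0 // curve_le1 ?t0.
Qed.

Lemma pt_square (o : plane R) (h : R) (q v : V) : 0 < h -> 0 <= v.1 - q.1 <= 1 -> 0 <= v.2 - q.2 <= 1 ->
  square o h q (pt o h v).
Proof.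
move=> h0 v1 v2; have -> : v = (q.1 + (v.1 - q.1), q.2 + (v.2 - q.2)).
  by rewrite !subrKC -surjective_pairing.
exact: square_corner.
Qed.

Lemma border_squares (o : plane R) (h : R) (b : pred V) p q z : 0 < h -> border b p q ->
  segment_set (pt o h p) (pt o h q) z ->
  exists q1 q2, [/\ b q1, ~~ b q2, square o h q1 z & square o h q2 z].
Proof.
move=> h0 /andP[adj bq] [t t01 ->].
have K s : (0 <= p.1 - s.1 <= 1) && (0 <= p.2 - s.2 <= 1) &&
    ((0 <= q.1 - s.1 <= 1) && (0 <= q.2 - s.2 <= 1)) ->
    square o h s ((1 - t) *: pt o h p + t *: pt o h q).
  by move=> /andP[/andP[a1 a2] /andP[a3 a4]]; apply: square_convex => //; exact: pt_square.
have [s1 [s2 [K1 K2 bs]]] : exists s1 s2,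
    [/\ square o h s1 ((1 - t) *: pt o h p + t *: pt o h q),
       square o h s2 ((1 - t) *: pt o h p + t *: pt o h q) & b s1 (+) b s2].
  move: bq; case: ifP => pq bq.
    exists (Num.min p.1 q.1, p.2), (Num.min p.1 q.1, p.2 - 1); split=> //; apply: K => /=;
      by move: adj pq; rewrite /adjacent; clear; move: p q => [? ?] [? ?] /=; lia.
  exists (p.1, Num.min p.2 q.2), (p.1 - 1, Num.min p.2 q.2); split=> //; apply: K => /=;
    by move: adj pq; rewrite /adjacent; clear; move: p q => [? ?] [? ?] /=; lia.
move: bs; case b1: (b s1); case b2: (b s2) => // _.
  by exists s1, s2; rewrite b1 b2.
by exists s2, s1; rewrite b1 b2.
Qed.

Lemma near_squares (o : plane R) (h : R) q q' z z' : 0 < h -> square o h q z -> square o h q' z' ->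
  `|z - z'| < h -> (`|q.1 - q'.1| <= 1)%N /\ (`|q.2 - q'.2| <= 1)%N.
Proof.
move=> h0 zq zq' zz'.
have H (k : 'I_2) : (`|coord q k - coord q' k| <= 1)%N.
  have /andP[a1 a2] := zq k; have /andP[a3 a4] := zq' k.
  have := le_lt_trans (entry_le (z - z') 0 k) zz'; rewrite !mxE ltr_norml => /andP[a5 a6].
  rewrite !ptE in a1 a2 a3 a4.
  have hab (s r : int) : h * s%:~R < h * r%:~R + 2 * h -> s < r + 2.
    by move=> H; rewrite -(ltr_int R) -(ltr_pM2l h0) intrD mulrDr [h * 2%:~R]mulrC.
  have H1 : coord q k < coord q' k + 2 by apply: hab; lra.
  have H2 : coord q' k < coord q k + 2 by apply: hab; lra.
  by move: H1 H2; clear; lia.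
by split; [exact: (H 0)|exact: (H 1)].
Qed.

Lemma square_dist (o : plane R) (h : R) q q' z z' (k : nat) : 0 < h -> square o h q z -> square o h q' z' ->
  (`|q.1 - q'.1| <= k)%N -> (`|q.2 - q'.2| <= k)%N -> `|z - z'| <= h * k.+1%:R.
Proof.
move=> h0 zq zq' k1 k2; apply: mx_norm_le => [|i j]; first by rewrite mulr_ge0 // ltW.
rewrite ord1 !mxE; have /andP[a1 a2] := zq j; have /andP[a3 a4] := zq' j.
rewrite !ptE in a1 a2 a3 a4.
have ck : `|coord q j - coord q' j| <= k%:Z.
  by case: (ord2P j) => ->; rewrite /coord /=; [move: k1|move: k2]; clear; lia.
have hab (s : int) : s <= k%:Z -> h * s%:~R <= h * k%:R.
  by move=> H; rewrite ler_pM2l // -[k%:R]/((k%:Z)%:~R) ler_int.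
have H1 := hab (coord q j - coord q' j) ltac:(move: ck; clear; lia).
have H2 := hab (coord q' j - coord q j) ltac:(move: ck; clear; lia).
rewrite !intrB !mulrBr in H1 H2; rewrite -natr1 mulrDr mulr1 ler_norml.
by apply/andP; split; lra.
Qed.

Lemma closed_separation E F : closed E -> bounded_set E -> closed F ->
  (forall z, E z -> ~ F z) ->
  exists2 d : R, 0 < d & forall z z', E z -> F z' -> d <= `|z - z'|.
Proof.
move=> cE bE cF EF; have cpE := bounded_closed_compact bE cE.
have [|d d0 H] := @compact_unif R _ E (fun z e => forall z', F z' -> e <= `|z - z'|) cpE.
  move=> z Ez; have oF : open (~` F) by apply: closed_openC.
  have [r r0 H] := near_ex (open_nbhs_nbhs (conj oF (EF z Ez))).
  exists (r / 2); first by rewrite divr_gt0.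
  move=> y e Ey zy /andP[e0 er] z' Fz'; rewrite leNgt; apply/negP => yz'.
  apply: (H z') => //; rewrite -(subrKA y); apply: (le_lt_trans (ler_normD _ _)); lra.
exists (d / 2) => [|z z' Ez Fz']; first by rewrite divr_gt0.
by apply: (H z (d / 2)) => //; apply/andP; split; lra.
Qed.

Lemma repeat_walk (r : rel V) (c : V -> V -> int) u m k : path r u m -> last u m = u ->
  [/\ path r u (flatten (nseq k m)), last u (flatten (nseq k m)) = u &
     step_sum c (u :: flatten (nseq k m)) = step_sum c (u :: m) *+ k].
Proof.
move=> pm lm; elim: k => [|k [p l s]] /=; first by rewrite step_sum1.
split; first by rewrite cat_path pm lm.
  by rewrite last_cat lm.
have lE : rcons (belast u m) u = u :: m by rewrite [RHS]lastI lm.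
have -> : u :: m ++ flatten (nseq k m) = belast u m ++ u :: flatten (nseq k m).
  by rewrite -cat_rcons lE.
by rewrite step_sum_cat lE s mulrS.
Qed.

End AnnulusLoops.

Section Loops.
Context {R : realType}.
Notation V := (int * int)%type.
Implicit Types (Omega E : set (plane R)) (z : plane R).

Lemma nat_2pi (x : R) : exists n : nat, x <= 2 * pi * n%:R.
Proof.
exists (Num.trunc (x / (2 * pi))).+1.
have p0 : 0 < 2 * pi :> R by rewrite mulr_gt0 // pi_gt0.
by rewrite -ler_pdivrMl // mulrC ltW // truncnS_gt.
Qed.

(** The walk is run through repeatedly during the time interval [-1, 1]; the curve stays constant
    outside it. Winding numbers other than 0 make the swept angle as large as desired. *)
Lemma winding_loop (a : plane R) (h : R) (r : rel V) u m (B : R) :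
  let o := a - const_mx (h / 2) in
  0 < h -> subrel r adjacent -> (forall p q, r p q -> short a h (pt o h p) (pt o h q)) ->
  path r u m -> last u m = u -> step_sum (crossing (0, 0)) (u :: m) != 0 ->
  exists (gam : R -> plane R) (al : R -> R),
    [/\ continuous gam, continuous al, forall t, polar (gam t - a) (al t),
       B <= al 1 /\ al (-1) <= - B &
       forall t, exists p q, r p q /\ segment_set (pt o h p) (pt o h q) (gam t)].
Proof.
move=> o h0 radj rsh pm lm; set c := step_sum _ _ => c0.
have p0 : 0 < pi :> R by exact: pi_gt0.
have p2 : 0 < 2 * pi :> R by apply: mulr_gt0.
(* A shift by [J] turns puts the angle at the starting vertex of the walk beyond [B] on its side;
   [K.+1] rounds make up for this shift and bring the other end beyond [B]. *)
have [J hJ] := nat_2pi (`|B| + `|vangle u|).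
have [K hK] := nat_2pi (2 * pi * J%:R + `|B| + `|vangle u|).
have [pK lK sK] := repeat_walk (crossing (0, 0)) K.+1 pm lm.
set mK := flatten (nseq K.+1 m) in pK lK sK.
pose W := map (pt o h) (u :: mK); pose l : R := (size mK)%:R.
have pS : path (short a h) (pt o h u) (map (pt o h) mK).
  by elim: (mK) (u) pK => //= v r' IH w /andP[/rsh -> /IH].
have pA : path adjacent u mK by exact: sub_path pK.
have tot : lift a W l = - (2 * pi * c%:~R * K.+1%:R).
  by rewrite /W lift_total // lK subrr sub0r sK -/c -[c *+ _]mulr_natr intrM mulrz_nat mulrA.
have [v [m' mE]] : exists v m', mK = v :: m'.
  by case: (mK) sK (c0) => [|v m'] sK c0'; [move: sK; rewrite step_sum1 -/c => /esym/eqP; rewrite mulrn_eq0 (negPf c0')|exists v, m'].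
(* [sg] is the sense in which the walk has to be run through *)
pose sg : R := if c < 0 then 1 else -1.
pose tau (t : R) := l * ((1 + sg * t) / 2).
pose sh : R := - (sg * 2 * pi * J%:R).
have ctau : continuous tau.
  have E : tau = fun t => (l * sg / 2) * t + l / 2 by apply/funext => t; rewrite /tau; ring.
  by rewrite E; exact: cont_affine.
exists (fun t => curve W (tau t)), (fun t => vangle u + lift a W (tau t) + sh); split.
- exact: (cont_comp ctau (@curve_continuous R W)).
- apply: (@cont_add R _ R); last exact: cst_continuous.
  apply: (@cont_add R _ R); first exact: cst_continuous.
  exact: (cont_comp ctau (lift_continuous h0 pS)).
- move=> t; have := lift_polar h0 (tau t) pS (vangle_polar a h0 u).
  have -> : sh = 2 * pi * (if c < 0 then - J%:Z else J%:Z)%:~R.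
    by rewrite /sh /sg; case: ifP => _; rewrite ?mulrNz -pmulrn; ring.
  exact: polar2pi.
- have n1 := ler_norm (- vangle u : R); have n2 := ler_norm (vangle u : R).
  have n3 := ler_norm (- B); have n4 := ler_norm B; rewrite !normrN in n1 n3.
  have l0 : lift a W 0 = 0 by rewrite lift_le0.
  have cK (k : int) : 1 <= k -> 2 * pi * K.+1%:R <= 2 * pi * k%:~R * K.+1%:R :> R.
    move=> k1; rewrite ler_pM2r ?ltr0n // (ler_pMr _ p2) //.
    by rewrite -(mulr1z 1) ler_int.
  have KS : 2 * pi * K%:R <= 2 * pi * K.+1%:R :> R.
    by rewrite (ler_pM2l p2) ler_nat.
  have sgE : (sg = 1 /\ c < 0) \/ (sg = -1 /\ 0 <= c).
    by rewrite /sg; case: (ltP c 0) => cs; [left|right].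
  rewrite /tau /sh; case: sgE => -[-> cs].
    have E1 : l * ((1 + 1 * 1) / 2) = l by field.
    have E2 : l * ((1 + 1 * -1) / 2) = 0 by field.
    have c1 : 1 <= - c by move: cs; clear; lia.
    rewrite E1 E2 l0 tot; have := cK _ c1; rewrite mulrNz mulrN mulNr => H.
    by split; lra.
  have E1 : l * ((1 + -1 * 1) / 2) = 0 by field.
  have E2 : l * ((1 + -1 * -1) / 2) = l by field.
  have c1 : 1 <= c by move: cs c0; clear; lia.
  rewrite E1 E2 l0 tot; have H := cK _ c1.
  by split; lra.
- move=> t; rewrite /W mE; apply: curve_on_edge; by rewrite -mE.
Qed.

(** The k-th curve runs along the border of the set of squares within [k.+1] steps of those that
    meet E. Close to such a border there are no points of E, whose neighbouring squares all belong
    to the set, and no other points of the complement, which are too far from E. For k < l a point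
    near the k-th border lies well inside the l-th set, so the curves are disjoint. *)
Lemma annulus_loops Omega E (a : plane R) (rho : R) (N : nat) :
  E `<=` ~` Omega -> closed E -> closed (~` Omega `\` E) -> bounded_set E -> E a ->
  0 < rho -> (forall z, Omega z -> rho <= `|z - a|) ->
  exists2 d : R, 0 < d & forall B : R, exists (gam : 'I_N -> R -> plane R) (al : 'I_N -> R -> R),
    [/\ forall k, continuous (gam k), forall k, continuous (al k),
       forall k t, polar (gam k t - a) (al k t),
       forall k, B <= al k 1 /\ al k (-1) <= - B &
       (forall k t z, `|gam k t - z| < d -> Omega z) /\
       (forall k l s t, k != l -> d <= `|gam k s - gam l t|)].
Proof.
move=> EO cE cF bE Ea rho0 rhoP.
have [d d0 hd] : exists2 d : R, 0 < d & forall z z', E z -> (~` Omega `\` E) z' -> d <= `|z - z'|.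
  by apply: closed_separation => // z Ez [].
(* The first bound makes the grid edges [short]. The second one keeps [N.+3] layers of squares
   around E away from the rest of the complement; two layers are spent on the square around E and on
   the tube of radius [h]. *)
pose h := Num.min (rho / 2) (d / (N.+3)%:R).
have h0 : 0 < h by rewrite lt_min !divr_gt0.
have hrho : 2 * h <= rho.
  have : h <= rho / 2 by rewrite ge_min lexx.
  by lra.
have hd' : h * N.+3%:R <= d.
  have : h <= d / N.+3%:R by rewrite ge_min lexx orbT.
  by rewrite ler_pdivlMr.
pose o : plane R := a - const_mx (h / 2).
pose b (k : nat) (q : V) := `[< exists q0 z0, [/\ E z0, square o h q0 z0,
   (`|q.1 - q0.1| <= k)%N & (`|q.2 - q0.2| <= k)%N] >].
have b_in k q : b k q -> exists q0 z0, [/\ E z0, square o h q0 z0,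
   (`|q.1 - q0.1| <= k)%N & (`|q.2 - q0.2| <= k)%N] by move=> /asboolP.
have b_step k l q q' : b k q -> (k < l)%N -> (`|q.1 - q'.1| <= 1)%N -> (`|q.2 - q'.2| <= 1)%N -> b l q'.
  move=> /b_in[q0 [z0 [E0 s0 h1 h2]]] kl h3 h4; apply/asboolP; exists q0, z0; split=> //.
    by move: h1 h3 kl; clear; lia.
  by move: h2 h4 kl; clear; lia.
have inO (k : 'I_N) p q z z' : border (b k.+1) p q -> segment_set (pt o h p) (pt o h q) z ->
    `|z - z'| < h -> Omega z'.
  move=> bpq zpq zz'; have [q1 [q2 [bq1 bq2 s1 s2]]] := border_squares h0 bpq zpq.
  apply: contrapT => nO; have Ez' : E z'.
    apply: contrapT => nE; have [q0 [z0 [E0 s0 h1 h2]]] := b_in _ _ bq1.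
    have := hd z0 z' E0 (conj nO nE); apply/negP; rewrite -ltNge.
    have := square_dist h0 s1 s0 h1 h2 => D.
    rewrite -(subrKA z); apply: (le_lt_trans (ler_normD _ _)); rewrite (distrC z0).
    apply: (lt_le_trans _ hd'); have := ltn_ord k => kN.
    have : h * k.+2%:R <= h * N.+1%:R by rewrite ler_pM2l // ler_nat.
    have -> : h * N.+3%:R = h * N.+1%:R + h + h.
      by rewrite -[N.+3%:R]natr1 -[N.+2%:R]natr1; ring.
    by lra.
  move/negP: bq2; apply; have [n1 n2] := near_squares h0 s2 (square_cell _ h0 z') zz'.
  apply/asboolP; exists (cell o h z'), z'; split=> //; first exact: square_cell.
    exact: leq_trans n1 _.
  exact: leq_trans n2 _.
have sep (k l : 'I_N) p q p' q' z z' : (k < l)%N -> border (b k.+1) p q -> border (b l.+1) p' q' ->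
    segment_set (pt o h p) (pt o h q) z -> segment_set (pt o h p') (pt o h q') z' ->
    h <= `|z - z'|.
  move=> kl b1 b2 s1 s2; rewrite leNgt; apply/negP => zz'.
  have [q1 [_ [bq1 _ sq1 _]]] := border_squares h0 b1 s1.
  have [_ [q2 [_ bq2 _ sq2]]] := border_squares h0 b2 s2.
  have [n1 n2] := near_squares h0 sq1 sq2 zz'.
  by move/negP: bq2; apply; apply: b_step bq1 _ n1 n2; rewrite ltnS.
have sh (k : 'I_N) p q : border (b k.+1) p q -> short a h (pt o h p) (pt o h q).
  move=> bpq; have Op : Omega (pt o h p).
    by apply: (inO k p q _ _ bpq (segment_left _ _)); rewrite subrr normr0.
  rewrite /short (le_trans hrho) ?rhoP // andbT.
  apply: mx_norm_le => [|i j]; first exact: ltW.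
  rewrite ord1; have -> : (pt o h p - pt o h q) 0 j = h * (coord p j - coord q j)%:~R.
    by have := ptE o h p j; have := ptE o h q j; rewrite !mxE intrB => _ _; ring.
  rewrite normrM gtr0_norm // ger_pMr // -intr_norm -(mulr1z 1) ler_int.
  have /andP[adj _] := bpq; move: adj; rewrite /adjacent /coord; clear.
  by case: (ord2P j) => -> /=; move: p q => [? ?] [? ?] /=; lia.
have walk (k : 'I_N) : exists u m, [/\ path (border (b k.+1)) u m, last u m = u &
    step_sum (crossing (0, 0)) (u :: m) != 0].
  have [B B0 hB] := bounded_setP bE.
  pose M := (Num.trunc ((B + `|o| + h) / h)).+1.
  have hM : B + `|o| + h < h * M%:R.
    by rewrite -ltr_pdivrMl // [ltLHS]mulrC; exact: truncnS_gt.
  apply: (@contour _ (M + k.+2)%N) => [q /b_in[q0 [z0 [E0 s0 h1 h2]]]|]; last first.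
    apply/asboolP; exists (0, 0), a; split=> // j; rewrite ptE !mxE /coord if_same mulr0z mulr0.
    by apply/andP; split; lra.
  have zB := hB _ E0.
  have c0 j : (`|coord q0 j| <= M)%N.
    have /andP[a1 a2] := s0 j; rewrite ptE in a1 a2.
    have := le_trans (entry_le z0 0 j) zB; have := entry_le o 0 j.
    rewrite !ler_norml => /andP[a3 a4] /andP[a5 a6].
    have hab (s r : int) : h * s%:~R < h * r%:~R -> s < r by rewrite ltr_pM2l // ltr_int.
    have MZ : (M%:Z)%:~R = M%:R :> R by [].
    have H1 : coord q0 j < M%:Z by apply: hab; rewrite MZ; lra.
    have H2 : - M%:Z < coord q0 j by apply: hab; rewrite mulrNz MZ; lra.
    by move: H1 H2; clear; lia.
  have := c0 0; have := c0 1; rewrite /coord /= => c2 c1.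
  split; first by move: h1 c1; clear; lia.
  by move: h2 c2; clear; lia.
exists h => // B.
have H (k : 'I_N) : exists ga : (R -> plane R) * (R -> R),
    [/\ continuous ga.1, continuous ga.2, forall t, polar (ga.1 t - a) (ga.2 t),
       B <= ga.2 1 /\ ga.2 (-1) <= - B &
       forall t, exists p q, border (b k.+1) p q /\ segment_set (pt o h p) (pt o h q) (ga.1 t)].
  have [u [m [pm lm sm]]] := walk k.
  have [|gam [al H]] := @winding_loop a h (border (b k.+1)) u m B h0 _ (sh k) pm lm sm.
    by move=> p q /andP[].
  by exists (gam, al).
have [ga gaP] := choice H.
exists (fun k => (ga k).1), (fun k => (ga k).2); split.
- by move=> k; case: (gaP k).
- by move=> k; case: (gaP k).
- by move=> k; case: (gaP k).
- by move=> k; case: (gaP k).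
split.
- move=> k t z; have [_ _ _ _ /(_ t)[p [q [bpq s]]]] := gaP k.
  exact: inO bpq s.
move=> k l s t; rewrite -val_eqE neq_ltn => kl.
have [_ _ _ _ /(_ s)[p [q [bpq s1]]]] := gaP k.
have [_ _ _ _ /(_ t)[p' [q' [bpq' s2]]]] := gaP l.
case/orP: kl => kl; first exact: (sep k l p q p' q').
by rewrite distrC; exact: (sep l k p' q' p q).
Qed.

End Loops.

(** * The distance to the boundary *)

Section Geometry.
Context {R : realType}.
Implicit Types (Omega : set (plane R)) (u v w x y z a b q e : plane R).

Lemma enormZ (k : R) u : enorm (k *: u) = `|k| * enorm u.
Proof.
rewrite /enorm; have -> : dot (k *: u) (k *: u) = k ^+ 2 * dot u u.
  by rewrite !dotE !mxE; ring.
by rewrite sqrtrM ?sqr_ge0 // sqrtr_sqr.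
Qed.

Lemma enormN u : enorm (- u) = enorm u.
Proof. by rewrite -scaleN1r enormZ normrN1 mul1r. Qed.

Lemma enormB u v : enorm (u - v) = enorm (v - u).
Proof. by rewrite -enormN opprB. Qed.

Lemma dot_le u v : `|dot u v| <= enorm u * enorm v.
Proof.
rewrite -ler_sqr ?nnegrE ?mulr_ge0 ?enorm_ge0 // exprMn !enorm_sqr (real_normK (num_real _)).
have : 0 <= cross u v ^+ 2 by rewrite sqr_ge0.
have -> : cross u v ^+ 2 = dot u u * dot v v - dot u v ^+ 2.
  by rewrite !dotE /cross; ring.
lra.
Qed.

Lemma enormD u v : enorm (u + v) <= enorm u + enorm v.
Proof.
rewrite -ler_sqr ?nnegrE ?addr_ge0 ?enorm_ge0 // sqrrD !enorm_sqr.
have -> : dot (u + v) (u + v) = dot u u + dot v v + 2 * dot u v.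
  by rewrite !dotE !mxE; ring.
have := dot_le u v; rewrite ler_norml => /andP[_]; lra.
Qed.

Lemma enorm_tri x y z : enorm (x - z) <= enorm (x - y) + enorm (y - z).
Proof. by rewrite -[x - z](subrKA y); exact: enormD. Qed.

Lemma coord_le_enorm u k : `|u 0 k| <= enorm u.
Proof.
rewrite -ler_sqr ?nnegrE ?enorm_ge0 // enorm_sqr (real_normK (num_real _)) dotE -!expr2.
have := sqr_ge0 (u 0 0); have := sqr_ge0 (u 0 1).
by case: (ord2P k) => ->; lra.
Qed.

Lemma norm_le_enorm u : `|u| <= enorm u.
Proof.
by apply: mx_norm_le => [|i k]; rewrite ?enorm_ge0 // ord1; exact: coord_le_enorm.
Qed.

Lemma enorm_le_norm u : enorm u <= 2 * `|u|.
Proof.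
rewrite -ler_sqr ?nnegrE ?enorm_ge0 ?mulr_ge0 // enorm_sqr dotE exprMn.
have sq k : u 0 k * u 0 k <= `|u| ^+ 2.
  by rewrite -expr2 -(real_normK (num_real (u 0 k))) ler_sqr ?nnegrE // entry_le.
have := sq 0; have := sq 1; have := sqr_ge0 `|u|; lra.
Qed.

Lemma enorm0 : enorm (0 : plane R) = 0.
Proof. by rewrite -(scale0r 0) enormZ normr0 mul0r. Qed.

Lemma enorm_eq0 u : enorm u = 0 -> u = 0.
Proof.
by move=> u0; apply/eqP; rewrite -normr_eq0; apply/eqP/le_anti; rewrite normr_ge0 -u0 norm_le_enorm.
Qed.

Lemma enorm_neq0 u : u <> 0 -> 0 < enorm u.
Proof.
move=> u0; rewrite lt_neqAle enorm_ge0 andbT eq_sym; apply/eqP => /enorm_eq0; exact: u0.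
Qed.

Lemma boundary_notin Omega b : open Omega -> boundary Omega b -> ~ Omega b.
Proof. by move=> oO [_ nb] Ob; apply: nb; rewrite /interior; exact: open_nbhs_nbhs. Qed.

Lemma boundary_between Omega z w : open Omega -> Omega z -> ~ Omega w ->
  exists2 s : R, 0 <= s <= 1 & boundary Omega (z + s *: (w - z)).
Proof.
move=> oO Oz nw; pose P (s : R) := z + s *: (w - z).
have cP : continuous P.
  apply: cont_add; first exact: cst_continuous.
  by apply: cont_scale; [move=> s; exact: cvg_id|exact: cst_continuous].
pose T := [set s : R | 0 <= s <= 1 /\ ~ Omega (P s)].
have P1 : P 1 = w by rewrite /P scale1r subrKC.
have T1 : T 1 by split; rewrite ?P1 ?ler01 ?lexx.
have hT : has_inf T by split; [exists 1|exists 0 => s [/andP[s0 _] _]].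
pose s0 := inf T.
have s0_le s : T s -> s0 <= s by move=> Ts; apply: (@ge_inf _ T) => //; exists 0 => t [/andP[t0 _] _].
have s00 : 0 <= s0 by apply: lb_le_inf; [exists 1|move=> s [/andP[s0' _] _]].
have s01 : s0 <= 1 by exact: s0_le.
exists s0; first by rewrite s00.
have nO : ~ Omega (P s0).
  move=> Os0; have oP : \forall s \near s0, Omega (P s).
    by apply: (cP s0); exact: open_nbhs_nbhs.
  have [r r0 H] := near_ex oP.
  have [s Ts ss0] : exists2 s, T s & s < s0 + r.
    have := inf_adherent r0 hT; by move=> [s Ts ss]; exists s.
  case: (Ts) => _; apply; apply: H; have := s0_le _ Ts => h1.
  by rewrite distrC ger0_norm ?subr_ge0 //; lra.
split; last by move/interior_subset.
move=> A nA; have [r r0 H] := near_ex (cP s0 _ nA).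
have s0p : 0 < s0.
  rewrite lt_neqAle s00 andbT; apply/eqP => s0E; apply: nO; rewrite -s0E.
  by rewrite /P scale0r addr0.
pose s := s0 - Num.min (s0 / 2) (r / 2).
have m0 : 0 < Num.min (s0 / 2) (r / 2) by rewrite lt_min !divr_gt0.
have m1 : Num.min (s0 / 2) (r / 2) <= s0 / 2 by rewrite ge_min lexx.
have m2 : Num.min (s0 / 2) (r / 2) <= r / 2 by rewrite ge_min lexx orbT.
exists (P s); split; last by apply: H; rewrite /s opprB addrC subrK gtr0_norm //; lra.
apply: contrapT => nOs; have Ts : T s.
  by split; [rewrite /s; apply/andP; split; lra|exact: nOs].
by have := s0_le _ Ts; rewrite /s; lra.
Qed.

Section Distance.
Variable Omega : set (plane R).
Hypotheses (oO : open Omega) (bO : bounded_set Omega) (O0 : Omega !=set0).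
Notation D z := (dist z (boundary Omega)).

Lemma boundary_neq0 : boundary Omega !=set0.
Proof.
have [z Oz] := O0; have [B B0 hB] := bounded_setP bO.
have nw : ~ Omega (const_mx (B + 1)).
  move=> /hB; have := entry_le (const_mx (B + 1) : plane R) 0 0; rewrite mxE => h1 h2.
  by have := le_trans h1 h2; rewrite ger0_norm; lra.
by have [s _ bs] := boundary_between oO Oz nw; exists (z + s *: (const_mx (B + 1) - z)).
Qed.

Lemma dist_le_boundary z b : boundary Omega b -> D z <= enorm (z - b).
Proof.
move=> bb; apply: ge_inf; last by exists b.
by exists 0 => _ [c _ <-]; exact: enorm_ge0.
Qed.

Lemma le_dist z (r : R) : (forall b, boundary Omega b -> r <= enorm (z - b)) -> r <= D z.
Proof.
move=> h; apply: lb_le_inf; last by move=> _ [b bb <-]; exact: h.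
by have [b bb] := boundary_neq0; exists (enorm (z - b)); exists b.
Qed.

Lemma dist_le_out z w : Omega z -> ~ Omega w -> D z <= enorm (z - w).
Proof.
move=> Oz nw; have [s /andP[s0 s1] bs] := boundary_between oO Oz nw.
apply: (le_trans (dist_le_boundary z bs)).
rewrite opprD addNKr -scalerN opprB enormZ ger0_norm //.
by apply: ler_piMl => //; exact: enorm_ge0.
Qed.

Lemma dist_gt0 z : Omega z -> 0 < D z.
Proof.
move=> Oz; have [r r0 H] := near_ex (open_nbhs_nbhs (conj oO Oz)).
apply: (lt_le_trans r0); apply: le_dist => b bb.
apply: le_trans (norm_le_enorm _); rewrite leNgt; apply/negP => /H.
exact: boundary_notin bb.
Qed.

Lemma dist_lip z z' : D z <= D z' + enorm (z - z').
Proof.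
rewrite -lerBlDr; apply: le_dist => b bb; rewrite lerBlDr.
apply: (le_trans (dist_le_boundary z bb)); rewrite [leRHS]addrC; exact: enorm_tri.
Qed.

Lemma dist_in z z' : Omega z -> enorm (z - z') < D z -> Omega z'.
Proof.
by move=> Oz h; apply: contrapT => nz; move: h; rewrite ltNge dist_le_out.
Qed.

Lemma boundary_compact : compact (boundary Omega).
Proof.
apply: bounded_closed_compact; last first.
  apply: closedI; first exact: closed_closure.
  by apply: open_closedC; exact: open_interior.
have [B B0 hB] := bounded_setP bO.
exists (B + 1); split; first exact: num_real.
move=> M hM b [cb _]; have [z [Oz bz]] := cb _ (ex_near (x := b) ltr01 (fun z => id)).
have := hB _ Oz => zB; apply: (le_trans _ (ltW hM)).
by rewrite -[b](subrK z); apply: (le_trans (ler_normD _ _)); lra.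
Qed.

End Distance.

(** E may meet the closure of Omega. At a boundary point [z0] of Omega in E the local graph shows on
    which side Omega lies; a small move to the other side leaves the closure, and stays in E because
    near [z0] the complement of Omega is E. *)
Lemma exterior_point Omega E : open Omega -> C3_boundary Omega -> E !=set0 ->
  E `<=` ~` Omega -> closed (~` Omega `\` E) ->
  exists a, E a /\ exists2 rho : R, 0 < rho & forall z, Omega z -> rho <= `|z - a|.
Proof.
move=> oO c3 [z0 Ez0] EO cF; have nz0 := EO _ Ez0.
have [r1 r10 H1] : exists2 r : R, 0 < r & forall z, `|z0 - z| < r -> ~ Omega z -> E z.
  have oF : open (~` (~` Omega `\` E)) by exact: closed_openC.
  have [|r r0 H] := @near_ex _ _ z0 (~` (~` Omega `\` E)).
    by apply: open_nbhs_nbhs; split=> //; case=> _; apply.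
  by exists r => // z /H nF nz; apply: contrapT => nE; apply: nF.
have [cz|ncz] := pselect (closure Omega z0); last first.
  exists z0; split=> //.
  have oC : open (~` closure Omega) by apply: closed_openC; exact: closed_closure.
  have [r r0 H] := near_ex (open_nbhs_nbhs (conj oC ncz)).
  exists r => // z Oz; rewrite leNgt; apply/negP => zz.
  by apply: (H z); [rewrite distrC|exact: subset_closure].
have [e [gamma [e1 [dg _] /near_ex[r2 r20 H2]]]] := c3 z0 (conj cz (fun h => nz0 (interior_subset h))).
have de u : dot (u : plane R) e = u 0 0 * e 0 0 + u 0 1 * e 0 1 by rewrite dotE.
have dp u : dot (u : plane R) (perp e) = u 0 1 * e 0 0 - u 0 0 * e 0 1.
  by rewrite dotE !mxE /=; ring.
have e2 : e 0 0 * e 0 0 + e 0 1 * e 0 1 = 1.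
  by rewrite -dotE -enorm_sqr e1 expr1n.
pose t := Num.min (r1 / 3) (r2 / 3).
have t0 : 0 < t by rewrite lt_min !divr_gt0.
have t1 : t <= r1 / 3 by rewrite ge_min lexx.
have t2 : t <= r2 / 3 by rewrite ge_min lexx orbT.
pose a := z0 - t *: perp e.
have za : `|z0 - a| <= t.
  apply: (le_trans (norm_le_enorm _)); rewrite /a opprB addrC subrK enormZ gtr0_norm //.
  have -> : enorm (perp e) = 1.
    rewrite -e1 /enorm; congr Num.sqrt; rewrite !dotE !mxE /=; ring.
  by rewrite mulr1.
have g0 : dot z0 (perp e) <= gamma (dot z0 e).
  rewrite leNgt; apply/negP => h; apply: nz0; apply/H2 => //; by rewrite subrr normr0.
have ae : dot a e = dot z0 e by rewrite !de !mxE /=; ring.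
have ap : dot a (perp e) = dot z0 (perp e) - t.
  rewrite !dp !mxE /=; rewrite -[t in RHS]mulr1 -e2; ring.
pose F z := gamma (dot z e) - dot z (perp e).
have cid : continuous (fun z : plane R => z) by move=> z; exact: cvg_id.
have cF' : continuous F.
  apply: (@cont_sub R _ R).
    apply: (@cont_comp _ _ _ _ (fun z => dot z e) gamma).
      by apply: dot_continuous => //; exact: cst_continuous.
    by move=> s; apply: differentiable_continuous; exact: dg.
  by apply: dot_continuous => //; exact: cst_continuous.
have Fa : 0 < F a by rewrite /F ae ap; lra.
have [r3 r30 H3] := cont_ex Fa (cF' a).
pose rho := Num.min r3 (r2 / 3).
have rho0 : 0 < rho by rewrite lt_min r30 divr_gt0.
have out z : `|a - z| < rho -> ~ Omega z.
  rewrite lt_min => /andP[az az2] Oz.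
  have hz : `|z0 - z| < r2.
    by rewrite -(subrKA a); apply: (le_lt_trans (ler_normD _ _)); lra.
  have h2 := (H2 z hz).1 Oz; have := H3 z az.
  by rewrite ltr_norml /F => /andP[h3 h4]; move: h4; rewrite /F; lra.
exists a; split.
  apply: H1; first by apply: (le_lt_trans za); lra.
  by apply: out; rewrite subrr normr0.
by exists rho => // z Oz; rewrite leNgt distrC; apply/negP => /out.
Qed.

End Geometry.

(** * The normal inequality *)

Section Taylor.
Context {R : realType}.
Implicit Types (f : R -> R).

Lemma mean_value f a b : (forall x, differentiable f x) ->
  exists2 th : R, 0 <= th <= 1 & f b - f a = 'D_1 f (a + th * (b - a)) * (b - a).
Proof.
move=> df.
have dd (x : R) : is_derive x (1 : R) f ('D_1 f x) by apply: DeriveDef => //; exact: diff_derivable.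
have cf (A : set R) : {within A, continuous f}.
  by apply: continuous_subspaceT => x; exact: differentiable_continuous.
have [ab|ba|ab] := ltgtP a b.
- have [c] := MVT_segment (ltW ab) (fun x _ => dd x) (cf _).
  rewrite in_itv /= => /andP[ac cb] E.
  exists ((c - a) / (b - a)).
    by rewrite divr_ge0 ?subr_ge0 ?(ltW ab)//= ler_pdivrMr ?subr_gt0// mul1r lerD2r.
  by rewrite divfK ?subrKC // subr_eq0 gt_eqF.
- have [c] := MVT_segment (ltW ba) (fun x _ => dd x) (cf _).
  rewrite in_itv /= => /andP[ac cb] E.
  exists ((a - c) / (a - b)).
    by rewrite divr_ge0 ?subr_ge0 ?(ltW ba)//= ler_pdivrMr ?subr_gt0// mul1r lerD2l lerN2.
  have -> : a + (a - c) / (a - b) * (b - a) = c.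
    by rewrite -[b - a]opprB mulrN divfK ?subr_eq0 ?gt_eqF //; ring.
  by rewrite -[LHS]opprB E -mulrN opprB.
- by exists 0; rewrite ?lexx ?ler01 // ab !subrr mulr0.
Qed.

Lemma second_order_bound f t0 : Ck 2 setT f ->
  exists M r : R, [/\ 0 < M, 0 < r & forall s t, `|t0 - s| < r -> `|t0 - t| < r ->
    `|f t - f s - 'D_1 f s * (t - s)| <= M * (t - s) ^+ 2].
Proof.
move=> [df /(_ 1)[ddf /(_ 1) cd]].
have [r r0 H] := cont_ex (@ltr01 R) (cd t0 I).
exists (`|'D_1 ('D_1 f) t0| + 1), r; split=> //.
move=> s t hs ht.
have [th /andP[th0 th1] E] := mean_value s t (fun x => df x I).
set c := s + _ in E.
have [ph /andP[ph0 ph1] E'] := mean_value s c (fun x => ddf x I).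
set d := s + _ in E'.
have -> : f t - f s - 'D_1 f s * (t - s) = 'D_1 ('D_1 f) d * (th * (t - s) ^+ 2).
  rewrite E -mulrBl E' /c; ring.
have h2 : 0 <= th * (t - s) ^+ 2 by rewrite mulr_ge0 ?sqr_ge0.
rewrite normrM [X in _ * X]ger0_norm //.
have dE : t0 - d = (1 - ph * th) * (t0 - s) + ph * th * (t0 - t).
  by rewrite /d /c; ring.
have h0 : 0 <= ph * th by rewrite mulr_ge0.
have h1 : ph * th <= 1 by rewrite mulr_ile1.
have dn : `|t0 - d| < r.
  rewrite dE; apply: (le_lt_trans (ler_normD _ _)).
  rewrite (normrM (1 - ph * th)) (normrM (ph * th)).
  rewrite (ger0_norm h0) ger0_norm ?subr_ge0 //.
  apply: (@le_lt_trans _ _ (Num.max `|t0 - s| `|t0 - t|)); last by rewrite gt_max hs.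
  set m := Num.max _ _.
  have a1 : (1 - ph * th) * `|t0 - s| <= (1 - ph * th) * m.
    by rewrite ler_wpM2l ?subr_ge0 // le_max lexx.
  have a2 : ph * th * `|t0 - t| <= ph * th * m.
    by rewrite ler_wpM2l // le_max lexx orbT.
  by apply: (le_trans (lerD a1 a2)); rewrite -mulrDl subrK mul1r.
have hd : `|'D_1 ('D_1 f) d| <= `|'D_1 ('D_1 f) t0| + 1.
  have := H d dn; move: ('D_1 ('D_1 f) d) ('D_1 ('D_1 f) t0) => A B h.
  have -> : A = B - (B - A) by rewrite opprB subrKC.
  by apply: (le_trans (ler_normB _ _)); lra.
apply: ler_pM => //.
by apply: ler_piMl; rewrite ?sqr_ge0.
Qed.

End Taylor.

Section Normal.
Context {R : realType}.
Implicit Types (Omega : set (plane R)) (u v w x y z a b q e : plane R).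

Lemma dotBl u v w : dot (u - v) w = dot u w - dot v w.
Proof. by rewrite !dotE !mxE; ring. Qed.

Lemma dotZl (k : R) u v : dot (k *: u) v = k * dot u v.
Proof. by rewrite !dotE !mxE; ring. Qed.

Lemma dot_frame e u v : enorm e = 1 ->
  dot u v = dot u e * dot v e + dot u (perp e) * dot v (perp e).
Proof.
move=> e1; have e2 : e 0 0 * e 0 0 + e 0 1 * e 0 1 = 1.
  by rewrite -dotE -enorm_sqr e1 expr1n.
have -> : dot u v = (e 0 0 * e 0 0 + e 0 1 * e 0 1) * dot u v by rewrite e2 mul1r.
by rewrite !dotE !mxE /=; ring.
Qed.

(** As [a] is a nearest boundary point to [x], the vector [x - a] is orthogonal to the tangent of
    the graph at [a]; the chord [b - a] deviates from the tangent only quadratically. *)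
Lemma normal_local Omega q : open Omega -> bounded_set Omega ->
  C3_boundary Omega -> boundary Omega q ->
  exists M r : R, [/\ 0 < M, 0 < r & forall a b x, boundary Omega a -> boundary Omega b ->
    Omega x -> `|q - a| < r -> `|q - b| < r -> `|q - x| < r ->
    enorm (x - a) = dist x (boundary Omega) ->
    `|dot (x - a) (b - a)| <= M * enorm (x - a) * enorm (b - a) ^+ 2].
Proof.
move=> oO bO c3 bq.
have [e [gam [e1 cg /near_ex[r0 r00 H]]]] := c3 q bq.
have c2 : Ck 2 setT gam.
  by case: cg => dg cg; split=> // v; case: (cg v) => d1 c1; split=> // w; case: (c1 w) => d2 _ t _;
     exact: differentiable_continuous (d2 t I).
have dg : forall x : R, differentiable gam x by move=> t; exact: (proj1 cg).
have [M [r1 [M0 r10 T]]] := second_order_bound (dot q e) c2.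
have cgm : continuous gam by move=> t; exact: differentiable_continuous (dg t).
have pe1 : enorm (perp e) = 1.
  rewrite -e1 /enorm; congr Num.sqrt; rewrite !dotE !mxE /=; ring.
have de_le u : `|dot u e| <= 2 * `|u|.
  by apply: (le_trans (dot_le _ _)); rewrite e1 mulr1; exact: enorm_le_norm.
have onG b : boundary Omega b -> `|q - b| < r0 -> dot b (perp e) = gam (dot b e).
  move=> bb qb; apply/eqP; rewrite eq_le; apply/andP; split.
    by rewrite leNgt; apply/negP => h; apply: (boundary_notin oO bb); apply/(H b qb).
  rewrite leNgt; apply/negP => h.
  pose F z := gam (dot z e) - dot z (perp e).
  have cF : continuous F.
    apply: (@cont_sub R _ R).
      apply: (@cont_comp _ _ _ _ (fun z => dot z e) gam) => //.
      by apply: dot_continuous => //; [move=> z; exact: cvg_id|exact: cst_continuous].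
    by apply: dot_continuous => //; [move=> z; exact: cvg_id|exact: cst_continuous].
  have Fb : 0 < F b by rewrite /F subr_gt0.
  have [r2 r20 H2] := cont_ex Fb (cF b).
  have m0 : 0 < Num.min r2 (r0 - `|q - b|) by rewrite lt_min r20 subr_gt0.
  have [z [Oz bz]] := bb.1 _ (ex_near (x := b) m0 (fun z => id)).
  move: bz; rewrite lt_min => /andP[z1 z2].
  have qz : `|q - z| < r0.
    by rewrite -(subrKA b); apply: (le_lt_trans (ler_normD _ _)); lra.
  have h2 := (H z qz).1 Oz.
  have := H2 z z1; rewrite ltr_norml /F => /andP[_]; move: h2; lra.
pose r := Num.min (r0 / 2) (r1 / 2).
exists M, r; split; rewrite ?lt_min ?divr_gt0 //.
move=> a b x ba bb Ox; rewrite !lt_min => /andP[qa qa1] /andP[qb qb1] /andP[qx qx1] xa.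
have Ga := onG a ba _; have Gb := onG b bb _.
have {}Ga : dot a (perp e) = gam (dot a e) by apply: Ga; lra.
have {}Gb : dot b (perp e) = gam (dot b e) by apply: Gb; lra.
set a1 := dot a e in Ga *.
(* first-order optimality of the foot point *)
pose P (t : R) : plane R := t *: e + gam t *: perp e.
have e2 : e 0 0 * e 0 0 + e 0 1 * e 0 1 = 1.
  by rewrite -dotE -enorm_sqr e1 expr1n.
have dPe t : dot (P t) e = t.
  by rewrite -[RHS]mulr1 -e2 !dotE !mxE /=; ring.
have dPp t : dot (P t) (perp e) = gam t.
  by rewrite -[RHS]mulr1 -e2 !dotE !mxE /=; ring.
have Pa : P a1 = a.
  apply/eqP; rewrite -subr_eq0; apply/eqP/enorm_eq0.
  apply/eqP; rewrite -sqrf_eq0 enorm_sqr (dot_frame _ _ e1) !dotBl dPe dPp -Ga.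
  by rewrite /a1 !subrr !mulr0 addr0.
have cP : continuous P.
  apply: cont_add.
    by apply: cont_scale; [move=> s; exact: cvg_id|exact: cst_continuous].
  by apply: cont_scale => //; exact: cst_continuous.
have r02 : 0 < r0 / 2 by rewrite divr_gt0.
have [r3 r30 H3] := cont_ex r02 (cP a1).
(* The squared distance from [x] to the graph. Graph points near [a] are not in Omega, hence not
   closer to [x] than the boundary, and [phi] has a minimum at [a1]. *)
pose phi (t : R) := (dot x e - t) ^+ 2 + (dot x (perp e) - gam t) ^+ 2.
have phiE t : phi t = enorm (x - P t) ^+ 2.
  by rewrite enorm_sqr (dot_frame _ _ e1) !dotBl dPe dPp /phi !expr2.
have dphi (t : R) : is_derive t (1 : R) phi
   (- 2 * (dot x e - t) - 2 * (dot x (perp e) - gam t) * 'D_1 gam t).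
  have d1 : is_derive t (1 : R) gam ('D_1 gam t).
    by apply: DeriveDef => //; exact: diff_derivable.
  rewrite /phi; apply: is_derive_eq.
  by move: ('D_1 gam t) => A; rewrite /GRing.scale /=; ring.
have opt : dot x e - a1 = - (dot x (perp e) - gam a1) * 'D_1 gam a1.
  have := @derive1_at_min R phi (a1 - r3) (a1 + r3) a1 _ _ _ _.
  case.
  - by rewrite lerD2l; move: r30; lra.
  - by move=> t _; have [] := dphi t.
  - by rewrite in_itv /=; apply/andP; split; move: r30; lra.
  - move=> t; rewrite in_itv /= => /andP[t1 t2].
    have tr : `|a1 - t| < r3 by rewrite ltr_norml; apply/andP; split; move: t1 t2; lra.
    rewrite !phiE ler_sqr ?nnegrE ?enorm_ge0 // Pa xa.
    apply: dist_le_out => // OP.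
    have qP : `|q - P t| < r0.
      rewrite -(subrKA a); apply: (le_lt_trans (ler_normD _ _)).
      by have := H3 t tr; rewrite Pa; move: qa; lra.
    by have := (H _ qP).1 OP; rewrite dPe dPp ltxx.
  - move=> _ d0; have [_ d1] := dphi a1; move: d1; rewrite d0.
    by move: ('D_1 gam a1) => A; lra.
have Taylor : `|gam (dot b e) - gam a1 - 'D_1 gam a1 * (dot b e - a1)| <= M * (dot b e - a1) ^+ 2.
  by apply: T; rewrite /a1 -dotBl; apply: (le_lt_trans (de_le _)); move: qa1 qb1; lra.
rewrite (dot_frame _ _ e1) !dotBl -/a1 opt Ga Gb.
set u2 := dot x (perp e) - gam a1.
have -> : - u2 * 'D_1 gam a1 * (dot b e - a1) + u2 * (gam (dot b e) - gam a1) =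
  u2 * (gam (dot b e) - gam a1 - 'D_1 gam a1 * (dot b e - a1)).
  by move: ('D_1 gam a1) => A; ring.
rewrite normrM [M * _]mulrC -mulrA; apply: ler_pM => //.
  have -> : u2 = dot (x - a) (perp e) by rewrite dotBl Ga.
  by apply: (le_trans (dot_le _ _)); rewrite pe1 mulr1.
apply: (le_trans Taylor); rewrite ler_wpM2l ?(ltW M0) // -dotBl.
rewrite -(real_normK (num_real _)) ler_sqr ?nnegrE ?enorm_ge0 //.
by apply: (le_trans (dot_le _ _)); rewrite e1 mulr1.
Qed.

Lemma normal_bound Omega : open Omega -> bounded_set Omega ->
  C3_boundary Omega ->
  exists M r : R, [/\ 0 < M, 0 < r & forall a b x, boundary Omega a -> boundary Omega b ->
    Omega x -> enorm (x - a) < r ->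
    enorm (x - a) = dist x (boundary Omega) ->
    `|dot (x - a) (b - a)| <= M * enorm (x - a) * enorm (b - a) ^+ 2].
Proof.
move=> oO bO c3.
pose P (a : plane R) (s : R) := forall b x, boundary Omega b -> Omega x ->
  enorm (x - a) < s -> enorm (x - a) = dist x (boundary Omega) ->
  s * `|dot (x - a) (b - a)| <= enorm (x - a) * enorm (b - a) ^+ 2.
have [|r r0 H] := @compact_unif R _ (boundary Omega) P (boundary_compact bO).
  move=> q bq; have [M [r [M0 r0 H]]] := normal_local oO bO c3 bq.
  pose s := Num.min (r / 2) M^-1.
  have s0 : 0 < s by rewrite lt_min divr_gt0 ?invr_gt0.
  exists s => // a t ba; rewrite !lt_min => /andP[qa _] /and3P[t0 tr tM] b x bb Ox xt xd.
  have xa : `|x - a| < r / 2 by apply: (le_lt_trans (norm_le_enorm _)); lra.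
  have [qb|qb] := ltP `|a - b| (r / 2).
    have h := H a b x ba bb Ox.
    have {}h := h _ _ _ xd; apply: (@le_trans _ _ (t * (M * enorm (x - a) * enorm (b - a) ^+ 2))).
      rewrite ler_pM2l //; apply: h; first by lra.
        by rewrite -(subrKA a); apply: (le_lt_trans (ler_normD _ _)); lra.
      rewrite -(subrKA a); apply: (le_lt_trans (ler_normD _ _)).
      by rewrite [ `|a - x|]distrC; lra.
    have -> : t * (M * enorm (x - a) * enorm (b - a) ^+ 2) = t * M * (enorm (x - a) * enorm (b - a) ^+ 2) by rewrite !mulrA.
    apply: ler_piMl; first by rewrite mulr_ge0 ?sqr_ge0 ?enorm_ge0.
    by rewrite -ler_pdivlMr // mul1r; exact: ltW.
  apply: (@le_trans _ _ (t * (enorm (x - a) * enorm (b - a)))).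
    by rewrite ler_pM2l // dot_le.
  rewrite mulrCA ler_wpM2l ?enorm_ge0 // expr2 ler_wpM2r ?enorm_ge0 //.
  by apply: (le_trans _ (norm_le_enorm _)); rewrite distrC; lra.
exists (r / 2)^-1, (r / 2); split; rewrite ?invr_gt0 ?divr_gt0 //.
move=> a b x ba bb Ox xr xd.
have h : 0 < r / 2 < r by apply/andP; split; lra.
have := H a (r / 2) ba h b x bb Ox xr xd.
rewrite -[_^-1 * _ * _]mulrA; by rewrite ler_pdivlMl ?divr_gt0.
Qed.

End Normal.

(** * The differential of the path function *)

Section Differentials.
Context {R : realType}.
Implicit Types (V W : normedModType R).

Lemma diff_near V W (f h : V -> W) x : differentiable h x ->
  (\forall y \near x, f y = h y) -> is_diff x f ('d h x).
Proof.
move=> dh /near_ex[r r0 fh].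
have dc := diff_continuous dh.
have fx : f x = h x by apply: fh; rewrite subrr normr0.
have E : f \o shift x = cst (f x) + 'd h x +o_ 0 id.
  apply/eqaddoP => e e0; have /eqaddoP/(_ e e0) := diff_locally dh.
  have nr : \forall y \near (0 : V), f (y + x) = h (y + x).
    apply: (ex_near (x := 0 : V) r0) => y; rewrite distrC subr0 => yr.
    by apply: fh; rewrite opprD addrCA subrr addr0 normrN.
  apply: filterS2 nr => y /=; rewrite !fctE /= fx => ->; exact.
have D := diff_unique dc E.
split; last exact: D.
by apply/diff_locallyP; rewrite D; split.
Qed.

Lemma cont_near V W (f h : V -> W) x : (\forall y \near x, f y = h y) ->
  {for x, continuous h} -> {for x, continuous f}.
Proof.
move=> fh ch; have [r r0 E] := near_ex fh.
have fx : f x = h x by apply: E; rewrite subrr normr0.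
by move=> A; rewrite fx => /ch; apply: filterS2 fh => y /= ->.
Qed.

Lemma cont_sum V W (I : finType) (P : pred I) (f : I -> V -> W) x :
  (forall i, P i -> {for x, continuous (f i)}) ->
  {for x, continuous (fun y => \sum_(i | P i) f i y)}.
Proof.
move=> h; have -> : (fun y => \sum_(i | P i) f i y) = \sum_(i | P i) f i.
  by apply/funext => y; rewrite fct_sumE.
apply: (big_ind (fun k => {for x, continuous k})) => //.
  exact: cst_continuous.
by move=> k1 k2 c1 c2; apply: cvgD.
Qed.

Lemma is_diff_sum V W (I : finType) (P : pred I) (f df : I -> V -> W) x :
  (forall i, P i -> is_diff x (f i) (df i)) ->
  is_diff x (fun y => \sum_(i | P i) f i y) (fun y => \sum_(i | P i) df i y).
Proof.
move=> h.
have E (k : I -> V -> W) : (fun y => \sum_(i | P i) k i y) = \sum_(i | P i) k i.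
  by apply/funext => y; rewrite fct_sumE.
rewrite !E; elim/big_rec2: _ => [|i k1 k2 Pi hk]; first exact: is_diff_cst.
by apply: is_diffD => //; exact: h.
Qed.

Lemma is_diff_linear V W (f : V -> W) x : linear f -> continuous f -> is_diff x f f.
Proof.
move=> lf cf; pose L : {linear V -> W} := HB.pack f (GRing.isLinear.Build _ _ _ _ f lf).
by split; [exact: (@linear_differentiable _ _ _ L)|exact: (@diff_lin _ _ _ L)].
Qed.

Lemma is_diff_real (f : R -> R) (x df : R) : is_derive x (1 : R) f df ->
  is_diff x f (fun v => v * df).
Proof.
move=> [d1 d2]; split; first exact/derivable1_diffP.
by apply/funext => v; rewrite diff1E; [rewrite derive1E d2|exact/derivable1_diffP].
Qed.

Lemma diff_grad (f : plane R -> R) x v : differentiable f x ->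
  'd f x v = dot (grad f x) v.
Proof.
move=> df; rewrite dotE !mxE !deriveE //.
have E : v = v 0 0 *: delta_mx 0 0 + v 0 1 *: delta_mx 0 1.
  by apply/rowP => k; rewrite !mxE /=; case: (ord2P k) => -> /=; rewrite !mulr1 mulr0 ?addr0 ?add0r.
by rewrite [in LHS]E linearD !linearZ /= mulrC [v 0 1 *: _]mulrC.
Qed.

Lemma is_diff_dot (x : plane R) : is_diff x (fun u => dot u u) (fun v => 2 * dot x v).
Proof.
have c k : is_diff x (fun u : plane R => u 0 k : R) (fun v => v 0 k).
  by apply: is_diff_linear => [a u v|u]; [rewrite !mxE|exact: coord_continuous].
have -> : (fun u : plane R => dot u u) = (fun u => u 0 0 : R) * (fun u => u 0 0) + (fun u => u 0 1 : R) * (fun u => u 0 1).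
  by apply/funext => u; rewrite dotE.
apply: is_diff_eq; apply/funext => v; rewrite !fctE dotE /GRing.scale /=; ring.
Qed.

(** The differential of the logarithm of the Euclidean norm at [u], applied to [v]. *)
Definition dlog (u v : plane R) : R := dot u v / dot u u.

Lemma is_diff_log (x : plane R) : x <> 0 ->
  is_diff x (fun u : plane R => ln (enorm u)) (dlog x).
Proof.
move=> x0; have e0 := enorm_neq0 x0.
have d0 : 0 < dot x x by rewrite -enorm_sqr exprn_gt0.
have ds : is_derive (dot x x) (1 : R) (fun s : R => ln (Num.sqrt s)) ((2 * dot x x)^-1).
  have -> : (2 * dot x x)^-1 = (enorm x)^-1 * (2 * enorm x)^-1.
    by rewrite -invfM -enorm_sqr; congr (_^-1); ring.
  apply: is_derive1_comp; [exact: is_derive1_ln|exact: is_derive1_sqrt].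
suff -> : dlog x = (fun v => v * (2 * dot x x)^-1) \o (fun v => 2 * dot x v).
  exact: is_diff_comp (is_diff_dot x) (is_diff_real ds).
apply/funext => v /=.
rewrite /dlog; have : dot x x != 0 by rewrite gt_eqF.
by move: (dot x x) (dot x v) => a b a0; field.
Qed.

End Differentials.

Section Routh.
Context {R : realType}.
Variables (Omega : set (plane R)) (G : plane R -> plane R -> R)
  (g : plane R * plane R -> R) (N : nat) (Gamma : 'rV[R]_N).
Hypothesis oO : open Omega.
Hypothesis gG : forall x y, Omega x -> Omega y -> x <> y ->
  g (x, y) = G x y + (2 * pi)^-1 * ln (enorm (x - y)).
Hypothesis g1 : Ck 1 (Omega `*` Omega) g.
Implicit Types (z v : 'M[R]_(N, 2)).

(** The differential of G off the diagonal. It is expressed by that of [g], because [g] is the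
    function that is assumed to be C^1. *)
Definition dG (x y u w : plane R) : R :=
  'd g (x, y) (u, w) - (2 * pi)^-1 * dlog (x - y) (u - w).

Definition dKR z v : R :=
  \sum_j Gamma 0 j ^+ 2 * 'd g (row j z, row j z) (row j v, row j v) +
  \sum_i \sum_(j | j != i) Gamma 0 i * Gamma 0 j *
     dG (row i z) (row j z) (row i v) (row j v).

Lemma row_continuous i : continuous (fun z => row i z).
Proof.
move=> z; apply: ex_cont => e e0; exists e => // y zy.
rewrite -linearB; apply: mx_norm_lt => // k l; rewrite mxE.
by apply: le_lt_trans zy; exact: entry_le.
Qed.

Lemma is_diff_row i z : is_diff z (fun z => row i z) (fun v => row i v).
Proof. by apply: is_diff_linear; [exact: linearP|exact: row_continuous]. Qed.

Lemma config_open z : config Omega z -> \forall y \near z, config Omega y.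
Proof.
move=> [zO zd].
have h1 : \forall y \near z, forall i, Omega (row i y).
  refine (@filter_forall 'M[R]_(N, 2) _ (fun i y => Omega (row i y)) (nbhs z) _ _) => i.
  have nO : nbhs (row i z) Omega by apply: open_nbhs_nbhs; split.
  exact: (row_continuous nO).
have h2 : \forall y \near z, forall i j, i <> j -> row i y <> row j y.
  refine (@filter_forall 'M[R]_(N, 2) _ (fun i y => forall j, i <> j -> row i y <> row j y) (nbhs z) _ _) => i.
  refine (@filter_forall 'M[R]_(N, 2) _ (fun j y => i <> j -> row i y <> row j y) (nbhs z) _ _) => j.
  have [ij|ij] := pselect (i = j); first by apply: nearW => y /(_ ij).
  have c : continuous (fun y : 'M[R]_(N, 2) => row i y - row j y).
    by apply: cont_sub; exact: row_continuous.
  have p : 0 < `|row i z - row j z|.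
    by rewrite normr_gt0 subr_eq0; apply/eqP; exact: zd.
  have [r r0 h] := cont_ex p (c z).
  refine (ex_near (x := z) r0 _) => y /h yr _ E; move: yr; rewrite E subrr subr0 ltxx //.
by apply: filterS2 h1 h2 => y; split.
Qed.

Lemma is_diff_g x y : Omega x -> Omega y -> is_diff (x, y) g ('d g (x, y)).
Proof. by move=> Ox Oy; split=> //; case: g1 => dg _; apply: dg. Qed.

Lemma is_diff_gpair i j z : Omega (row i z) -> Omega (row j z) ->
  is_diff z (fun z => g (row i z, row j z))
    (fun v => 'd g (row i z, row j z) (row i v, row j v)).
Proof.
move=> Oi Oj.
exact: (is_diff_comp (is_diff_pair (is_diff_row i z) (is_diff_row j z)) (is_diff_g Oi Oj)).
Qed.

Lemma is_diff_Gpair i j z : config Omega z -> i != j ->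
  is_diff z (fun z => G (row i z) (row j z))
    (fun v => dG (row i z) (row j z) (row i v) (row j v)).
Proof.
move=> cz ij; have [zO zd] := cz; have nij : i <> j by apply/eqP.
have d1 := is_diff_gpair (zO i) (zO j).
have n0 : row i z - row j z <> 0 by move/eqP; rewrite subr_eq0 => /eqP; exact: zd.
have d2 := is_diff_comp (is_diffB (is_diff_row i z) (is_diff_row j z)) (is_diff_log n0).
have d3 := is_diffB d1 (is_diffZ (2 * pi)^-1 d2).
have E : \forall y \near z, G (row i y) (row j y) =
   ((fun z => g (row i z, row j z)) - ((2 * pi)^-1 \*:
     ((fun u : plane R => ln (enorm u)) \o ((fun z => row i z) - (fun z => row j z))))) y.
  apply: filterS (config_open cz) => y [yO yd].
  by rewrite !fctE /= (gG (yO i) (yO j) (yd _ _ nij)) addrK.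
have [dd dE] := d3.
have := diff_near dd E; rewrite dE; exact.
Qed.

Lemma is_diff_KR z : config Omega z -> is_diff z (KirchhoffRouth Gamma G g) (dKR z).
Proof.
move=> cz; have [zO zd] := cz.
rewrite /KirchhoffRouth /dKR.
apply: (@is_diffD _ _ _ (fun z => \sum_j Gamma 0 j ^+ 2 * g (row j z, row j z))).
  apply: (is_diff_sum (f := fun j z => Gamma 0 j ^+ 2 * g (row j z, row j z))) => j _.
  exact: (is_diffZ _ (is_diff_gpair (zO j) (zO j))).
apply: (is_diff_sum (f := fun i z => \sum_(j | j != i) Gamma 0 i * Gamma 0 j * G (row i z) (row j z))) => i _.
apply: (is_diff_sum (f := fun j z => Gamma 0 i * Gamma 0 j * G (row i z) (row j z))) => j ji.
by apply: (is_diffZ _ (is_diff_Gpair cz _)); rewrite eq_sym.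
Qed.

Lemma dKR_continuous v z : config Omega z -> {for z, continuous (fun z => dKR z v)}.
Proof.
move=> cz; have [zO zd] := cz.
have cg i j : {for z, continuous (fun z => 'd g (row i z, row j z) (row i v, row j v))}.
  pose k z := (row i z, row j z); pose w := (row i v, row j v).
  have ck : {for z, continuous k} by exact: cvg_pair (@row_continuous i z) (@row_continuous j z).
  have c := (proj2 g1 w) (k z) (conj (zO i) (zO j)).
  have c2 : {for z, continuous ('D_w g \o k)} by exact: continuous_comp ck c.
  apply: cont_near c2; apply: filterS (config_open cz) => y [yO yd] /=.
  by rewrite deriveE //; case: (is_diff_g (yO i) (yO j)).
have cl i j : i != j -> {for z, continuous (fun z => dlog (row i z - row j z) (row i v - row j v))}.
  move=> ij; have nij : i <> j by apply/eqP.
  have n0 : row i z - row j z <> 0 by move/eqP; rewrite subr_eq0 => /eqP; exact: zd.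
  have c : continuous (fun z : 'M[R]_(N, 2) => row i z - row j z).
    by apply: cont_sub; exact: row_continuous.
  have c1 : continuous (fun z : 'M[R]_(N, 2) => dot (row i z - row j z) (row i v - row j v)).
    exact: (dot_continuous c (@cst_continuous _ _ (row i v - row j v))).
  have c2 : continuous (fun z : 'M[R]_(N, 2) => dot (row i z - row j z) (row i z - row j z)).
    exact: dot_continuous.
  apply: (cvgM (c1 z)); apply: (cvgV _ (c2 z)).
  by rewrite -enorm_sqr sqrf_eq0 gt_eqF // enorm_neq0.
have s1 : {for z, continuous (fun z => \sum_j Gamma 0 j ^+ 2 * 'd g (row j z, row j z) (row j v, row j v))}.
  apply: (cont_sum (f := fun j z => Gamma 0 j ^+ 2 * 'd g (row j z, row j z) (row j v, row j v))) => j _.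
  exact: (cvgM (cvg_cst _) (cg j j)).
have s2 : {for z, continuous (fun z => \sum_i \sum_(j | j != i) Gamma 0 i * Gamma 0 j * dG (row i z) (row j z) (row i v) (row j v))}.
  apply: (cont_sum (f := fun i z => \sum_(j | j != i) Gamma 0 i * Gamma 0 j * dG (row i z) (row j z) (row i v) (row j v))) => i _.
  apply: (cont_sum (f := fun j z => Gamma 0 i * Gamma 0 j * dG (row i z) (row j z) (row i v) (row j v))) => j ji.
  have ij : i != j by rewrite eq_sym.
  exact: (cvgM (cvg_cst _) (cvgB (cg i j) (cvgM (cvg_cst _) (cl i j ij)))).
exact: cvgD s1 s2.
Qed.

End Routh.

(** * Pair estimates *)

Section PairEstimates.
Context {R : realType}.
Variables (Omega : set (plane R)) (eps0 : R) (p : plane R -> plane R)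
  (G : plane R -> plane R -> R) (g : plane R * plane R -> R).
Hypotheses (oO : open Omega) (bO : bounded_set Omega) (O0 : Omega !=set0).
Hypotheses (Hp : collar_projection Omega eps0 p) (HG : hypothesis_G Omega eps0 p G g).
Implicit Types (x y u v w : plane R).
Notation D z := (dist z (boundary Omega)).
Notation c := ((2 * pi)^-1 : R).

Lemma dlogD x u v : dlog x (u + v) = dlog x u + dlog x v.
Proof. by rewrite /dlog -mulrDl !dotE !mxE; congr (_ / _); ring. Qed.

Lemma dlogN x u : dlog x (- u) = - dlog x u.
Proof. by rewrite /dlog -mulNr !dotE !mxE; congr (_ / _); ring. Qed.

Lemma dlog_le x u (r : R) : 0 < r -> r <= enorm x -> `|dlog x u| <= enorm u / r.
Proof.
move=> r0 rx; have x0 := lt_le_trans r0 rx.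
rewrite /dlog normrM -enorm_sqr normfV (ger0_norm (sqr_ge0 _)) ler_pdivrMr ?exprn_gt0 //.
apply: (le_trans (dot_le _ _)).
have -> : enorm u / r * enorm x ^+ 2 = enorm x * enorm u * (enorm x / r) by ring.
by apply: ler_peMr; rewrite ?mulr_ge0 ?enorm_ge0 // ler_pdivlMr ?mul1r.
Qed.

Lemma c_gt0 : 0 < c.
Proof. by rewrite invr_gt0 mulr_gt0 // pi_gt0. Qed.

Lemma is_diff_g' x y : Omega x -> Omega y -> is_diff (x, y) g ('d g (x, y)).
Proof. by move=> Ox Oy; exact: (is_diff_g (g_C1 HG) Ox Oy). Qed.

Lemma dgD x y u w : 'd g (x, y) (u, w) = 'd g (x, y) (u, 0) + 'd g (x, y) (0, w).
Proof.
have E : (u, w) = (u, 0) + (0, w) by rewrite -[RHS]/(u + 0, 0 + w) addr0 add0r.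
by rewrite E linearD.
Qed.

Lemma dGD x y u w : dG g x y u w = dG g x y u 0 + dG g x y 0 w.
Proof.
rewrite /dG dgD subr0 sub0r dlogD; ring.
Qed.

Lemma is_diff_pair1 x y : is_diff x (fun x' : plane R => (x', y)) (fun u => (u, 0)).
Proof. exact: (is_diff_pair (is_diff_id x) (is_diff_cst y x)). Qed.

Lemma is_diff_pair2 x y : is_diff y (fun y' : plane R => (x, y')) (fun w => (0, w)).
Proof. exact: (is_diff_pair (is_diff_cst x y) (is_diff_id y)). Qed.

Lemma near_other x y : Omega x -> x <> y -> \forall x' \near x, Omega x' /\ x' <> y.
Proof.
move=> Ox xy; have n1 : nbhs x Omega by apply: open_nbhs_nbhs.
have p0 : 0 < `|x - y| by rewrite normr_gt0 subr_eq0; apply/eqP.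
have n2 : \forall x' \near x, x' <> y.
  by apply: (ex_near (x := x) p0) => x' xx' E; move: xx'; rewrite E ltxx.
by apply: filterS2 n1 n2.
Qed.

Lemma is_diff_G1 x y : Omega x -> Omega y -> x <> y ->
  is_diff x (fun x' => G x' y) (fun u => dG g x y u 0).
Proof.
move=> Ox Oy xy; have n0 : x - y <> 0 by move/eqP; rewrite subr_eq0 => /eqP.
have d1 := is_diff_comp (is_diff_pair1 x y) (is_diff_g' Ox Oy).
have d2 := is_diff_comp (is_diffB (is_diff_id x) (is_diff_cst y x)) (is_diff_log n0).
have d3 := is_diffB d1 (is_diffZ c d2).
have [dd dE] := d3.
have E : \forall x' \near x, G x' y = ((g \o (fun x' => (x', y))) -
   (c \*: ((fun u : plane R => ln (enorm u)) \o (id - cst y)))) x'.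
  apply: filterS (near_other Ox xy) => x' [Ox' x'y].
  by rewrite !fctE /= (g_continuation HG Ox' Oy x'y) addrK.
have := diff_near dd E; rewrite dE; exact.
Qed.

Lemma is_diff_G2 x y : Omega x -> Omega y -> x <> y ->
  is_diff y (fun y' => G x y') (fun w => dG g x y 0 w).
Proof.
move=> Ox Oy xy; have n0 : x - y <> 0 by move/eqP; rewrite subr_eq0 => /eqP.
have d1 := is_diff_comp (is_diff_pair2 x y) (is_diff_g' Ox Oy).
have d2 := is_diff_comp (is_diffB (is_diff_cst x y) (is_diff_id y)) (is_diff_log n0).
have d3 := is_diffB d1 (is_diffZ c d2).
have [dd dE] := d3.
have E : \forall y' \near y, G x y' = ((g \o (fun y' => (x, y'))) -
   (c \*: ((fun u : plane R => ln (enorm u)) \o (cst x - id)))) y'.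
  have yx : y <> x by move=> yx; apply: xy.
  apply: filterS (near_other Oy yx) => y' [Oy' y'x].
  have xy' : x <> y' by move=> E; apply: y'x.
  by rewrite !fctE /= (g_continuation HG Ox Oy' xy') addrK.
have := diff_near dd E; rewrite dE; exact.
Qed.

Lemma grad_bound (F : plane R -> plane R -> R) x y C (L1 L2 : plane R -> R) :
  C1_bound F x y <= C ->
  is_diff x (fun x' => F x' y) L1 -> is_diff y (fun y' => F x y') L2 ->
  (forall u, `|L1 u| <= C * enorm u) /\ (forall w, `|L2 w| <= C * enorm w).
Proof.
move=> h [d1 <-] [d2 <-]; split => u.
  rewrite (diff_grad _ d1); apply: (le_trans (dot_le _ _)); rewrite ler_wpM2r ?enorm_ge0 //.
  apply: le_trans h; rewrite /C1_bound.
  by rewrite -addrA addrCA lerDl addr_ge0 ?normr_ge0 ?enorm_ge0.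
rewrite (diff_grad _ d2); apply: (le_trans (dot_le _ _)); rewrite ler_wpM2r ?enorm_ge0 //.
apply: le_trans h; rewrite /C1_bound.
by rewrite lerDr addr_ge0 ?normr_ge0 ?enorm_ge0.
Qed.

Lemma dG_far (e : R) : 0 < e -> exists2 C : R, 0 < C &
  forall x y, Omega x -> Omega y -> e <= enorm (x - y) ->
  forall u w, `|dG g x y u w| <= C * (enorm u + enorm w).
Proof.
move=> e0; have [C C0 H] := G_off_diagonal HG e0; exists C => // x y Ox Oy xy u w.
have nxy : x <> y by move=> E; move: xy; rewrite E subrr enorm0 leNgt e0.
have [h1 h2] := grad_bound (H x y Ox Oy xy) (is_diff_G1 Ox Oy nxy) (is_diff_G2 Ox Oy nxy).
rewrite dGD mulrDr; apply: (le_trans (ler_normD _ _)); exact: lerD.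
Qed.

Lemma collar_in x : collar Omega eps0 x -> Omega x.
Proof. by case. Qed.

(** On the segment from [x] to its foot the distance to the boundary decreases at unit speed, by the
    Lipschitz property; so [p x] remains a nearest point, and the nearest point is unique. *)
Lemma proj_shift x (t : R) : collar Omega eps0 x -> 0 <= t < 1 ->
  p (x - t *: (x - p x)) = p x.
Proof.
move=> cx /andP[t0 t1]; have [Ox dx] := cx; set v := x - p x.
have vD : enorm v = D x by rewrite /v enormB; exact: proj_dist Hp _ cx.
have D0 := dist_gt0 oO bO O0 Ox.
have pE : p x - (x - t *: v) = - ((1 - t) *: v).
  by rewrite scalerBl scale1r /v !opprB addrCA; apply/rowP => k; rewrite !mxE; ring.
have dE : enorm (p x - (x - t *: v)) = (1 - t) * D x.
  by rewrite pE enormN enormZ vD ger0_norm ?subr_ge0 // ltW.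
have Oxt : Omega (x - t *: v).
  apply: (dist_in (z := x) oO Ox); rewrite opprB addrC subrK enormZ vD ger0_norm //.
  by rewrite gtr_pMl.
have Dt : D (x - t *: v) = (1 - t) * D x.
  apply/eqP; rewrite eq_le; apply/andP; split.
    by rewrite -dE enormB; apply: dist_le_boundary; exact: proj_boundary Hp _ cx.
  have := dist_lip oO bO O0 x (x - t *: v).
  by rewrite subKr enormZ vD ger0_norm //; lra.
apply/esym; apply: (proj_unique Hp).
- split=> //; rewrite Dt; apply: le_lt_trans dx; rewrite ler_piMl ?(ltW D0) //; lra.
- exact: proj_boundary Hp _ cx.
- by rewrite dE Dt.
Qed.

(** The projection is constant along the normal segment, hence has derivative 0 in its direction. *)
Lemma proj_normal x : collar Omega eps0 x -> 'd p x (x - p x) = 0.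
Proof.
move=> cx; set v := x - p x.
have [dp _] := proj_C2 Hp; have dpx := dp x cx.
rewrite -deriveE //; have := diff_derivable (v := v) dpx.
rewrite /derivable => /cvg_ex[l cl].
have -> : 'D_v p x = l by apply: cvg_lim.
apply/eqP; rewrite -normr_eq0; apply/eqP/le_anti; rewrite normr_ge0 andbT leNgt; apply/negP => l0.
move/cvgrPdist_lt : cl => /(_ _ l0); rewrite /dnbhs /prop_near1 /= => hn.
have {}hn : \forall t \near (0 : R), t != 0 -> `|l - t^-1 *: (p (t *: v + x) - p x)| < `|l| by exact: hn.
have [r r0 H] := @near_ex R R 0 _ hn.
(* The difference quotient is tested at [- t], that is, towards the boundary, where [proj_shift]
   applies. *)
pose t := Num.min (r / 2) 2^-1.
have t0 : 0 < t by rewrite lt_min divr_gt0 //= invr_gt0.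
have t1 : t <= 2^-1 by rewrite ge_min lexx orbT.
have tr : t <= r / 2 by rewrite ge_min lexx.
have := H (- t); rewrite sub0r opprK gtr0_norm // => /(_ _).
have {}tr : t < r by lra.
move=> /(_ tr); rewrite oppr_eq0 gt_eqF // => /(_ isT) /=.
rewrite scaleNr [- _ + x]addrC proj_shift // ?subrr ?scaler0 ?subr0 ?ltxx //.
by rewrite (ltW t0) /=; apply: (le_lt_trans t1); lra.
Qed.

(** Moving [x] along [x - p x] moves the reflected point along [- (x - p x)], since the projection
    stays put to first order; this explains the sign of the logarithmic term in the first
    estimate. *)
Lemma psi_estimate : exists2 C : R, 0 < C &
  forall x y, collar Omega eps0 x -> collar Omega eps0 y ->
  `|'d g (x, y) (x - p x, 0) + c * dlog (reflection p x - y) (x - p x)| <= C * D x /\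
  forall w, `|'d g (x, y) (0, w) + c * dlog (reflection p x - y) w| <= C * enorm w.
Proof.
have [C C0 H] := psi_bounded HG; exists C => // x y cx cy.
have Ox := collar_in cx; have Oy := collar_in cy.
have n0 : reflection p x - y <> 0.
  move/eqP; rewrite subr_eq0 => /eqP E; apply: (reflection_outside Hp cx); by rewrite E.
have [dp _] := proj_C2 Hp; have dpx := differentiableP (dp x cx).
have dr : is_diff x (reflection p) (2 \*: ('d p x : plane R -> plane R) - id).
  exact: (is_diffB (is_diffZ 2 dpx) (is_diff_id x)).
have d1 := is_diffB (is_diff_comp (is_diff_pair1 x y) (is_diff_g' Ox Oy))
  (is_diffZ c (is_diff_comp (is_diffB dr (is_diff_cst y x)) (is_diff_log n0))).
have d2 := is_diffB (is_diff_comp (is_diff_pair2 x y) (is_diff_g' Ox Oy))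
  (is_diffZ c (is_diff_comp (is_diffB (is_diff_cst (reflection p x) y) (is_diff_id y)) (is_diff_log n0))).
have [h1 h2] := grad_bound (H x y cx cy) d1 d2.
split.
  have := h1 (x - p x); rewrite !fctE /= proj_normal // scaler0 sub0r subr0 dlogN.
  by rewrite /GRing.scale /= mulrN opprK [enorm (x - _)]enormB (proj_dist Hp cx).
move=> w; have := h2 w; rewrite !fctE /= sub0r dlogN.
by rewrite /GRing.scale /= mulrN opprK.
Qed.

End PairEstimates.

(** * Scales and compactness *)

Section Scales.
Context {R : realType}.

(** Pigeonhole: if each of the N intervals between consecutive scales [rho ^+ k * d] contained a
    value of [f], all N indices would be used up, but [f i0] lies below all these intervals. *)
Lemma scale_gap (N : nat) (f : 'I_N -> R) (i0 : 'I_N) (d rho : R) :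
  0 < d -> 0 < rho < 1 -> f i0 <= rho ^+ N * d ->
  exists eta, [/\ rho ^+ N * d <= eta, eta <= d &
    forall j, f j <= rho * eta \/ eta < f j].
Proof.
move=> d0 /andP[r0 r1] fi0; apply: contrapT => no.
have mono m n : (m <= n)%N -> rho ^+ n * d <= rho ^+ m * d.
  by move=> mn; rewrite ler_pM2r // ler_wiXn2l // ltW.
have hit (k : 'I_N) : exists j, rho ^+ k.+1 * d < f j /\ f j <= rho ^+ k * d.
  apply: contrapT => nk; apply: no; exists (rho ^+ k * d); split.
  - by apply: mono; exact: ltnW.
  - by rewrite -[leRHS]mul1r -(expr0 rho) mono.
  - move=> j; rewrite mulrA -exprS; have [h|h] := ltP (rho ^+ k.+1 * d) (f j); last by left.
    right; rewrite ltNge; apply/negP => h2; apply: nk; by exists j.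
have [J HJ] := choice hit.
have injJ : injective J.
  move=> k l E; have [a1 a2] := HJ k; have [b1 b2] := HJ l; rewrite E in a1 a2.
  apply/val_inj/eqP; rewrite eqn_leq; apply/andP; split; rewrite leqNgt; apply/negP => lt.
    by have := lt_le_trans b1 a2; rewrite ltNge mono.
  by have := lt_le_trans a1 b2; rewrite ltNge mono.
have [k E] : exists k, J k = i0.
  by exists (invF injJ i0); rewrite f_invF.
have [h _] := HJ k; rewrite E in h.
by have := lt_le_trans h fi0; rewrite ltNge mono.
Qed.

Lemma finite_pos (T : finType) (P : pred T) (f : T -> R) :
  (forall t, P t -> 0 < f t) -> exists2 mu : R, 0 < mu & forall t, P t -> mu <= f t.
Proof.
move=> h; have H : \forall e \near (0 : R), forall t, P t -> e <= f t.
  refine (@filter_forall R _ (fun t e => P t -> e <= f t) (nbhs (0 : R)) _ _) => t.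
  have [Pt|nPt] := boolP (P t); last by apply: nearW.
  by apply: (@ex_near R R 0 _ _ (h t Pt)) => e + _; rewrite sub0r normrN => /ltW; apply: le_trans; exact: ler_norm.
have [r r0 Hr] := @near_ex R R 0 _ H.
exists (r / 2); first by rewrite divr_gt0.
by apply: Hr; rewrite sub0r normrN gtr0_norm ?divr_gt0 //; lra.
Qed.

Lemma KR_sum_bound (N : nat) (Gam : 'I_N -> R) (K : R) (A a : 'I_N -> R) (B b : 'I_N -> 'I_N -> R) :
  (forall j, A j <= Gam j ^+ 2 * a j + K * Gam j ^+ 2) ->
  (forall i j, j != i -> B i j <= Gam i * Gam j * b i j + K * `|Gam i * Gam j|) ->
  \sum_j A j + \sum_i \sum_(j | j != i) B i j <=
  \sum_j Gam j ^+ 2 * a j + \sum_i \sum_(j | j != i) Gam i * Gam j * b i j +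
  K * (\sum_j Gam j ^+ 2 + \sum_i \sum_(j | j != i) `|Gam i * Gam j|).
Proof.
move=> hA hB; rewrite mulrDr addrACA; apply: lerD.
  rewrite mulr_sumr -big_split /=; apply: ler_sum => j _; exact: hA.
rewrite mulr_sumr -big_split /=; apply: ler_sum => i _.
rewrite mulr_sumr -big_split /=; apply: ler_sum => j ji; exact: hB.
Qed.

Lemma mx_compact m n (A : set 'M[R]_(m, n)) (B : R) : 0 < B ->
  (forall z, A z -> `|z| <= B) ->
  (forall z, (forall r, 0 < r -> exists2 z', A z' & `|z - z'| < r) -> A z) -> compact A.
Proof.
move=> B0 hB hA; have cv : continuous (fun v : 'rV[R]_(m * n) => vec_mx v).
  move=> v; apply: ex_cont => e e0; exists e => // w vw; rewrite -linearB.
  by apply: mx_norm_lt => // i j; rewrite mxE; apply: le_lt_trans vw; exact: entry_le.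
have cK := @cube_compact R (m * n) B.
have cI := continuous_compact (continuous_subspaceT cv) cK.
apply: (subclosed_compact _ cI).
  move=> z cz; apply: hA => r r0; have [z' [Az' zz']] := cz _ (ex_near (x := z) r0 (fun z => id)).
  by exists z'.
move=> z Az; exists (mxvec z); last by rewrite mxvecK.
move=> i /=; case/mxvec_indexP: i => i j; rewrite mxvecE.
by apply: le_trans (hB _ Az); exact: entry_le.
Qed.

End Scales.

(** * Compact sets of configurations *)

Section Deep.
Context {R : realType}.
Variables (Omega : set (plane R)).
Hypotheses (oO : open Omega) (bO : bounded_set Omega) (O0 : Omega !=set0).
Notation D z := (dist z (boundary Omega)).

Definition deep (N : nat) (d s : R) : set 'M[R]_(N, 2) :=
  [set z | (forall i, Omega (row i z) /\ d <= D (row i z)) /\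
           forall i j, i <> j -> s <= enorm (row i z - row j z)].

Lemma row_dist (N : nat) (z z' : 'M[R]_(N, 2)) i : enorm (row i z - row i z') <= 2 * `|z - z'|.
Proof.
rewrite -linearB; apply: (le_trans (enorm_le_norm _)).
rewrite ler_pM2l //; apply: mx_norm_le => // k l; rewrite mxE; exact: entry_le.
Qed.

Lemma deep_point_limit (d : R) x : 0 < d ->
  (forall r, 0 < r -> exists2 x', Omega x' /\ d <= D x' & enorm (x - x') < r) ->
  Omega x /\ d <= D x.
Proof.
move=> d0 h; split.
  have [x' [Ox' dx'] xx'] := h d d0.
  by apply: (dist_in oO Ox'); rewrite enormB; apply: lt_le_trans dx'.
apply/ler_addgt0Pr => e e0; have [x' [Ox' dx'] xx'] := h e e0.
apply: (le_trans dx'); apply: (le_trans (dist_lip oO bO O0 x' x)).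
by rewrite lerD2l enormB ltW.
Qed.

Lemma deep_compact N (d s : R) : 0 < d -> compact (@deep N d s).
Proof.
move=> d0; have [B B0 hB] := bounded_setP bO.
apply: (mx_compact B0).
  move=> z [zO _]; apply: mx_norm_le => [|i j]; first exact: ltW.
  have := hB _ (proj1 (zO i)); apply: le_trans.
  by have := entry_le (row i z) 0 j; rewrite mxE.
move=> z h; split=> [i|i j ij].
  apply: deep_point_limit => // r r0.
  have r2 : 0 < r / 2 by rewrite divr_gt0.
  have [z' [zO' _] zz'] := h _ r2.
  exists (row i z'); first exact: zO'.
  by apply: (le_lt_trans (row_dist _ _ _)); lra.
apply/ler_addgt0Pr => e e0; have e4 : 0 < e / 4 by rewrite divr_gt0.
have [z' [_ sz'] zz'] := h _ e4.
apply: (le_trans (sz' i j ij)).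
apply: (le_trans (enorm_tri _ (row i z) _)); rewrite addrC.
apply: (le_trans (lerD (enorm_tri _ (row j z) _) (lexx _))).
rewrite -addrA lerD2l [enorm (row i z' - _)]enormB.
by apply: (le_trans (lerD (row_dist _ _ _) (row_dist _ _ _))); lra.
Qed.

Lemma deep_pair_compact (d : R) : 0 < d ->
  compact [set x | Omega x /\ d <= D x].
Proof.
move=> d0; have [B B0 hB] := bounded_setP bO.
apply: (mx_compact B0) => [z [Oz _]|z h]; first exact: hB.
apply: deep_point_limit => // r r0.
have r2 : 0 < r / 2 by rewrite divr_gt0.
have [z' Kz zz'] := h _ r2; exists z' => //.
by apply: (le_lt_trans (enorm_le_norm _)); lra.
Qed.

Lemma dg_deep (g : plane R * plane R -> R) (d : R) : Ck 1 (Omega `*` Omega) g -> 0 < d ->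
  exists2 C : R, 0 < C & forall x y, Omega x -> Omega y -> d <= D x -> d <= D y ->
    forall u w, `|'d g (x, y) (u, w)| <= C * (enorm u + enorm w).
Proof.
move=> [dg cg] d0; pose K := [set x | Omega x /\ d <= D x].
have cK : compact (K `*` K) by apply: compact_setX; exact: deep_pair_compact.
pose P (q : plane R * plane R) (e : R) := forall u w,
  e * `|'d g q (u, w)| <= enorm u + enorm w.
have [|r r0 H] := @compact_unif R _ _ P cK.
  move=> q [[h1 _] [h2 _]].
  pose E := [:: (delta_mx 0 0 : plane R, 0 : plane R); (delta_mx 0 1, 0);
               (0, delta_mx 0 0); (0, delta_mx 0 1)].
  have near1 e : exists M r : R, [/\ 0 < M, 0 < r & forall y, `|q - y| < r -> `|'D_e g y| <= M].
    have [r r0 h] := cont_ex (@ltr01 R) (cg e q (conj h1 h2)).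
    exists (`|'D_e g q| + 1), r; split=> // y /h yq.
    have -> : 'D_e g y = 'D_e g q - ('D_e g q - 'D_e g y) by rewrite opprB subrKC.
    by apply: (le_trans (ler_normB _ _)); rewrite lerD2l ltW.
  have [M [r [M0 r0 hM]]] : exists M r : R, [/\ 0 < M, 0 < r & forall y, `|q - y| < r ->
     forall e, e \in E -> `|'D_e g y| <= M].
    elim: E => [|e E [M [r [M0 r0 h]]]]; first by exists 1, 1; split.
    have [M' [r' [M0' r0' h']]] := near1 e.
    exists (Num.max M M'), (Num.min r r'); split; rewrite ?lt_max ?M0 ?lt_min ?r0 //.
    move=> y; rewrite lt_min => /andP[y1 y2] e'; rewrite inE => /orP[/eqP ->|e'E].
      by apply: (le_trans (h' y y2)); rewrite le_max lexx orbT.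
    by apply: (le_trans (h y y1 _ e'E)); rewrite le_max lexx.
  pose s := Num.min r (2 * M)^-1.
  have s0 : 0 < s by rewrite lt_min r0 invr_gt0 mulr_gt0.
  exists s => // y e [[Y1 _] [Y2 _]] qy /andP[e0]; rewrite lt_min => /andP[_ eM] u w.
  have {}qy : `|q - y| < r by apply: (lt_le_trans qy); rewrite ge_min lexx.
  have dy : differentiable g y by apply: dg.
  have uw : (u, w) = u 0 0 *: (delta_mx 0 0 : plane R, 0 : plane R) + u 0 1 *: (delta_mx 0 1 : plane R, 0 : plane R) +
      (w 0 0 *: (0 : plane R, delta_mx 0 0 : plane R) + w 0 1 *: (0 : plane R, delta_mx 0 1 : plane R)).
    have ex (v : plane R) : v = v 0 0 *: delta_mx 0 0 + v 0 1 *: delta_mx 0 1.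
      by apply/rowP => k; rewrite !mxE /=; case: (ord2P k) => -> /=; rewrite !mulr1 mulr0 ?addr0 ?add0r.
    rewrite -[RHS]/(u 0 0 *: delta_mx 0 0 + u 0 1 *: delta_mx 0 1 + (w 0 0 *: 0 + w 0 1 *: 0),
                    u 0 0 *: 0 + u 0 1 *: 0 + (w 0 0 *: delta_mx 0 0 + w 0 1 *: delta_mx 0 1)).
    by rewrite !scaler0 !addr0 add0r -!ex.
  have b e' (k : R) : e' \in E -> `|k * 'd g y e'| <= `|k| * M.
    by move=> eE; rewrite normrM -deriveE // ler_wpM2l // hM.
  have bb : `|'d g y (u, w)| <= 2 * M * (enorm u + enorm w).
    rewrite uw !linearD !linearZ /=.
    have c1 v k := coord_le_enorm (v : plane R) k.
    have b' (v : plane R) k e' : e' \in E -> `|v 0 k * 'd g y e'| <= enorm v * M.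
      by move=> eE; apply: (le_trans (b _ _ eE)); rewrite ler_wpM2r ?(ltW M0).
    apply: (le_trans (ler_normD _ _)).
    apply: (le_trans (lerD (ler_normD _ _) (ler_normD _ _))).
    apply: (@le_trans _ _ (enorm u * M + enorm u * M + (enorm w * M + enorm w * M))).
      by rewrite !lerD // b' // !inE eqxx ?orbT.
    by rewrite le_eqVlt; apply/orP; left; apply/eqP; ring.
  apply: (@le_trans _ _ (e * (2 * M * (enorm u + enorm w)))); first by rewrite ler_pM2l.
  rewrite mulrA; apply: ler_piMl; first by rewrite addr_ge0 ?enorm_ge0.
  by rewrite -ler_pdivlMr ?mulr_gt0 // mul1r ltW.
exists (r / 2)^-1; first by rewrite invr_gt0 divr_gt0.
move=> x y Ox Oy dx dy u w; rewrite ler_pdivlMl ?divr_gt0 //.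
by apply: H => //; apply/andP; split; lra.
Qed.

End Deep.

(** * Pairs of points near the boundary *)

Section NearBoundary.
Context {R : realType}.
Variables (Omega : set (plane R)) (eps0 : R) (p : plane R -> plane R)
  (G : plane R -> plane R -> R) (g : plane R * plane R -> R).
Hypotheses (oO : open Omega) (bO : bounded_set Omega) (O0 : Omega !=set0) (c3 : C3_boundary Omega).
Hypotheses (Hp : collar_projection Omega eps0 p) (HG : hypothesis_G Omega eps0 p G g).
Implicit Types (x y u v w q n : plane R).
Notation D z := (dist z (boundary Omega)).
Notation c := ((2 * pi)^-1 : R).

Lemma dotDl u v w : dot (u + v) w = dot u w + dot v w.
Proof. by rewrite !dotE !mxE; ring. Qed.

Lemma dotNl u w : dot (- u) w = - dot u w.
Proof. by rewrite !dotE !mxE; ring. Qed.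

Lemma dotNr u w : dot u (- w) = - dot u w.
Proof. by rewrite !dotE !mxE; ring. Qed.

(* Since dlog (q + n) n = 1 - <q + n, q> / |q + n|^2, the claim is that the last
   ratio lies in [0, 1 + 2e]. *)
Lemma dlog_range q n (e : R) : `|dot n q| <= e * dot q q -> 0 <= e <= 2^-1 ->
  q + n <> 0 -> - (2 * e) <= dlog (q + n) n <= 1.
Proof.
move=> h /andP[e0 e1] n0.
have cs : dot n q ^+ 2 <= dot n n * dot q q.
  rewrite -(real_normK (num_real _)) -!enorm_sqr -exprMn ler_sqr ?nnegrE ?mulr_ge0 ?enorm_ge0 //.
  exact: dot_le.
have d0 : 0 < dot (q + n) (q + n) by rewrite -enorm_sqr exprn_gt0 // enorm_neq0.
rewrite /dlog ler_pdivlMr // ler_pdivrMr // mul1r.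
have E : dot (q + n) (q + n) = dot q q + 2 * dot n q + dot n n by rewrite !dotE !mxE; ring.
have E2 : dot (q + n) n = dot n q + dot n n by rewrite !dotE !mxE; ring.
move: cs d0 (dot_ge0 q) (dot_ge0 n) h; rewrite E E2 ler_norml.
move: (dot q q) (dot n q) (dot n n) => A B C cs d0 A0 C0 /andP[h1 h2].
have eA : e * A <= A / 2 by rewrite mulrC ler_wpM2l.
apply/andP; split; last by lra.
have [Az|Ap] := leP A 0.
  have A0' : A = 0 by lra.
  rewrite A0' mulr0 in h1 h2; have B0 : B = 0 by lra.
  by have : 0 <= e * C by [rewrite mulr_ge0]; rewrite A0' B0; lra.
have AB : A * (1 - e) <= A + B by lra.
have AB0 : 0 <= A + B by lra.
have sq : (A + B) ^+ 2 <= A * (A + 2 * B + C) by rewrite sqrrD; lra.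
have s1 : (1 - e) * (A + B) <= A + 2 * B + C.
  rewrite -(ler_pM2l Ap); apply: le_trans sq.
  by rewrite mulrA expr2 ler_wpM2r.
suff : A + B <= (1 + 2 * e) * (A + 2 * B + C) by lra.
have e12 : 0 <= 1 + 2 * e by lra.
apply: le_trans (ler_wpM2l e12 s1); rewrite mulrA.
apply: ler_peMl => //.
have : 0 <= e * (1 - 2 * e) by apply: mulr_ge0; lra.
lra.
Qed.

Lemma enorm_orth q n (e : R) : `|dot n q| <= e * dot q q -> e <= 2^-1 ->
  enorm n <= enorm (q + n).
Proof.
move=> h e1; rewrite -ler_sqr ?nnegrE ?enorm_ge0 // !enorm_sqr.
have -> : dot (q + n) (q + n) = dot q q + 2 * dot n q + dot n n by rewrite !dotE !mxE; ring.
have eA : e * dot q q <= dot q q / 2 by rewrite mulrC ler_wpM2l ?dot_ge0.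
by move: h; rewrite ler_norml => /andP[h1 h2]; lra.
Qed.

(** Close to the boundary a normal vector is almost orthogonal to all chords from its foot, with an
    error relative to the squared chord. *)
Lemma shallow (e : R) : 0 < e -> exists2 d : R, 0 < d & forall x, Omega x -> D x < d ->
  collar Omega eps0 x /\ forall b, boundary Omega b ->
    `|dot (x - p x) (b - p x)| <= e * dot (b - p x) (b - p x).
Proof.
move=> e0; have [M [r [M0 r0 H]]] := normal_bound oO bO c3.
pose d := Num.min eps0 (Num.min r (e / M)).
exists d; first by rewrite !lt_min (collar_gt0 Hp) r0 divr_gt0.
move=> x Ox; rewrite !lt_min => /and3P[d1 d2 d3].
have cx : collar Omega eps0 x by [].
split=> // b bb; have xD : enorm (x - p x) = D x by rewrite enormB; exact: proj_dist Hp _ cx.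
apply: (le_trans (H _ b x (proj_boundary Hp cx) bb Ox _ xD)); first by rewrite xD.
rewrite -enorm_sqr ler_wpM2r ?sqr_ge0 // xD mulrC -ler_pdivlMr //; exact: ltW.
Qed.

Section Pairs.
Variables (e d C3 : R).
Hypotheses (e0 : 0 < e) (e1 : e <= 4^-1) (C30 : 0 < C3).
Hypothesis Hd : forall x, Omega x -> D x < d ->
  collar Omega eps0 x /\ forall b, boundary Omega b ->
    `|dot (x - p x) (b - p x)| <= e * dot (b - p x) (b - p x).
Hypothesis HC3 : forall x y, collar Omega eps0 x -> collar Omega eps0 y ->
  `|'d g (x, y) (x - p x, 0) + c * dlog (reflection p x - y) (x - p x)| <= C3 * D x /\
  forall w, `|'d g (x, y) (0, w) + c * dlog (reflection p x - y) w| <= C3 * enorm w.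

Lemma foot_enorm x : collar Omega eps0 x -> enorm (x - p x) = D x.
Proof. by move=> cx; rewrite enormB; exact: proj_dist Hp _ cx. Qed.

Lemma two_feet x y : Omega x -> Omega y -> D x < d -> D y < d ->
  let q := p x - p y in let u := x - p x in let w := y - p y in
  `|dot (u - w) q| <= 2 * e * dot q q /\ `|dot (- (u + w)) q| <= 2 * e * dot q q.
Proof.
move=> Ox Oy dx dy q u w.
have [cx hx] := Hd Ox dx; have [cy hy] := Hd Oy dy.
have := hx _ (proj_boundary Hp cy); have := hy _ (proj_boundary Hp cx).
rewrite -/u -/w -/q; have -> : p y - p x = - q by rewrite opprB.
rewrite !dotNr !dotNl dotBl dotDl opprK normrN => h1 h2.
have h3 : dot u q - dot w q = dot u q + - dot w q by [].
split; first by apply: (le_trans (ler_normB _ _)); lra.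
by rewrite normrN; apply: (le_trans (ler_normD _ _)); lra.
Qed.

(** With q the chord of the feet, x - y = q + n and (reflection of x) - y = q + n', where n = u - w
    and n' = - (u + w). Up to the error of psi, [dG] is c times the difference of [dlog (q + n') n']
    and [dlog (q + n) n]. Both lie in [- 4 e, 1] by [dlog_range], so the difference is at most 1 + 4
    e in absolute value. *)
Lemma pair_near x y : Omega x -> Omega y -> x <> y -> D x < d -> D y < d ->
  `|dG g x y (x - p x) (y - p y)| <= c * (1 + 4 * e) + C3 * (D x + D y) /\
  enorm ((x - p x) - (y - p y)) <= enorm (x - y).
Proof.
move=> Ox Oy xy dx dy; have [h1 h2] := two_feet Ox Oy dx dy.
have [cx hx] := Hd Ox dx; have [cy hy] := Hd Oy dy.
set q := p x - p y in h1 h2; set u := x - p x in h1 h2 *; set w := y - p y in h1 h2 *.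
have Y : x - y = q + (u - w) by rewrite /q /u /w; apply/rowP => k; rewrite !mxE; ring.
have X : reflection p x - y = q + (- (u + w)).
  by rewrite /q /u /w /reflection; apply/rowP => k; rewrite !mxE; ring.
split; last by rewrite Y; apply: enorm_orth h1 _; move: e1; lra.
have e2 : 0 <= 2 * e <= 2^-1 by apply/andP; split; move: e0 e1; lra.
have nY : q + (u - w) <> 0 by rewrite -Y; move/eqP; rewrite subr_eq0 => /eqP.
have nX : q + (- (u + w)) <> 0.
  rewrite -X; move/eqP; rewrite subr_eq0 => /eqP E; apply: (reflection_outside Hp cx); by rewrite E.
have /andP[y1 y2] := dlog_range h1 e2 nY; have /andP[x1 x2] := dlog_range h2 e2 nX.
have [g1 g2] := HC3 cx cy; have {}g2 := g2 w.
rewrite (foot_enorm cy) in g2.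
rewrite /dG dgD Y.
move: g1 g2 x1 x2; rewrite X dlogN (dlogD (q - (u + w)) u w) -/u.
move: ('d g (x, y) (u, 0)) ('d g (x, y) (0, w)) => a1 a2.
move: y1 y2; move: (dlog (q + (u - w)) (u - w)) => L1.
move: (dlog (q - (u + w)) u) (dlog (q - (u + w)) w) => L2 L3.
move: (@c_gt0 R) (D x) (D y); move: c => cc c0 Dx Dy y1 y2.
rewrite !ler_norml => /andP[g1 g2] /andP[g3 g4] x1 x2.
have k2 : cc * (L2 + L3 + L1) <= cc * (1 + 4 * e) by rewrite ler_pM2l //; lra.
have k3 : cc * - (1 + 4 * e) <= cc * (L2 + L3 + L1) by rewrite ler_pM2l //; lra.
by apply/andP; split; lra.
Qed.

(** Here the reflected point minus [x] is -2 u, and each of the two variables of [g] contributes c /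
    2. The limit c equals the bound in [pair_near], which is why boundary-admissibility compares the
    squares with the products without a factor. *)
Lemma pair_diag x : Omega x -> D x < d ->
  `|'d g (x, x) (x - p x, x - p x) - c| <= C3 * (2 * D x).
Proof.
move=> Ox dx; have [cx hx] := Hd Ox dx; have [g1 g2] := HC3 cx cx.
have {}g2 := g2 (x - p x); rewrite (foot_enorm cx) in g2.
rewrite dgD; set u := x - p x in g1 g2 *.
have X : reflection p x - x = -2 *: u.
  by rewrite /u /reflection; apply/rowP => k; rewrite !mxE; ring.
have u0 : 0 < dot u u.
  by rewrite -enorm_sqr exprn_gt0 // /u foot_enorm // (dist_gt0 oO bO O0).
have L : dlog (-2 *: u) u = - 2^-1.
  rewrite /dlog dotZl; have -> : dot (-2 *: u) (-2 *: u) = 4 * dot u u by rewrite !dotE !mxE; ring.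
  by move: (dot u u) u0 => A A0; have : A != 0 by [rewrite gt_eqF]; move=> ?; field.
move: g1 g2; rewrite X L.
move: ('d g (x, x) (u, 0)) ('d g (x, x) (0, u)) => a1 a2; move: c => cc.
rewrite !ler_norml => /andP[g1 g2] /andP[g3 g4].
by apply/andP; split; lra.
Qed.

(** The point [x] moves by at most [rho * eta], whereas [y] is at least [eta / 2] away from it, and
    so are the reflected points involved; hence all logarithmic terms are of order [rho]. If [y] is
    not near the boundary, the estimate away from the diagonal is used instead. *)
Lemma pair_separate (C2 rho eta : R) x y :
  (forall x y, Omega x -> Omega y -> d / 2 <= enorm (x - y) ->
    forall u w, `|dG g x y u w| <= C2 * (enorm u + enorm w)) -> 0 <= C2 ->
  0 < rho <= 2^-1 -> 0 < eta -> eta <= d -> eta <= 1 ->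
  Omega x -> Omega y -> D x <= rho * eta -> eta < D y ->
  [/\ `|dG g x y (x - p x) 0| <= (4 * c + C3 + C2) * rho,
      `|dG g y x 0 (x - p x)| <= (4 * c + C3 + C2) * rho &
      enorm (x - p x) <= enorm (x - y)].
Proof.
move=> HC2 C20 /andP[r0 r1] h0 hd h1 Ox Oy Dx Dy.
have re : rho * eta <= eta / 2 by rewrite mulrC ler_pM2l.
have rr : rho * eta <= rho by rewrite ger_pMr.
have dx : D x < d by lra.
have [cx hx] := Hd Ox dx; have uD := foot_enorm cx; set u := x - p x in hx uD *.
have xy : D y - D x <= enorm (x - y).
  by rewrite enormB; have := dist_lip oO bO O0 y x; lra.
have c0 := @c_gt0 R.
have small r : eta / 2 <= r -> enorm u / r <= 2 * rho.
  move=> hr; have r00 : 0 < r by lra.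
  rewrite ler_pdivrMr // uD; apply: (le_trans Dx).
  have : 2 * rho * (eta / 2) <= 2 * rho * r by rewrite ler_pM2l // mulr_gt0.
  lra.
have dl X : eta / 2 <= enorm X -> `|dlog X u| <= 2 * rho.
  by move=> hX; apply: (le_trans (dlog_le _ _ hX)); rewrite ?divr_gt0 //; exact: small.
have hxy : eta / 2 <= enorm (x - y) by lra.
have n1 := dl _ hxy; have n2 : `|dlog (y - x) u| <= 2 * rho by apply: dl; rewrite enormB.
have uxy : enorm u <= enorm (x - y) by rewrite uD; lra.
have C2r : 0 <= C2 * rho by rewrite mulr_ge0 // ltW.
have cr : 0 <= c * rho by rewrite mulr_ge0 // ltW.
have C3r : 0 <= C3 * rho by rewrite mulr_ge0 // ltW.
have C3D : C3 * D x <= C3 * rho by rewrite ler_pM2l //; lra.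
have [dy|dy] := ltP (D y) d; last first.
  have far : d / 2 <= enorm (x - y) by lra.
  have C2u : C2 * (enorm u) <= C2 * rho by rewrite ler_wpM2l // uD; lra.
  split=> //.
    by apply: (le_trans (HC2 x y Ox Oy far u 0)); rewrite enorm0 addr0; lra.
  rewrite enormB in far.
  by apply: (le_trans (HC2 y x Oy Ox far 0 u)); rewrite enorm0 add0r; lra.
have [cy hy] := Hd Oy dy.
have [g1 _] := HC3 cx cy; have [_ /(_ u) g2] := HC3 cy cx.
have n3 : `|dlog (reflection p x - y) u| <= 2 * rho.
  apply: dl; rewrite enormB.
  by have := dist_le_out oO Oy (reflection_outside Hp cx); lra.
have n4 : `|dlog (reflection p y - x) u| <= 2 * rho.
  apply: dl; set w := y - p y in hy.
  have k1 : enorm (- w) <= enorm ((p y - p x) + (- w)).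
    apply: (@enorm_orth _ _ e); last by move: e1; lra.
    have := hy _ (proj_boundary Hp cx); have -> : p x - p y = - (p y - p x) by rewrite opprB.
    by rewrite !dotNr !dotNl opprK.
  have k2 : p y - p x - w = (reflection p y - x) + u.
    by rewrite /w /u /reflection; apply/rowP => k; rewrite !mxE; ring.
  have k3 := enormD (reflection p y - x) u.
  rewrite -k2 in k3; rewrite enormN /w foot_enorm // in k1.
  by rewrite uD in k3; rewrite -/w in k1; lra.
rewrite -/u in g1; rewrite uD in g2.
have cl L : `|L| <= 2 * rho -> `|c * L| <= c * (2 * rho).
  by move=> hL; rewrite normrM (gtr0_norm c0) ler_pM2l.
move: (cl _ n1) (cl _ n2) (cl _ n3) (cl _ n4) => {}n1 {}n2 {}n3 {}n4.
split=> //; rewrite /dG ?subr0 ?sub0r ?dlogN.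
  rewrite (_ : 'd g (x, y) (u, 0) - c * dlog (x - y) u =
    ('d g (x, y) (u, 0) + c * dlog (reflection p x - y) u) - c * dlog (reflection p x - y) u - c * dlog (x - y) u); last by rewrite addrK.
  apply: (le_trans (ler_normB _ _)); apply: (le_trans (lerD (ler_normB _ _) (lexx _))).
  lra.
rewrite (_ : 'd g (y, x) (0, u) - c * - dlog (y - x) u =
    ('d g (y, x) (0, u) + c * dlog (reflection p y - x) u) - c * dlog (reflection p y - x) u + c * dlog (y - x) u); last by rewrite addrK mulrN opprK.
apply: (le_trans (ler_normD _ _)); apply: (le_trans (lerD (ler_normB _ _) (lexx _))).
lra.
Qed.

End Pairs.

End NearBoundary.

(** * The slope near the boundary of the configuration space *)

Section Slope.
Context {R : realType}.
Variables (Omega : set (plane R)) (eps0 : R) (p : plane R -> plane R)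
  (G : plane R -> plane R -> R) (g : plane R * plane R -> R) (N : nat) (Gamma : 'rV[R]_N).
Hypotheses (oO : open Omega) (bO : bounded_set Omega) (O0 : Omega !=set0) (c3 : C3_boundary Omega).
Hypotheses (Hp : collar_projection Omega eps0 p) (HG : hypothesis_G Omega eps0 p G g).
Hypotheses (gb : boundary_admissible Gamma) (gd : Delta_admissible Gamma)
  (gn : forall i, Gamma 0 i != 0).
Notation D z := (dist z (boundary Omega)).
Notation c := ((2 * pi)^-1 : R).
Implicit Types (z v : 'M[R]_(N, 2)).

(* The two bounds on [v] make the flow along such directions stay in the
   configuration space forever. *)
Definition steep (A : R) z v : Prop :=
  [/\ 1 <= dKR g Gamma z v, forall i, enorm (row i v) <= A * D (row i z) &
      forall i j, enorm (row i v - row j v) <= A * enorm (row i z - row j z)].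

Lemma dKRZ z v (k : R) : config Omega z -> dKR g Gamma z (k *: v) = k * dKR g Gamma z v.
Proof.
move=> cz; have [_ E] := is_diff_KR Gamma oO (g_continuation HG) (g_C1 HG) cz.
by rewrite -E linearZ.
Qed.

Lemma steepZ (A k : R) z v : config Omega z -> 0 < k -> k <= dKR g Gamma z v ->
  (forall i, enorm (row i v) <= A * D (row i z)) ->
  (forall i j, enorm (row i v - row j v) <= A * enorm (row i z - row j z)) ->
  steep (A / k) z (k^-1 *: v).
Proof.
move=> cz k0 kd h1 h2; have ki : 0 < k^-1 by rewrite invr_gt0.
have rZ i : row i (k^-1 *: v) = k^-1 *: row i v by apply/rowP => l; rewrite !mxE.
split=> [|i|i j].
- by rewrite dKRZ // ler_pdivlMl ?mulr1.
- by rewrite rZ enormZ gtr0_norm // mulrAC [leRHS]mulrC ler_pM2l.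
- by rewrite !rZ -scalerBr enormZ gtr0_norm // mulrAC [leRHS]mulrC ler_pM2l.
Qed.

Lemma weight_le (gam b beta K : R) : `|b - beta| <= K ->
  gam * beta <= gam * b + K * `|gam|.
Proof.
move=> h; have : `|gam * (b - beta)| <= K * `|gam| by rewrite normrM mulrC ler_wpM2r.
by rewrite ler_norml => /andP[+ _]; lra.
Qed.

Lemma sq_le (gam b beta K : R) : `|b - beta| <= K ->
  gam ^+ 2 * beta <= gam ^+ 2 * b + K * gam ^+ 2.
Proof. by move=> /(weight_le (gam ^+ 2)); rewrite (ger0_norm (sqr_ge0 _)). Qed.

Lemma dG00 x y : dG g x y 0 0 = 0.
Proof.
rewrite /dG subrr /dlog; have -> : dot (x - y) 0 = 0 by rewrite dotE !mxE !mulr0 addr0.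
by rewrite mul0r mulr0 subr0 -[(0, 0)]/(0 : plane R * plane R) linear0.
Qed.

Definition total_weight : R :=
  \sum_j Gamma 0 j ^+ 2 + \sum_i \sum_(j | j != i) `|Gamma 0 i * Gamma 0 j|.
Notation S := total_weight.

Lemma total_weight_ge0 : 0 <= S.
Proof.
apply: addr_ge0; first by apply: sumr_ge0 => i _; exact: sqr_ge0.
by apply: sumr_ge0 => i _; apply: sumr_ge0 => j _.
Qed.

Lemma error_size (mu : R) : 0 < mu -> exists2 K : R, 0 < K & K * S <= mu / 2.
Proof.
move=> mu0; have S0 := total_weight_ge0; exists (mu / 2 / (S + 1)).
  by rewrite divr_gt0 ?divr_gt0 //; lra.
rewrite mulrAC ler_pdivrMr; last by lra.
by rewrite ler_wpM2l; lra.
Qed.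

(** For singletons this is the nonvanishing of the strengths; admissibility covers larger sets. *)
Lemma boundary_margin (C : {set 'I_N}) : (0 < #|C|)%N ->
  0 < \sum_(i in C) Gamma 0 i ^+ 2 -
      \sum_(i in C) \sum_(j in C | j != i) `|Gamma 0 i * Gamma 0 j|.
Proof.
move=> C0; have [C2|C1] := leqP 2 #|C|; first by rewrite subr_gt0; exact: gb.
have /cards1P[i ->] : #|C| == 1%N by rewrite eqn_leq -ltnS C1.
rewrite !big_set1 [X in _ - X]big1 ?subr0 ?exprn_even_gt0 //= => j.
by rewrite inE => /andP[/eqP ->]; rewrite eqxx.
Qed.

(** The cluster [C] comes from [scale_gap], so all other points are farther from the boundary by a
    factor [1 / rho]. Each term of dH is at least its ideal value (c Gamma_i^2 on the diagonal and -
    c |Gamma_i Gamma_j| inside [C], 0 otherwise) minus [K] times its weight, and [K * total_weight]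
    is at most half of the margin [c * mu]. *)
Lemma slope_boundary : exists d A : R, [/\ 0 < d, 0 < A &
  forall z i0, config Omega z -> D (row i0 z) <= d -> exists v, steep A z v].
Proof.
have [mu mu0 Hmu] := finite_pos boundary_margin.
have c0 := @c_gt0 R; have cm0 : 0 < c * mu by rewrite mulr_gt0.
have [K K0 KS] := error_size cm0.
(* [e] controls the excess [c * (4 * e)] in [pair_near], and [rho] below controls all errors that
   are linear in the scale. *)
pose e := Num.min 4^-1 (K / (8 * c)).
have e0 : 0 < e by rewrite lt_min invr_gt0 ltr0n divr_gt0 ?mulr_gt0.
have e1 : e <= 4^-1 by rewrite ge_min lexx.
have eK : c * (4 * e) <= K / 2.
  have : e <= K / (8 * c) by rewrite ge_min lexx orbT.
  by rewrite ler_pdivlMr ?mulr_gt0 //; lra.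
have [d d0 Hd] := shallow oO bO c3 Hp e0.
have [C3 C30 HC3] := psi_estimate oO bO O0 Hp HG.
have d20 : 0 < d / 2 by rewrite divr_gt0.
have [C2 C20 HC2] := dG_far oO HG d20.
pose B := 4 * c + C3 + C2; have B0 : 0 < B by rewrite !addr_gt0 ?mulr_gt0.
pose rho := Num.min 2^-1 (K / (4 * C3 + B)).
have den0 : 0 < 4 * C3 + B by rewrite addr_gt0 ?mulr_gt0.
have r0 : 0 < rho by rewrite lt_min invr_gt0 ltr0n divr_gt0.
have r1 : rho <= 2^-1 by rewrite ge_min lexx.
have rK : rho * (4 * C3 + B) <= K.
  have : rho <= K / (4 * C3 + B) by rewrite ge_min lexx orbT.
  by rewrite ler_pdivlMr.
have rC3 : 0 < rho * C3 by rewrite mulr_gt0.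
have rB : 0 < rho * B by rewrite mulr_gt0.
have rho01 : 0 < rho < 1 by rewrite r0 /=; lra.
have rho02 : 0 < rho <= 2^-1 by rewrite r0.
pose d1 := Num.min d 1; have d10 : 0 < d1 by rewrite lt_min d0 ltr01.
exists (rho ^+ N * d1), (c * mu / 2)^-1.
split; rewrite ?invr_gt0 ?divr_gt0 ?mulr_gt0 ?exprn_gt0 //.
move=> z i0 cz zi0; have [zO zd] := cz.
have [eta [eta1 eta2 gap]] := scale_gap (f := fun i => D (row i z)) d10 rho01 zi0.
have eta0 : 0 < eta by apply: lt_le_trans eta1; rewrite mulr_gt0 ?exprn_gt0.
have etad : eta <= d by apply: (le_trans eta2); rewrite ge_min lexx.
have eta_1 : eta <= 1 by apply: (le_trans eta2); rewrite ge_min lexx orbT.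
have re : rho * eta <= rho by rewrite ger_pMr.
have re2 : rho * eta <= eta / 2 by rewrite mulrC ler_pM2l.
pose C : {set 'I_N} := finset (fun i => D (row i z) <= rho * eta).
have inC i : i \in C -> D (row i z) <= rho * eta by rewrite finset.in_set.
have notC i : i \notin C -> eta < D (row i z).
  by rewrite finset.in_set => nC; case: (gap i) => // h; rewrite h in nC.
have i0C : i0 \in C.
  rewrite finset.in_set; case: (gap i0) => // h.
  by have := le_lt_trans (le_trans zi0 eta1) h; rewrite ltxx.
have Cd i : i \in C -> D (row i z) < d by move=> /inC h; lra.
pose v0 : 'M[R]_(N, 2) := \matrix_(i < N) (if i \in C then row i z - p (row i z) else 0).
have v0E i : row i v0 = if i \in C then row i z - p (row i z) else 0 by rewrite rowK.
have sep := pair_separate oO bO O0 Hp e1 C30 Hd HC3 HC2 (ltW C20) rho02 eta0 etad eta_1.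
have nr := pair_near Hp e0 e1 Hd HC3.
exists ((c * mu / 2)^-1 *: v0); rewrite -[X in steep X]mul1r; apply: steepZ => //.
- by rewrite divr_gt0.
- have := @KR_sum_bound R N (fun j => Gamma 0 j) K
    (fun j => if j \in C then c * Gamma 0 j ^+ 2 else 0)
    (fun j => 'd g (row j z, row j z) (row j v0, row j v0))
    (fun i j => if (i \in C) && (j \in C) then - c * `|Gamma 0 i * Gamma 0 j| else 0)
    (fun i j => dG g (row i z) (row j z) (row i v0) (row j v0)).
  rewrite -/(dKR g Gamma z v0) -/total_weight => h.
  have {}h := h _ _; apply: le_trans (_ : c * mu - K * S <= _); first by lra.
  rewrite lerBlDr; apply: le_trans (h _ _).
  + have -> : \sum_i \sum_(j | j != i) (if (i \in C) && (j \in C) then - c * `|Gamma 0 i * Gamma 0 j| else 0)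
       = - (c * \sum_(i in C) \sum_(j in C | j != i) `|Gamma 0 i * Gamma 0 j|).
      rewrite mulr_sumr -sumrN [RHS]big_mkcond /=; apply: eq_bigr => i _.
      have [iC|iC] := boolP (i \in C); last by rewrite big1.
      rewrite mulr_sumr -sumrN big_mkcondl /= big_mkcond [RHS]big_mkcond /=.
      by apply: eq_bigr => j _; case: (j \in C); case: (j != i); rewrite ?mulNr.
    rewrite -big_mkcond /= -mulr_sumr -mulrBr ler_pM2l //; apply: Hmu.
    by apply/card_gt0P; exists i0.
  + move=> j; rewrite !v0E; case: ifP => jC.
      rewrite mulrC; apply: sq_le; apply: (le_trans (pair_diag oO bO O0 Hp Hd HC3 (zO j) (Cd j jC))).
      have : C3 * (2 * D (row j z)) <= C3 * (2 * rho) by rewrite !ler_pM2l //; have := inC j jC; lra.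
      lra.
    rewrite -[(0, 0)]/(0 : plane R * plane R) linear0 mulr0 add0r mulr_ge0 ?sqr_ge0 //; exact: ltW.
  + move=> i j ji; rewrite !v0E.
    have ij : row i z <> row j z by apply: zd => E; rewrite E eqxx in ji.
    have far b : `|b| <= B * rho -> 0 <= Gamma 0 i * Gamma 0 j * b + K * `|Gamma 0 i * Gamma 0 j|.
      move=> hb; rewrite -[leLHS](mulr0 (Gamma 0 i * Gamma 0 j)); apply: weight_le; rewrite subr0.
      by apply: (le_trans hb); lra.
    have [iC|iC] := boolP (i \in C); have [jC|jC] := boolP (j \in C) => /=.
    * have [b1 _] := nr _ _ (zO i) (zO j) ij (Cd i iC) (Cd j jC).
      move: b1; set b := dG _ _ _ _ _ => b1.
      have bK : `|b| <= c + K.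
        apply: (le_trans b1); have := inC i iC; have := inC j jC => q1 q2.
        have : C3 * (D (row i z) + D (row j z)) <= C3 * (2 * rho) by rewrite ler_pM2l //; lra.
        lra.
      have : `|Gamma 0 i * Gamma 0 j * b| <= `|Gamma 0 i * Gamma 0 j| * (c + K).
        by rewrite normrM ler_wpM2l.
      by rewrite ler_norml => /andP[+ _]; lra.
    * by apply: far; case: (sep _ _ (zO i) (zO j) (inC i iC) (notC j jC)).
    * by apply: far; case: (sep _ _ (zO j) (zO i) (inC j jC) (notC i iC)).
    * by rewrite dG00 mulr0 add0r mulr_ge0 // ltW.
- move=> i; rewrite v0E mul1r; case: ifP => iC.
    by have [cx _] := Hd _ (zO i) (Cd i iC); rewrite (foot_enorm Hp cx).
  by rewrite enorm0; exact: ltW (dist_gt0 oO bO O0 (zO i)).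
- move=> i j; rewrite !v0E mul1r.
  have [->|ij] := eqVneq i j; first by rewrite !subrr.
  have nij : row i z <> row j z by apply: zd; apply/eqP.
  have [iC|iC] := boolP (i \in C); have [jC|jC] := boolP (j \in C) => /=.
  + by case: (nr _ _ (zO i) (zO j) nij (Cd i iC) (Cd j jC)).
  + by rewrite subr0; case: (sep _ _ (zO i) (zO j) (inC i iC) (notC j jC)).
  + by rewrite sub0r enormN [leRHS]enormB; case: (sep _ _ (zO j) (zO i) (inC j jC) (notC i iC)).
  + by rewrite subr0 enorm0 enorm_ge0.
Qed.

End Slope.

(** * The slope at collisions and in the interior *)

Section SlopeInside.
Context {R : realType}.
Variables (Omega : set (plane R)) (eps0 : R) (p : plane R -> plane R)
  (G : plane R -> plane R -> R) (g : plane R * plane R -> R) (N : nat) (Gamma : 'rV[R]_N).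
Hypotheses (oO : open Omega) (bO : bounded_set Omega) (O0 : Omega !=set0) (c3 : C3_boundary Omega).
Hypotheses (Hp : collar_projection Omega eps0 p) (HG : hypothesis_G Omega eps0 p G g).
Hypotheses (gb : boundary_admissible Gamma) (gd : Delta_admissible Gamma)
  (gn : forall i, Gamma 0 i != 0).
Notation D z := (dist z (boundary Omega)).
Notation c := ((2 * pi)^-1 : R).
Notation S := (total_weight Gamma).
Implicit Types (z v : 'M[R]_(N, 2)).

(** The cluster [C] around the i0-th point is dilated about that point. For a pair in [C] the
    singular term is then exactly [- c * sg]; for a pair with one point in [C] it is of order [rho]
    by the gap of scales, and the regular part is small because the cluster is. *)
Lemma slope_collision (d : R) : 0 < d -> exists s A : R, [/\ 0 < s, 0 < A &
  forall z i0 i1, config Omega z -> (forall i, d <= D (row i z)) -> i0 != i1 ->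
    enorm (row i1 z - row i0 z) <= s -> exists v, steep Omega g Gamma A z v].
Proof.
move=> d0; have [mu mu0 Hmu] : exists2 mu : R, 0 < mu & forall C : {set 'I_N}, (2 <= #|C|)%N ->
    mu <= `|\sum_(i in C) \sum_(j in C | j != i) Gamma 0 i * Gamma 0 j|.
  apply: (finite_pos (P := fun C : {set 'I_N} => (2 <= #|C|)%N)
    (f := fun C : {set 'I_N} => `|\sum_(i in C) \sum_(j in C | j != i) Gamma 0 i * Gamma 0 j|)) => C C2.
  by rewrite normr_gt0; exact: gd.
have c0 := @c_gt0 R; have cm0 : 0 < c * mu by rewrite mulr_gt0.
have [K K0 KS] := error_size Gamma cm0.
have [C4 C40 HC4] := dg_deep oO bO O0 (g_C1 HG) d0.
have den0 : 0 < 2 * C4 + 2 * c by rewrite addr_gt0 ?mulr_gt0.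
pose rho := Num.min 2^-1 (K / (2 * C4 + 2 * c)).
have r0 : 0 < rho by rewrite lt_min invr_gt0 ltr0n divr_gt0.
have r1 : rho <= 2^-1 by rewrite ge_min lexx.
have rK : rho * (2 * C4 + 2 * c) <= K.
  have : rho <= K / (2 * C4 + 2 * c) by rewrite ge_min lexx orbT.
  by rewrite ler_pdivlMr.
have rC4 : 0 < rho * C4 by rewrite mulr_gt0.
have rc : 0 < rho * c by rewrite mulr_gt0.
have rho01 : 0 < rho < 1 by rewrite r0 /=; lra.
pose d1 := Num.min d 1; have d10 : 0 < d1 by rewrite lt_min d0 ltr01.
exists (rho ^+ N * d1), (c * mu / 2)^-1.
split; rewrite ?invr_gt0 ?divr_gt0 ?mulr_gt0 ?exprn_gt0 //.
move=> z i0 i1 cz zd i01 zi; have [zO zn] := cz.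
have [eta [eta1 eta2 gap]] := scale_gap (f := fun j => enorm (row j z - row i0 z)) d10 rho01 zi.
have eta0 : 0 < eta by apply: lt_le_trans eta1; rewrite mulr_gt0 ?exprn_gt0.
have etad : eta <= d by apply: (le_trans eta2); rewrite ge_min lexx.
have eta_1 : eta <= 1 by apply: (le_trans eta2); rewrite ge_min lexx orbT.
have re : rho * eta <= rho by rewrite ger_pMr.
have re0 : 0 < rho * eta by rewrite mulr_gt0.
have re2 : rho * eta <= eta / 2 by rewrite mulrC ler_pM2l.
pose C : {set 'I_N} := finset (fun j => enorm (row j z - row i0 z) <= rho * eta).
have inC j : j \in C -> enorm (row j z - row i0 z) <= rho * eta by rewrite finset.in_set.
have notC j : j \notin C -> eta < enorm (row j z - row i0 z).
  by rewrite finset.in_set => nC; case: (gap j) => // h; rewrite h in nC.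
have i0C : i0 \in C by rewrite finset.in_set subrr enorm0 ltW.
have i1C : i1 \in C.
  rewrite finset.in_set; case: (gap i1) => // h.
  by have := le_lt_trans (le_trans zi eta1) h; rewrite ltxx.
have C2 : (2 <= #|C|)%N by apply/card_gt1P; exists i0, i1.
have far i j : i \in C -> j \notin C -> eta / 2 <= enorm (row i z - row j z).
  move=> /inC h1 /notC h2; have := enorm_tri (row j z) (row i z) (row i0 z).
  by rewrite [enorm (row j z - row i z)]enormB; lra.
pose T := \sum_(i in C) \sum_(j in C | j != i) Gamma 0 i * Gamma 0 j.
(* Dilation or contraction, whichever raises H; Delta-admissibility keeps [T] away from 0. *)
have [sg [sg1 sgT]] : exists sg : R, `|sg| = 1 /\ - sg * T = `|T|.
  have [T0|T0] := lerP 0 T.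
    by exists (-1); split; [rewrite normrN1|rewrite opprK mul1r ger0_norm].
  by exists 1; split; [rewrite normr1|rewrite mulN1r ltr0_norm].
pose v0 : 'M[R]_(N, 2) := \matrix_(i < N) (if i \in C then sg *: (row i z - row i0 z) else 0).
have v0E i : row i v0 = if i \in C then sg *: (row i z - row i0 z) else 0 by rewrite rowK.
have v0n i : enorm (row i v0) <= rho * eta.
  rewrite v0E; case: ifP => [/inC h|_]; last by rewrite enorm0 ltW.
  by rewrite enormZ sg1 mul1r.
exists ((c * mu / 2)^-1 *: v0); rewrite -[X in steep _ _ _ X]mul1r; apply: (steepZ oO HG) => //.
- by rewrite divr_gt0.
- have := @KR_sum_bound R N (fun j => Gamma 0 j) K (fun j => Gamma 0 j ^+ 2 * 0)
    (fun j => 'd g (row j z, row j z) (row j v0, row j v0))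
    (fun i j => Gamma 0 i * Gamma 0 j * (if (i \in C) && (j \in C) then - c * sg else 0))
    (fun i j => dG g (row i z) (row j z) (row i v0) (row j v0)).
  rewrite -/(dKR g Gamma z v0) -/(total_weight Gamma) => h.
  apply: le_trans (_ : c * mu - K * S <= _); first by lra.
  have gK i j : `|'d g (row i z, row j z) (row i v0, row j v0)| <= 2 * C4 * rho.
    apply: (le_trans (HC4 _ _ (zO i) (zO j) (zd i) (zd j) _ _)).
    have : C4 * (enorm (row i v0) + enorm (row j v0)) <= C4 * (2 * rho).
      by rewrite ler_pM2l //; have := v0n i; have := v0n j; lra.
    lra.
  rewrite lerBlDr; apply: le_trans (h _ _).
  + have -> : \sum_j Gamma 0 j ^+ 2 * 0 = 0 by rewrite big1 // => j _; rewrite mulr0.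
    have -> : \sum_i \sum_(j | j != i) Gamma 0 i * Gamma 0 j * (if (i \in C) && (j \in C) then - c * sg else 0)
       = c * (- sg * T).
      rewrite mulrA mulr_sumr [RHS]big_mkcond /=; apply: eq_bigr => i _.
      have [iC|iC] := boolP (i \in C); last by rewrite big1 // => j _; rewrite mulr0.
      rewrite mulr_sumr big_mkcondl /= big_mkcond [RHS]big_mkcond /=.
      apply: eq_bigr => j _; case: (j \in C); case: (j != i); rewrite ?mulr0 //; ring.
    by rewrite add0r sgT ler_pM2l //; exact: Hmu.
  + move=> j; apply: sq_le; rewrite subr0; apply: (le_trans (gK j j)); lra.
  + move=> i j ji; apply: weight_le; rewrite /dG.
    have ij : row i z - row j z <> 0.
      by move/eqP; rewrite subr_eq0 => /eqP; apply: zn => E; rewrite E eqxx in ji.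
    have one k l : k \in C -> l \notin C -> `|dlog (row k z - row l z) (row k v0)| <= 2 * rho.
      move=> kC lC; have e20 : 0 < eta / 2 by rewrite divr_gt0.
      apply: (le_trans (dlog_le _ e20 (far k l kC lC))).
      by rewrite ler_pdivrMr //; have := v0n k; lra.
    have cl L : `|L| <= 2 * rho -> `|c * L| <= c * (2 * rho).
      by move=> hL; rewrite normrM (gtr0_norm c0) ler_pM2l.
    have [iC|iC] := boolP (i \in C); have [jC|jC] := boolP (j \in C) => /=.
    * have -> : dlog (row i z - row j z) (row i v0 - row j v0) = sg.
        rewrite !v0E iC jC -scalerBr opprB addrA subrK /dlog.
        have -> : dot (row i z - row j z) (sg *: (row i z - row j z)) =
          sg * dot (row i z - row j z) (row i z - row j z) by rewrite dotC dotZl.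
        by rewrite mulfK // -enorm_sqr sqrf_eq0 gt_eqF // enorm_neq0.
      rewrite mulNr opprK subrK; apply: (le_trans (gK i j)); lra.
    * rewrite subr0 [row j v0]v0E (negbTE jC) subr0.
      have := gK i j; rewrite [row j v0]v0E (negbTE jC) => g1.
      apply: (le_trans (ler_normB _ _)); apply: (le_trans (lerD g1 (cl _ (one i j iC jC)))); lra.
    * rewrite subr0 [row i v0]v0E (negbTE iC) sub0r dlogN.
      have := gK i j; rewrite [row i v0]v0E (negbTE iC) => g1.
      have E : dlog (row i z - row j z) (row j v0) = - dlog (row j z - row i z) (row j v0).
        rewrite -[row i z - row j z]opprB /dlog dotNl dotNl dotNr opprK mulNr; congr (- _).
      rewrite E opprK.
      apply: (le_trans (ler_normB _ _)); apply: (le_trans (lerD g1 (cl _ (one j i jC iC)))); lra.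
    * rewrite -/(dG g (row i z) (row j z) (row i v0) (row j v0)) !v0E (negbTE iC) (negbTE jC).
      by rewrite dG00 subr0 normr0 ltW.
- move=> i; rewrite mul1r; apply: (le_trans (v0n i)); apply: le_trans (zd i); lra.
- move=> i j; rewrite !v0E mul1r.
  have [iC|iC] := boolP (i \in C); have [jC|jC] := boolP (j \in C) => /=.
  + by rewrite -scalerBr opprB addrA subrK enormZ sg1 mul1r.
  + by rewrite subr0 enormZ sg1 mul1r; have := inC i iC; have := far i j iC jC; lra.
  + rewrite sub0r enormN enormZ sg1 mul1r [leRHS]enormB.
    by have := inC j jC; have := far j i jC iC; lra.
  + by rewrite subr0 enorm0 enorm_ge0.
Qed.

(** At a noncritical configuration some direction has derivative 2. It keeps derivative at least 1
    nearby, and the two bounds hold with [A = e^-1] for small [e], as all distances are at least [d]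
    or [s]. Compactness makes [A] uniform. *)
Lemma slope_inner (d s : R) : 0 < d -> 0 < s ->
  (forall z, config Omega z -> ~ critical_point (KirchhoffRouth Gamma G g) z) ->
  exists2 A : R, 0 < A & forall z, config Omega z -> deep Omega d s z -> exists v, steep Omega g Gamma A z v.
Proof.
move=> d0 s0 nc.
have cf z : deep Omega d s z -> config Omega z.
  move=> [h1 h2]; split=> [i|i j ij E]; first by case: (h1 i).
  by have := h2 i j ij; rewrite E subrr enorm0 leNgt s0.
pose P z (e : R) := exists v, steep Omega g Gamma e^-1 z v.
have [|r r0 H] := @compact_unif R _ (deep Omega d s) P (@deep_compact R Omega oO bO O0 N d s d0).
  move=> z dz; have cz := cf z dz.
  have [dd dE] := is_diff_KR Gamma oO (g_continuation HG) (g_C1 HG) cz.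
  have [v nv] : exists v, dKR g Gamma z v != 0.
    apply: contrapT => nv; apply: (nc z cz); split=> // v; rewrite dE.
    by apply/eqP; apply: contrapT => h; apply: nv; exists v; apply/negP.
  pose w := (2 / dKR g Gamma z v) *: v.
  have w2 : dKR g Gamma z w = 2 by rewrite /w (dKRZ Gamma oO HG) // divfK.
  have [r1 r10 h1] := cont_ex (@ltr01 R) (@dKR_continuous _ _ _ _ Gamma oO (g_C1 HG) w z cz).
  have M0 : 0 < 4 * `|w| + 1 by have := normr_ge0 w; lra.
  pose r := Num.min r1 (Num.min d s / (4 * `|w| + 1)).
  have ds0 : 0 < Num.min d s by rewrite lt_min d0.
  have rr0 : 0 < r by rewrite lt_min r10 divr_gt0.
  exists r => // y e dy zy /andP[e0]; rewrite lt_min => /andP[_].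
  rewrite ltr_pdivlMr // => eM.
  have {}zy : `|z - y| < r1 by apply: (lt_le_trans zy); rewrite ge_min lexx.
  have wn i : enorm (row i w) <= 2 * `|w|.
    apply: (le_trans (enorm_le_norm _)); rewrite ler_pM2l //.
    by apply: mx_norm_le => // k l; rewrite mxE; exact: entry_le.
  have ew : e * `|w| >= 0 by rewrite mulr_ge0 // ltW.
  have md : Num.min d s <= d by rewrite ge_min lexx.
  have ms : Num.min d s <= s by rewrite ge_min lexx orbT.
  have [y1 y2] := dy; exists w; split.
  - have := h1 y zy; rewrite w2 ltr_norml => /andP[_]; lra.
  - move=> i; rewrite ler_pdivlMl //; have [_ yi] := y1 i.
    have : e * enorm (row i w) <= e * (2 * `|w|) by rewrite ler_pM2l.
    lra.
  - move=> i j; rewrite ler_pdivlMl //.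
    have [->|ij] := eqVneq i j; first by rewrite !subrr enorm0 mulr0.
    have yij := y2 i j (elimN eqP ij).
    have h : enorm (row i w - row j w) <= 4 * `|w|.
      apply: (le_trans (enormD _ _)); rewrite enormN.
      by apply: (le_trans (lerD (wn i) (wn j))); lra.
    have : e * enorm (row i w - row j w) <= e * (4 * `|w|) by rewrite ler_pM2l.
    lra.
exists (r / 2)^-1; first by rewrite invr_gt0 divr_gt0.
by move=> z cz dz; apply: H => //; apply/andP; split; lra.
Qed.

Lemma steep_mono (A A' : R) z v : A <= A' -> config Omega z -> steep Omega g Gamma A z v -> steep Omega g Gamma A' z v.
Proof.
move=> AA [zO _] [h1 h2 h3]; split=> // [i|i j].
  by apply: (le_trans (h2 i)); rewrite ler_wpM2r // ltW // (dist_gt0 oO bO O0 (zO i)).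
by apply: (le_trans (h3 i j)); rewrite ler_wpM2r // enorm_ge0.
Qed.

(** The order matters: [d] comes from the boundary estimate, [s] from the collision estimate at
    depth [d], and what remains is the compact set [deep Omega d s]. *)
Lemma slope : (forall z, config Omega z -> ~ critical_point (KirchhoffRouth Gamma G g) z) ->
  exists2 A : R, 0 < A & forall z, config Omega z -> exists v, steep Omega g Gamma A z v.
Proof.
move=> nc; have [d [A1 [d0 A10 H1]]] := slope_boundary oO bO O0 c3 Hp HG gb gn.
have [s [A2 [s0 A20 H2]]] := slope_collision d0.
have [A3 A30 H3] := slope_inner d0 s0 nc.
pose A := Num.max A1 (Num.max A2 A3).
exists A; first by rewrite lt_max A10.
have a1 : A1 <= A by rewrite le_max lexx.
have a2 : A2 <= A by rewrite !le_max lexx orbT.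
have a3 : A3 <= A by rewrite !le_max lexx !orbT.
move=> z cz; have [[i0 h]|n1] := pselect (exists i0, D (row i0 z) <= d).
  by have [v sv] := H1 z i0 cz h; exists v; exact: steep_mono sv.
have far i : d <= D (row i z) by rewrite leNgt; apply/negP => h; apply: n1; exists i; exact: ltW.
have [[i0 [i1 [i01 h]]]|n2] := pselect (exists i0 i1, i0 != i1 /\ enorm (row i1 z - row i0 z) <= s).
  by have [v sv] := H2 z i0 i1 cz far i01 h; exists v; exact: steep_mono sv.
have dz : deep Omega d s z.
  have [zO _] := cz; split=> [i|i j ij]; first by [].
  rewrite leNgt; apply/negP => h; apply: n2; exists j, i; split; last exact: ltW.
  by apply/eqP => E; apply: ij.
by have [v sv] := H3 z cz dz; exists v; exact: steep_mono sv.
Qed.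

End SlopeInside.

(** * The deformation *)

Section PointContinuity.
Context {R : realType} {U V : normedModType R}.

Lemma inv_continuous (f : U -> R) x : f x != 0 -> {for x, continuous f} ->
  {for x, continuous (fun y => (f y)^-1)}.
Proof. by move=> f0 cf; exact: cvgV f0 cf. Qed.

Lemma scale_continuous (a : U -> R) (f : U -> V) x : {for x, continuous a} ->
  {for x, continuous f} -> {for x, continuous (fun y => a y *: f y)}.
Proof. by move=> ca cf; exact: cvgZ ca cf. Qed.

End PointContinuity.

Section Field.
Context {R : realType}.
Variables (Omega : set (plane R))
  (G : plane R -> plane R -> R) (g : plane R * plane R -> R) (N : nat) (Gamma : 'rV[R]_N).
Hypotheses (oO : open Omega) (bO : bounded_set Omega) (O0 : Omega !=set0).
Hypothesis gG : forall x y, Omega x -> Omega y -> x <> y ->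
  g (x, y) = G x y + (2 * pi)^-1 * ln (enorm (x - y)).
Hypothesis g1 : Ck 1 (Omega `*` Omega) g.
Variable A : R.
Hypotheses (A0 : 0 < A)
  (HA : forall z : 'M[R]_(N, 2), config Omega z -> exists v, steep Omega g Gamma A z v).
Notation D z := (dist z (boundary Omega)).
Notation dH := (dKR g Gamma).
Notation st := (steep Omega g Gamma).
Implicit Types (z y v : 'M[R]_(N, 2)).

Lemma dKR_linear z : config Omega z -> linear (dH z : _ -> R).
Proof.
move=> cz k u v; have [_ E] := is_diff_KR Gamma oO gG g1 cz.
by rewrite -E linearP.
Qed.

Lemma dKR0 z : config Omega z -> dH z 0 = 0.
Proof.
by move=> cz; have [_ E] := is_diff_KR Gamma oO gG g1 cz; rewrite -E linear0.
Qed.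

Lemma rowD u v i : row i (u + v : 'M[R]_(N, 2)) = row i u + row i v.
Proof. by apply/rowP => k; rewrite !mxE. Qed.

Lemma rowZ (k : R) v i : row i (k *: v) = k *: row i v.
Proof. by apply/rowP => l; rewrite !mxE. Qed.

(** A steep direction is doubled, so that its derivative stays at least 1 nearby. Distances may be
    halved nearby, which gives the second factor 2 in [4 * A]. *)
Lemma near_steep z : config Omega z -> exists v (r : R), 0 < r /\
  forall y, `|z - y| < r -> config Omega y /\ st (4 * A) y v.
Proof.
move=> cz; have [v0 [h1 h2 h3]] := HA cz; pose v := (2 : R) *: v0.
have dv : 2 <= dH z v.
  have := dKR_linear cz 2 v0 0; rewrite addr0 -/v => ->.
  by rewrite dKR0 // addr0 /GRing.scale /=; lra.
have [r1 r10 c1] := near_ex (config_open oO cz).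
have [r2 r20 c2] := cont_ex (@ltr01 R) (@dKR_continuous _ _ _ _ Gamma oO g1 v z cz).
have [zO zd] := cz.
have [m1 m10 hm1] : exists2 m : R, 0 < m & forall i : 'I_N, true -> m <= D (row i z).
  by apply: (finite_pos (P := xpredT) (f := fun i => D (row i z))) => i _; exact: (dist_gt0 oO bO O0).
have [m2 m20 hm2] : exists2 m : R, 0 < m & forall ij : 'I_N * 'I_N, ij.1 != ij.2 ->
    m <= enorm (row ij.1 z - row ij.2 z).
  apply: (finite_pos (P := fun ij => ij.1 != ij.2) (f := fun ij : 'I_N * 'I_N => enorm (row ij.1 z - row ij.2 z))) => -[i j] /= ij.
  apply: enorm_neq0 => /eqP; rewrite subr_eq0 => /eqP; apply: zd; exact/eqP.
pose r := Num.min (Num.min r1 r2) (Num.min (m1 / 8) (m2 / 8)).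
exists v, r; split; first by rewrite !lt_min r10 r20 !divr_gt0.
move=> y; rewrite !lt_min => /andP[/andP[y1 y2] /andP[y3 y4]].
have cy := c1 y y1; split=> //; split.
- by have := c2 y y2; rewrite ltr_norml => /andP[_]; lra.
- move=> i; rewrite rowZ enormZ gtr0_norm //.
  have b1 : D (row i z) <= 2 * D (row i y).
    have := dist_lip oO bO O0 (row i z) (row i y); have := row_dist z y i; have := hm1 i isT; lra.
  have := h2 i; have : A * D (row i z) <= A * (2 * D (row i y)) by rewrite ler_pM2l.
  lra.
- move=> i j; rewrite !rowZ -scalerBr enormZ gtr0_norm //.
  have [->|ij] := eqVneq i j; first by rewrite !subrr enorm0 !mulr0.
  have b1 : enorm (row i z - row j z) <= 2 * enorm (row i y - row j y).
    have := hm2 (i, j) ij => /= q1; have q2 := row_dist z y i; have q3 := row_dist z y j.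
    have := enorm_tri (row i z) (row i y) (row j z); have := enorm_tri (row i y) (row j y) (row j z).
    by rewrite [enorm (row j y - row j z)]enormB; lra.
  have := h3 i j; have : A * enorm (row i z - row j z) <= A * (2 * enorm (row i y - row j y)) by rewrite ler_pM2l.
  lra.
Qed.

(* The conditions defining [steep], made homogeneous in (l, v). *)
Let cone B y (l : R) v : Prop :=
  [/\ l <= dH y v, forall i, enorm (row i v) <= l * (B * D (row i y)) &
      forall i j, enorm (row i v - row j v) <= l * (B * enorm (row i y - row j y))].

(** The cone of pairs (l, v) is convex, so weighted averages of steep directions are steep. *)
Lemma steep_average (B : R) y (s : seq 'M[R]_(N, 2)) (phi : 'M[R]_(N, 2) -> R) V :
  config Omega y -> (forall k, k \in s -> 0 <= phi k) ->
  (forall k, k \in s -> 0 < phi k -> st B y (V k)) ->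
  0 < \sum_(k <- s) phi k ->
  st B y ((\sum_(k <- s) phi k)^-1 *: \sum_(k <- s) phi k *: V k).
Proof.
move=> cy p0 h S0.
have C : cone B y (\sum_(k <- s) phi k) (\sum_(k <- s) phi k *: V k).
  rewrite !big_seq; elim/big_rec2: _ => [|k v l ks [c1 c2 c3]].
    split=> [|i|i j]; last 2 first.
    - by rewrite mul0r (_ : row i 0 = 0) ?enorm0 //; apply/rowP => k; rewrite !mxE.
    - by rewrite mul0r (_ : row i 0 - row j 0 = 0) ?enorm0 //; apply/rowP => k; rewrite !mxE subrr.
    by rewrite dKR0.
  have [pk|pk] := leP (phi k) 0.
    have -> : phi k = 0 by apply/eqP; rewrite eq_le pk p0.
    by rewrite scale0r !add0r.
  have [k1 k2 k3] := h k ks pk.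
  split=> [|i|i j].
  - rewrite dKR_linear // /GRing.scale /=.
    by apply: lerD => //; rewrite -[leLHS]mulr1 ler_pM2l.
  - rewrite rowD rowZ mulrDl; apply: (le_trans (enormD _ _)); apply: lerD => //.
    by rewrite enormZ gtr0_norm // ler_pM2l.
  - rewrite !rowD !rowZ opprD addrACA mulrDl; apply: (le_trans (enormD _ _)); apply: lerD => //.
    by rewrite -scalerBr enormZ gtr0_norm // ler_pM2l.
move: C; move: (\sum_(k <- s) phi k) (\sum_(k <- s) phi k *: V k) S0 => l v l0 [c1 c2 c3].
have li : 0 < l^-1 by rewrite invr_gt0.
split=> [|i|i j].
- have := dKR_linear cy l^-1 v 0; rewrite addr0 => ->.
  by rewrite dKR0 // addr0 /GRing.scale /= ler_pdivlMl ?mulr1.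
- rewrite rowZ enormZ gtr0_norm // ler_pdivrMl //; exact: c2.
- rewrite !rowZ -scalerBr enormZ gtr0_norm // ler_pdivrMl //; exact: c3.
Qed.

(** A partition of unity makes the choice of directions continuous. The value [V z] is steep at all
    [y] within a uniform distance of [z], which is what a straight step from [z] along [V z] needs.
    For this the balls of the cover have only half of the radius from [near_steep]. *)
Lemma steep_field (K : set 'M[R]_(N, 2)) : compact K -> K `<=` config Omega ->
  exists (V : 'M[R]_(N, 2) -> 'M[R]_(N, 2)) (rho : R), 0 < rho /\ forall z, K z ->
    {for z, continuous V} /\
    forall y, `|z - y| < rho -> config Omega y /\ st (4 * A) y (V z).
Proof.
move=> cK Kc.
have : forall z, exists vr : 'M[R]_(N, 2) * R, K z -> 0 < vr.2 /\
    forall y, `|z - y| < 2 * vr.2 -> config Omega y /\ st (4 * A) y vr.1.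
  move=> z; have [Kz|nK] := pselect (K z); last by exists (0, 0).
  have [v [r [r0 h]]] := near_steep (Kc z Kz); exists (v, r / 2) => _ /=.
  by split; [rewrite divr_gt0|rewrite mulrC divfK].
move=> /choice[f Hf].
pose U k := [set y : 'M[R]_(N, 2) | `|k - y| < (f k).2].
have oU k : K k -> open (U k).
  move=> _; rewrite openE => y Uy; rewrite /U /= in Uy.
  have e0 : 0 < (f k).2 - `|k - y| by rewrite subr_gt0.
  refine (ex_near (x := y) e0 _) => y' yy'; rewrite /U /= -(subrKA y).
  by apply: (le_lt_trans (ler_normD _ _)); lra.
have cov : K `<=` cover K U.
  by move=> z Kz; exists z => //; rewrite /U /= subrr normr0; case: (Hf z Kz).
have [s sK scov] : finite_subset_cover K U K.
  by move: cK; rewrite compact_cover; apply.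
pose e := finmap.enum_fset s.
have eK k : k \in e -> K k by move=> ke; have := sK k ke; rewrite inE.
pose phi z k := Num.max 0 ((f k).2 - `|k - z|).
have phi0 z k : 0 <= phi z k by rewrite le_max lexx.
have phip z k : 0 < phi z k -> `|k - z| < (f k).2.
  by rewrite lt_max ltxx /= subr_gt0.
have Sp z : K z -> 0 < \sum_(k <- e) phi z k.
  move=> Kz; have [k ke Uk] := scov z Kz.
  have ke' : k \in e by [].
  rewrite (perm_big _ (perm_to_rem ke')) big_cons /=.
  apply: ltr_pwDl; last by apply: sumr_ge0.
  by rewrite lt_max subr_gt0; apply/orP; right; exact: Uk.
have [rho rho0 hrho] : exists2 rho : R, 0 < rho & forall k, k \in e -> rho <= (f k).2.
  elim: (e) eK => [|k e' IH] eK; first by exists 1.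
  have [|rho rho0 h] := IH; first by move=> l le; apply: eK; rewrite inE le orbT.
  have [k0 _] := Hf k (eK k (mem_head _ _)).
  exists (Num.min rho (f k).2); first by rewrite lt_min rho0.
  move=> l; rewrite inE => /orP[/eqP ->|/h lr]; first by rewrite ge_min lexx orbT.
  by rewrite ge_min lr.
exists (fun z => (\sum_(k <- e) phi z k)^-1 *: \sum_(k <- e) phi z k *: (f k).1), rho.
split; first exact: rho0.
move=> z Kz; split.
  have cphi k : continuous (fun z => phi z k).
    apply: cont_max; first exact: cst_continuous.
    apply: (@cont_sub R _ R); first exact: cst_continuous.
    have cd : continuous (fun z => k - z).
      by apply: cont_sub; [exact: cst_continuous|move=> x; exact: cvg_id].
    exact: (cont_comp cd (@norm_continuous _ _)).
  have c1 : continuous (fun z => \sum_(k <- e) phi z k).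
    elim: (e) => [|k e' IH].
      by rewrite (_ : (fun z => _) = cst 0); [exact: cst_continuous|apply/funext => x; rewrite big_nil].
    rewrite (_ : (fun z => _) = fun z => phi z k + \sum_(k <- e') phi z k); last by apply/funext => x; rewrite big_cons.
    by apply: (@cont_add R _ R).
  have c2 : continuous (fun z => \sum_(k <- e) phi z k *: (f k).1).
    elim: (e) => [|k e' IH].
      by rewrite (_ : (fun z => _) = cst 0); [exact: cst_continuous|apply/funext => x; rewrite big_nil].
    rewrite (_ : (fun z => _) = fun z => phi z k *: (f k).1 + \sum_(k <- e') phi z k *: (f k).1); last by apply/funext => x; rewrite big_cons.
    by apply: cont_add => //; apply: cont_scale => //; exact: cst_continuous.
  have ci : {for z, continuous (fun z => (\sum_(k <- e) phi z k)^-1)}.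
    by apply: inv_continuous; [rewrite gt_eqF ?Sp|exact: c1].
  exact: (scale_continuous ci (c2 z)).
move=> y zy; have good k : k \in e -> 0 < phi z k -> config Omega y /\ st (4 * A) y (f k).1.
  move=> ke /phip kz; have [k0] := Hf k (eK k ke); apply.
  rewrite -(subrKA z); apply: (le_lt_trans (ler_normD _ _)).
  by have := hrho k ke; lra.
have cy : config Omega y.
  have [k ke Uk] := scov z Kz; have ke' : k \in e by [].
  by case: (good k ke') => //; rewrite lt_max subr_gt0; apply/orP; right; exact: Uk.
split=> //; apply: steep_average => // [k ke kp|]; last exact: Sp.
by case: (good k ke kp).
Qed.

End Field.

(** * Raising the path function by Euler steps *)

Section Deformation.
Context {R : realType}.
Variables (Omega : set (plane R))
  (G : plane R -> plane R -> R) (g : plane R * plane R -> R) (N : nat) (Gamma : 'rV[R]_N).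
Hypotheses (oO : open Omega) (bO : bounded_set Omega) (O0 : Omega !=set0).
Hypothesis gG : forall x y, Omega x -> Omega y -> x <> y ->
  g (x, y) = G x y + (2 * pi)^-1 * ln (enorm (x - y)).
Hypothesis g1 : Ck 1 (Omega `*` Omega) g.
Notation D z := (dist z (boundary Omega)).
Notation dH := (dKR g Gamma).
Notation H := (KirchhoffRouth Gamma G g).
Notation st := (steep Omega g Gamma).
Implicit Types (z y v : 'M[R]_(N, 2)).

Lemma KR_increase z v (rho s : R) : 0 < s -> s * `|v| < rho ->
  (forall y, `|z - y| < rho -> config Omega y /\ 1 <= dH y v) ->
  H z + s <= H (z + s *: v).
Proof.
move=> s0 sv h; pose P (t : R) := z + t *: v.
have near t : 0 <= t <= s -> `|z - P t| < rho.
  move=> /andP[t0 ts]; rewrite /P opprD addNKr normrN normrZ ger0_norm //.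
  by apply: le_lt_trans sv; rewrite ler_wpM2r.
have dP (t : R) : is_diff t P (fun k : R => k *: v).
  have := is_diffD (is_diff_cst z t) (is_diff_scalel t v).
  by rewrite (_ : 0 + _ = fun k => k *: v) //; apply/funext => k; rewrite !fctE add0r.
have dHP t : 0 <= t <= s -> is_derive t (1 : R) (fun t => H (P t)) (dH (P t) v).
  move=> /near /h[cy _]; have [d1 e1] := is_diff_comp (dP t) (is_diff_KR Gamma oO gG g1 cy).
  have e2 : 'D_1 (fun t => H (P t)) t = dH (P t) v.
    by rewrite deriveE // -[fun t => H (P t)]/(H \o P) e1 /= scale1r.
  by split; [exact: diff_derivable|].
have cHP : {within `[0, s], continuous (fun t => H (P t))}.
  apply: derivable_within_continuous => t; rewrite in_itv /= => ts; by case: (dHP t ts).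
have := @MVT_segment R (fun t => H (P t)) (fun t => dH (P t) v) 0 s (ltW s0) _ cHP.
case.
  move=> t; rewrite in_itv /= => /andP[t0 ts]; apply: dHP; by rewrite !ltW.
move=> c; rewrite in_itv /= => cs; rewrite /P scale0r addr0 subr0 => E.
have [_ d1] := h _ (near c cs).
have : s <= dH (P c) v * s by rewrite ler_peMl // ltW.
by rewrite -E; lra.
Qed.

Lemma KR_bounded_below (d : R) : 0 < d -> exists c0 : R, forall z, deep Omega d d z -> c0 <= H z.
Proof.
move=> d0; pose P z (e : R) := e * - H z <= 1.
have cf z : deep Omega d d z -> config Omega z.
  move=> [h1 h2]; split=> [i|i j ij E]; first by case: (h1 i).
  by have := h2 i j ij; rewrite E subrr enorm0 leNgt d0.
have [|r r0 h] := @compact_unif R _ (deep Omega d d) P (@deep_compact R Omega oO bO O0 N d d d0).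
  move=> z dz; have [dd _] := is_diff_KR Gamma oO gG g1 (cf z dz).
  have [r r0 hr] := cont_ex (@ltr01 R) (differentiable_continuous dd).
  have M0 : 0 < `|H z| + 1 by have := normr_ge0 (H z); lra.
  exists (Num.min r (`|H z| + 1)^-1); first by rewrite lt_min r0 invr_gt0.
  move=> y e dy; rewrite !lt_min => /andP[zy _] /and3P[e0 _ eM].
  have := hr y zy; rewrite ltr_norml => /andP[_ h1].
  have h2 : - H y <= `|H z| + 1 by have := lerNnormlW (lexx `|H z|); lra.
  apply: (@le_trans _ _ (e * (`|H z| + 1))); first by rewrite ler_pM2l.
  by rewrite -ler_pdivlMr // mul1r ltW.
exists (- (2 / r)) => z dz.
have : P z (r / 2) by apply: h => //; apply/andP; split; lra.
rewrite /P mulrC -ler_pdivlMr ?divr_gt0 // mul1r invf_div; lra.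
Qed.

Lemma dist_bounded : exists2 B : R, 0 < B & forall x, Omega x -> D x <= B.
Proof.
have [b bb] := boundary_neq0 oO bO O0; have [B B0 hB] := bounded_setP bO.
have h : 0 <= 2 * (B + `|b|) by rewrite mulr_ge0 // addr_ge0 // ltW.
exists (2 * (B + `|b|) + 1); first by lra.
move=> x /hB xB; apply: (le_trans (dist_le_boundary x bb)).
apply: (le_trans (enorm_le_norm _)); have := ler_normB x b; lra.
Qed.

(** A bound for repeated contraction that depends on [n * x] only, hence does not degenerate when a
    fixed time is divided into more steps. *)
Lemma expR_contract (x : R) (n k : nat) : 0 <= x <= 2^-1 -> (k <= n)%N ->
  expR (- (2 * (n%:R * x))) <= (1 - x) ^+ k.
Proof.
move=> /andP[x0 x1] kn; have x10 : 0 <= 1 - x by lra.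
apply: (@le_trans _ _ ((1 - x) ^+ n)); last by apply: ler_wiXn2l => //; lra.
have -> : - (2 * (n%:R * x)) = n%:R * - (2 * x) by ring.
rewrite expRM_natl lerXn2r ?nnegrE ?expR_ge0 // expRN.
rewrite invf_ple ?posrE ?expR_gt0 //; last by lra.
apply: le_trans (expR_ge1Dx _).
rewrite -[_^-1]mul1r ler_pdivrMr; last by lra.
have : 0 <= x * (1 - 2 * x) by apply: mulr_ge0; lra.
lra.
Qed.

Section Deform.
Variables (A : R) (a : plane R) (rho : R).
Hypotheses (A0 : 0 < A)
  (HA : forall z, config Omega z -> exists v, st A z v).
Hypotheses (rho0 : 0 < rho) (ha : forall x, Omega x -> rho <= `|x - a|).

(** Euler steps along a continuous field replace the flow, so no differential equation has to be
    solved. [C] is chosen before the family [f0]: it must not depend on the winding of the torus to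
    which the lemma is applied. *)
Lemma deform (tau d : R) : 0 < tau -> 0 < d -> exists C : R,
  forall (T : topologicalType) (f0 : T -> 'M[R]_(N, 2)) (al0 : 'I_N -> T -> R),
  continuous f0 -> (forall t, deep Omega d d (f0 t)) ->
  (forall i, continuous (al0 i)) ->
  (forall i t, polar (row i (f0 t) - a) (al0 i t)) ->
  exists (f : T -> 'M[R]_(N, 2)) (al : 'I_N -> T -> R),
  [/\ forall t, config Omega (f t), forall i, continuous (al i),
      forall i t, polar (row i (f t) - a) (al i t),
      forall i t, `|al i t - al0 i t| <= C & forall t, H (f0 t) + tau <= H (f t)].
Proof.
move=> tau0 d0; pose A' := 4 * A; have A'0 : 0 < A' by rewrite mulr_gt0.
(* A lower bound for all distances during the deformation, whatever the number of steps. So the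
   field can be chosen on [deep Omega m m] before the step size. *)
pose m := d * expR (- (2 * (tau * A'))).
have m0 : 0 < m by rewrite mulr_gt0 // expR_gt0.
have cf w z : 0 < w -> deep Omega w w z -> config Omega z.
  move=> w0 [h1 h2]; split=> [i|i j ij E]; first by case: (h1 i).
  by have := h2 i j ij; rewrite E subrr enorm0 leNgt w0.
have [V [r [r0 hV]]] := steep_field oO bO O0 gG g1 A0 HA
  (@deep_compact R Omega oO bO O0 N m m m0) (fun z => cf m z m0).
have [B B0 hB] := dist_bounded.
pose L := A' * B; have L0 : 0 < L by rewrite mulr_gt0.
(* The three terms bound the step length [s]: each step shrinks distances at most by the factor
   [1 - s * A' >= 1 / 2], it stays where the chosen direction is steep, and it turns the points
   around [a] by less than pi / 2. *)
pose n := (Num.bound (tau * (2 * A' + 2 * L / r + 2 * L / rho))).+1.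
have n0 : 0 < n%:R :> R by rewrite ltr0n.
pose s := tau / n%:R; have s0 : 0 < s by rewrite divr_gt0.
have ns : n%:R * s = tau by rewrite mulrC divfK // gt_eqF.
have X0 : 0 < 2 * A' + 2 * L / r + 2 * L / rho by rewrite !addr_gt0 ?divr_gt0 ?mulr_gt0.
have sX : s * (2 * A' + 2 * L / r + 2 * L / rho) <= 1.
  rewrite /s mulrAC ler_pdivrMr // mul1r ltW //.
  apply: (lt_le_trans (archi_boundP _)); first by rewrite ltW // mulr_gt0.
  by rewrite ler_nat /n leqnSn.
have q1 : 0 < s * A' by rewrite mulr_gt0.
have q2 : 0 < s * (2 * L / r) by rewrite mulr_gt0 // divr_gt0 ?mulr_gt0.
have q3 : 0 < s * (2 * L / rho) by rewrite mulr_gt0 // divr_gt0 ?mulr_gt0.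
have sA : s * A' <= 2^-1 by lra.
have sr : s * L < r.
  have h : s * (2 * L / r) <= 1 by lra.
  have sL : 0 < s * L by rewrite mulr_gt0.
  have e : s * L = s * (2 * L / r) * r / 2 by field; rewrite gt_eqF.
  have : s * (2 * L / r) * r <= r by rewrite ger_pMl.
  lra.
have srho : s * L <= rho / 2.
  have h : s * (2 * L / rho) <= 1 by lra.
  have e : s * L = s * (2 * L / rho) * rho / 2 by field; rewrite gt_eqF.
  have : s * (2 * L / rho) * rho <= rho by rewrite ger_pMl.
  lra.
pose x := 1 - s * A'; have x0 : 0 < x by rewrite /x; lra.
exists (n%:R * (pi / 2)) => T f0 al0 cf0 df0 cal0 pal0.
suff : forall k, (k <= n)%N -> exists (f : T -> 'M[R]_(N, 2)) (al : 'I_N -> T -> R),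
  [/\ continuous f /\ forall i, continuous (al i), forall t, deep Omega (x ^+ k * d) (x ^+ k * d) (f t),
      forall i t, polar (row i (f t) - a) (al i t),
      forall i t, `|al i t - al0 i t| <= k%:R * (pi / 2) & forall t, H (f0 t) + k%:R * s <= H (f t)].
  move=> /(_ n (leqnn n)) [f [al [[c1 c2] h1 h2 h3 h4]]]; exists f, al; split; [|exact: c2|exact: h2|exact: h3|].
    move=> t; apply: (cf (x ^+ n * d)); last exact: h1.
    by rewrite mulr_gt0 ?exprn_gt0.
  by move=> t; rewrite -ns.
elim=> [|k IH] kn.
  exists f0, al0; split=> // [t|i t|t]; first by rewrite expr0 mul1r.
    by rewrite subrr normr0 mul0r.
  by rewrite mul0r addr0.
have [f [al [[c1 c2] h1 h2 h3 h4]]] := IH (ltnW kn).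
have xk0 : 0 < x ^+ k * d by rewrite mulr_gt0 ?exprn_gt0.
have mk : m <= x ^+ k * d.
  rewrite /m mulrC ler_pM2r // /x -ns -[X in 2 * X]mulrA; apply: expR_contract; last exact: ltnW.
  by rewrite sA (ltW q1).
have Kf t : deep Omega m m (f t).
  have [e1 e2] := h1 t; split=> [i|i j ij]; last exact: le_trans (e2 i j ij).
  by have [e3 e4] := e1 i; split=> //; exact: le_trans e4.
have hf t := (hV (f t) (Kf t)).2.
have stf t : st A' (f t) (V (f t)) by case: (hf t (f t)); rewrite ?subrr ?normr0.
have Vn t i : enorm (row i (V (f t))) <= L.
  have [_ e2 _] := stf t; apply: (le_trans (e2 i)); rewrite ler_pM2l //; apply: hB.
  by case: (Kf t) => /(_ i)[].
have VL t : `|V (f t)| <= L.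
  apply: mx_norm_le => [|i j]; first exact: ltW.
  apply: le_trans (Vn t i); have := coord_le_enorm (row i (V (f t))) j; by rewrite mxE.
pose f' t := f t + s *: V (f t).
have cf' : continuous f'.
  apply: cont_add => //; apply: cont_scale; first exact: cst_continuous.
  move=> t; apply: continuous_comp; first exact: c1.
  by case: (hV (f t) (Kf t)).
have rowf' t i : row i (f' t) = row i (f t) + s *: row i (V (f t)).
  by rewrite /f' rowD rowZ.
have svn t i : enorm (s *: row i (V (f t))) <= s * A' * D (row i (f t)).
  rewrite enormZ gtr0_norm // -mulrA ler_pM2l //; by case: (stf t).
have df' t : deep Omega (x ^+ k.+1 * d) (x ^+ k.+1 * d) (f' t).
  have [e1 e2] := h1 t; rewrite exprS -mulrA; split=> [i|i j ij].
    have [e3 e4] := e1 i; have Dp := dist_gt0 oO bO O0 e3.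
    have lt : enorm (row i (f t) - row i (f' t)) <= s * A' * D (row i (f t)).
      by rewrite rowf' opprD addNKr enormN.
    have half : s * A' * D (row i (f t)) <= 2^-1 * D (row i (f t)) by rewrite ler_pM2r.
    split; first by apply: (dist_in oO e3); lra.
    have e5 : x * (x ^+ k * d) <= x * D (row i (f t)) by rewrite ler_pM2l.
    apply: (le_trans e5); have := dist_lip oO bO O0 (row i (f t)) (row i (f' t)).
    rewrite /x; lra.
  have e3 := e2 i j ij.
  have e5 : x * (x ^+ k * d) <= x * enorm (row i (f t) - row j (f t)) by rewrite ler_pM2l.
  apply: (le_trans e5); rewrite !rowf'.
  have [_ _ /(_ i j) e6] := stf t.
  have e7 : enorm (s *: row i (V (f t)) - s *: row j (V (f t))) <= s * A' * enorm (row i (f t) - row j (f t)).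
    by rewrite -scalerBr enormZ gtr0_norm // -mulrA ler_pM2l.
  have := enormB (row i (f t)) (row j (f t)).
  set u := row i (f t) - row j (f t) in e3 e5 e7 *; set w := s *: _ - s *: _ in e7.
  have -> : row i (f t) + s *: row i (V (f t)) - (row j (f t) + s *: row j (V (f t))) = u + w.
    by rewrite /u /w; apply/rowP => l; rewrite !mxE; ring.
  have := enormD (u + w) (- w); rewrite addrK enormN /x => e8 _; lra.
have dpos t i : 0 < dot (row i (f t) - a) (row i (f' t) - a).
  apply: (@dot_pos _ _ _ (rho / 2)); rewrite ?divr_gt0 //.
    rewrite opprB addrA subrK rowf' opprD addNKr normrN.
    apply: (le_trans (norm_le_enorm _)); rewrite enormZ gtr0_norm //.
    by apply: le_trans srho; rewrite ler_pM2l.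
  rewrite mulrC divfK // ?pnatr_eq0 //; apply: ha; by case: (Kf t) => /(_ i)[].
exists f', (fun i t => al i t + ang (row i (f t) - a) (row i (f' t) - a)); split.
- split=> // i; apply: (@cont_add R _ R) => //.
  have cr (h : T -> 'M[R]_(N, 2)) : continuous h -> continuous (fun t => row i (h t) - a).
    move=> ch; apply: cont_sub; last exact: cst_continuous.
    exact: (cont_comp ch (@row_continuous R N i)).
  by apply: ang_continuous => // ; exact: cr.
- exact: df'.
- by move=> i t; apply: polar_step.
- move=> i t; rewrite addrAC; apply: (le_trans (ler_normD _ _)).
  have := ang_lt (row i (f t) - a) (row i (f' t) - a); have := h3 i t; rewrite -natr1; lra.
- move=> t; have := h4 t; have : H (f t) + s <= H (f' t); last by rewrite -natr1; lra.
  apply: (@KR_increase _ _ r) => //; first by apply: le_lt_trans sr; rewrite ler_pM2l.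
  by move=> y /hf[cy [e1 _ _]].
Qed.

End Deform.

End Deformation.

(** * Linking *)

Section Rays.
Context {R : realType}.

Definition ray_angle (N : nat) (i : 'I_N) : R := 2 * pi * i%:R / N%:R.

Definition unit_vector (t : R) : plane R := \row_k (if k == 0 then cos t else sin t).

Lemma enorm_unit (t : R) : enorm (unit_vector t) = 1.
Proof. by rewrite /enorm dotE !mxE /= -!expr2 cos2Dsin2 sqrtr1. Qed.

Lemma polarE (z : plane R) t : polar z t -> z = enorm z *: unit_vector t.
Proof.
by move=> [z0 z1]; apply/rowP => k; rewrite !mxE; case: (ord2P k) => -> /=.
Qed.

Lemma polar_unit (t : R) : polar (unit_vector t) t.
Proof. by split; rewrite enorm_unit mul1r !mxE. Qed.

Lemma ray_angle_bounds N (i : 'I_N) : 0 <= ray_angle i < 2 * pi.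
Proof.
have N0 : 0 < N%:R :> R by rewrite ltr0n; apply: leq_ltn_trans (ltn_ord i).
have p0 := pi_gt0 R.
rewrite /ray_angle divr_ge0 ?mulr_ge0 ?ler0n ?(ltW p0) //=.
by rewrite ltr_pdivrMr // ltr_pM2l ?mulr_gt0 // ltr_nat.
Qed.

Lemma ray_angle_inj N (i j : 'I_N) : ray_angle i = ray_angle j -> i = j.
Proof.
have N0 : N%:R != 0 :> R by rewrite pnatr_eq0 -lt0n; apply: leq_ltn_trans (ltn_ord i).
have p0 : 2 * pi != 0 :> R by rewrite gt_eqF // mulr_gt0 // pi_gt0.
move=> /(mulIf (invr_neq0 N0)) /(mulfI p0) /eqP; rewrite eqr_nat => /eqP; exact: val_inj.
Qed.

(** With r_i the distance to [a] and u_i the unit vectors, r_i (u_i - u_j) = (z_i - z_j) - (r_i -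
    r_j) u_j. As |r_i - r_j| <= |z_i - z_j|, the left side is at most 2 |z_i - z_j|. *)
Lemma ray_separation N (a : plane R) (rho : R) : 0 < rho -> exists2 d : R, 0 < d &
  forall z : 'M[R]_(N, 2), (forall i, rho <= enorm (row i z - a)) ->
  (forall i, polar (row i z - a) (ray_angle i)) ->
  forall i j, i != j -> d <= enorm (row i z - row j z).
Proof.
move=> rho0; pose u (i : 'I_N) := unit_vector (ray_angle i).
have [m m0 hm] : exists2 m : R, 0 < m & forall ij : 'I_N * 'I_N, ij.1 != ij.2 ->
    m <= enorm (u ij.1 - u ij.2).
  apply: (finite_pos (P := fun ij => ij.1 != ij.2) (f := fun ij : 'I_N * 'I_N => enorm (u ij.1 - u ij.2))) => -[i j] /= ij.
  apply: enorm_neq0 => /eqP; rewrite subr_eq0 => /eqP E; move/eqP: ij; apply.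
  apply: ray_angle_inj; apply: (polar_unique (z := u i)); rewrite ?enorm_unit //.
  - exact: polar_unit.
  - by rewrite E; exact: polar_unit.
  - have /andP[a1 a2] := ray_angle_bounds i; have /andP[b1 b2] := ray_angle_bounds j.
    by rewrite ltr_norml; apply/andP; split; lra.
exists (rho * m / 2); first by rewrite divr_gt0 ?mulr_gt0.
move=> z hz pz i j ij; have := hm (i, j) ij => /= mij.
set ri := enorm (row i z - a); set rj := enorm (row j z - a).
have Zi : row i z - a = ri *: u i by apply: polarE.
have Zj : row j z - a = rj *: u j by apply: polarE.
have E : row i z - row j z = ri *: (u i - u j) + (ri - rj) *: u j.
  rewrite scalerBr scalerBl addrA subrK -Zi -Zj opprB addrA subrK //.
have b1 : `|ri - rj| <= enorm (row i z - row j z).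
  have t1 := enorm_tri (row i z) (row j z) a; have t2 := enorm_tri (row j z) (row i z) a.
  rewrite [enorm (row j z - row i z)]enormB in t2.
  by rewrite ler_norml; apply/andP; split; rewrite /ri /rj; lra.
have b2 : ri * enorm (u i - u j) <= enorm (row i z - row j z) + `|ri - rj|.
  have -> : ri * enorm (u i - u j) = enorm (ri *: (u i - u j)).
    by rewrite enormZ ger0_norm // enorm_ge0.
  have -> : ri *: (u i - u j) = row i z - row j z - (ri - rj) *: u j by rewrite E addrK.
  by apply: (le_trans (enormD _ _)); rewrite enormN enormZ enorm_unit mulr1.
have b3 : rho * m <= ri * enorm (u i - u j) by apply: ler_pM => //; [exact: ltW|exact: ltW|exact: hz].
lra.
Qed.

End Rays.

Section Level.
Context {R : realType}.
Variables (Omega : set (plane R)) (eps0 : R) (p : plane R -> plane R)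
  (G : plane R -> plane R -> R) (g : plane R * plane R -> R) (N : nat) (Gamma : 'rV[R]_N).
Hypothesis HG : hypothesis_G Omega eps0 p G g.

(** No distance to the boundary is prescribed: [g] is bounded above on all of Omega, and G is
    bounded off the diagonal up to the boundary. *)
Lemma KR_bounded_above (d : R) : 0 < d -> exists b : R, forall z, config Omega z ->
  (forall i j, i != j -> d <= enorm (row i z - row j z)) -> KirchhoffRouth Gamma G g z <= b.
Proof.
move=> d0; have [C1 C10 h1] := g_bounded_above HG; have [C2 C20 h2] := G_off_diagonal HG d0.
exists (\sum_j Gamma 0 j ^+ 2 * C1 + \sum_i \sum_(j | j != i) `|Gamma 0 i * Gamma 0 j| * C2).
move=> z [zO zd] hz; apply: lerD.
  by apply: ler_sum => j _; rewrite ler_wpM2l ?sqr_ge0 //; exact: h1.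
apply: ler_sum => i _; apply: ler_sum => j ji.
apply: (le_trans (ler_norm _)); rewrite normrM ler_wpM2l //.
have ij : i != j by rewrite eq_sym.
apply: le_trans (h2 _ _ (zO i) (zO j) (hz i j ij)).
by rewrite /C1_bound -addrA lerDl addr_ge0 ?enorm_ge0.
Qed.

End Level.

Lemma matrix_continuous {R : realType} {T : normedModType R} m n (f : T -> 'M[R]_(m, n)) :
  (forall i, continuous (fun t => row i (f t))) -> continuous f.
Proof.
move=> h t; apply: ex_cont => e e0.
have H : \forall t' \near t, forall i, `|row i (f t) - row i (f t')| < e.
  refine (@filter_forall T _ (fun i t' => `|row i (f t) - row i (f t')| < e) (nbhs t) _ _) => i.
  have [r r0 hr] := cont_ex e0 (h i t); exact: (ex_near r0).
have [r r0 hr] := near_ex H; exists r => // y ty.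
apply: mx_norm_lt => // i j; have := hr y ty i; apply: le_lt_trans.
by have := entry_le (row i (f t) - row i (f y)) 0 j; rewrite !mxE.
Qed.

Theorem theorem2p13 (R : realType) (Omega : set (plane R)) (eps0 : R)
    (p : plane R -> plane R) (G : plane R -> plane R -> R)
    (g : plane R * plane R -> R) (Omega_bounded : bounded_set Omega)
    (Omega_domain : domain Omega) (Omega_C3 : C3_boundary Omega)
    (Omega_pi1 : pi1_nontrivial Omega)
    (Hp : collar_projection Omega eps0 p)
    (HG : hypothesis_G Omega eps0 p G g)
    (N : nat) (Gamma : 'rV[R]_N) (Gamma_boundary : boundary_admissible Gamma)
    (Gamma_Delta : Delta_admissible Gamma) :
  exists2 z : 'M[R]_(N, 2),
    config Omega z & critical_point (KirchhoffRouth Gamma G g) z.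
Proof.
have [oO _ O0] := Omega_domain; have gG := g_continuation HG; have g1 := g_C1 HG.
(* The slope estimates need nonzero strengths. A vanishing one contradicts Delta-admissibility for
   pairs, unless it belongs to the only vortex; then H vanishes identically. *)
have [[i0 /eqP Gi0]|Gn] := pselect (exists i, Gamma 0 i == 0).
  have [x0 Ox0] := O0.
  have one j : j = i0.
    apply/eqP; apply: contrapT => /negP ji.
    have C2 : (2 <= #|[set i0; j]%SET|)%N by rewrite cards2 eq_sym ji.
    have /eqP := Gamma_Delta _ C2; apply; apply: big1 => i iC; apply: big1 => k /andP[kC ki].
    move: iC kC ki; rewrite !finset.inE => /orP[/eqP ->|/eqP ->]; first by rewrite Gi0 mul0r.
    by move=> /orP[/eqP ->|/eqP ->]; rewrite ?eqxx // Gi0 mulr0.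
  have cz : config Omega (\matrix_(i < N) x0).
    by split=> [i|i j ij]; [rewrite rowK|case: ij; rewrite (one i) (one j)].
  exists (\matrix_(i < N) x0) => //.
  have [dd dE] := is_diff_KR Gamma oO gG g1 cz; split=> // v; rewrite dE /dKR.
  rewrite big1 => [|j _]; last by rewrite (one j) Gi0 expr0n mul0r.
  by rewrite add0r big1 // => i _; rewrite big1 // => j _; rewrite (one j) Gi0 mulr0 mul0r.
have {}Gn i : Gamma 0 i != 0 by apply/negP => h; apply: Gn; exists i.
apply: contrapT => noc.
have nc z : config Omega z -> ~ critical_point (KirchhoffRouth Gamma G g) z.
  by move=> cz crit; apply: noc; exists z.
have [A A0 HA] := slope oO Omega_bounded O0 Omega_C3 Hp HG Gamma_boundary Gamma_Delta Gn nc.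
have [E [E0 EO cE cF bE]] := separation oO Omega_bounded Omega_pi1.
have [a [Ea [rho rho0 ha]]] := exterior_point oO Omega_C3 E0 EO cF.
have [d d0 loops] := annulus_loops N EO cE cF bE Ea rho0 ha.
have [dr dr0 hray] := ray_separation N a rho0.
have [b hb] := KR_bounded_above Gamma HG dr0.
have [c0 hc0] := KR_bounded_below Gamma oO Omega_bounded O0 gG g1 d0.
(* A gain that exceeds the difference between the upper bound on the rays and the lower bound on the
   torus. *)
pose tau := Num.max (b - c0) 0 + 1.
have tau0 : 0 < tau by rewrite /tau; have : 0 <= Num.max (b - c0) 0 by [rewrite le_max lexx orbT]; lra.
have tau1 : b - c0 < tau by rewrite /tau; have : b - c0 <= Num.max (b - c0) 0 by [rewrite le_max lexx]; lra.
have [C hC] := deform oO Omega_bounded O0 gG g1 A0 HA rho0 ha tau0 d0.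
(* The deformation changes angles by at most [C], and the angles of the rays lie in [0, 2 pi); with
   this margin the sign conditions at -1 and 1 survive. *)
have [gam [al [cgam cal pal alB [tube apart]]]] := loops (`|C| + 2 * pi).
pose f0 (t : 'rV[R]_N) : 'M[R]_(N, 2) := \matrix_(i < N) gam i (t 0 i).
have rf0 t i : row i (f0 t) = gam i (t 0 i) by rewrite rowK.
have cc i : continuous (fun t : 'rV[R]_N => t 0 i) by exact: coord_continuous.
have cf0 : continuous f0.
  apply: matrix_continuous => i.
  rewrite (_ : (fun t => row i (f0 t)) = fun t => gam i (t 0 i)); last by apply/funext.
  exact: (cont_comp (cc i) (cgam i)).
have df0 t : deep Omega d d (f0 t).
  split=> [i|i j ij]; rewrite !rf0; last first.
    by apply: le_trans (norm_le_enorm _); apply: apart; exact/eqP.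
  split; first by apply: (tube i (t 0 i)); rewrite subrr normr0.
  apply: le_dist => // q bq; apply: le_trans (norm_le_enorm _); rewrite leNgt; apply/negP => h.
  exact: (boundary_notin oO bq (tube _ _ _ h)).
have [|i t|f [th [cf cth pth thC gain]]] := hC _ f0 (fun i t => al i (t 0 i)) cf0 df0.
- by move=> i; exact: (cont_comp (cc i) (cal i)).
- by rewrite rf0.
have C0 := ler_norm C; have pp := pi_gt0 R.
have [||||t ht] := @poincare_miranda R N 1 (fun i t => th i t - ray_angle i).
- exact: ltr01.
- by move=> i; apply: (@cont_sub R _ R) => //; exact: cst_continuous.
- move=> i t ti; have := thC i t; rewrite ti ler_norml => /andP[_ h1].
  by have [_ h2] := alB i; have /andP[h3 _] := ray_angle_bounds (R := R) i; lra.
- move=> i t ti; have := thC i t; rewrite ti ler_norml => /andP[h1 _].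
  by have [h2 _] := alB i; have /andP[_ h3] := ray_angle_bounds (R := R) i; lra.
have fO i : Omega (row i (f t)) by case: (cf t).
have H1 : KirchhoffRouth Gamma G g (f t) <= b.
  apply: hb => //; apply: hray => i.
    by apply: le_trans (norm_le_enorm _); exact: ha.
  have := pth i t; have -> // : th i t = ray_angle i.
  by apply/eqP; rewrite -subr_eq0; apply/eqP; exact: ht.
by have := gain t; have := hc0 (f0 t) (df0 t); lra.
Qed.
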